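(* Let $\Omega_+,\Omega_-\subset\mathbb{C}$ be compact domains with Lipschitz boundaries whose closed convex hulls satisfy $\operatorname{Co}(\Omega_+)\cap\operatorname{Co}(\Omega_-)=\varnothing$. Let $V=v_+\chi_{\Omega_+}-v_-\chi_{\Omega_-}$, where $v_\pm$ are bounded non-negative functions such that $\inf_{\Omega_\pm}v_\pm>0$. Suppose that there exist $\theta\in\mathbb{R}$ and $\mathbf{c}\in\mathbb{C}$ such that one of the maps $\varphi(z)=e^{i\theta}z+\mathbf{c}$ or $\varphi(z)=e^{i\theta}\bar z+\mathbf{c}$ satisfies $\varphi(\Omega_+)=\Omega_-$ and $\varphi(\Omega_-)=\Omega_+$. Then the asymptotic estimates $$\exp\Bigl(-\frac{n\log n}{\delta_\pm}+o(n\log n)\Bigr)\leq\lambda_n^\pm\leq\exp\Bigl(-\frac{n\log n}{\Delta_\pm}+o(n\log n)\Bigr),\quad n\to\infty,$$ hold with $\delta_+=\delta_-=\Delta_+=\Delta_-=1/2$. Moreover, the remainder estimate can be improved: for both choices of sign, $$\lambda_n^\pm=e^{-2n\log n+O(n)},\quad n\to\infty .$$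
   Context: $dm$ is Lebesgue measure on $\mathbb{C}$. The Fock space $\mathcal{F}^2$ is the Hilbert space of entire functions $f$ with $\|f\|_{\mathcal{F}^2}^2=\int_{\mathbb{C}}|f(z)|^2e^{-|z|^2}\,dm(z)<\infty$, and $P_{\mathcal{F}^2}$ is the orthogonal projection in $L^2(\mathbb{C},e^{-|z|^2}dm(z))$ onto $\mathcal{F}^2$. For a bounded compactly supported function $V:\mathbb{C}\to\mathbb{R}$ the Bargmann-Toeplitz operator with symbol $V$ is $T_V:\mathcal{F}^2\to\mathcal{F}^2$, $T_Vf=P_{\mathcal{F}^2}(Vf)$; it is compact and self-adjoint. $\lambda_1^+\geq\lambda_2^+\geq\cdots$ is the sequence of positive eigenvalues of $T_V$ enumerated with multiplicities (if there are only $k$ of them, $\lambda_n^+=0$ for $n>k$); $\lambda_1^-\geq\lambda_2^-\geq\cdots$ is the corresponding sequence of positive eigenvalues of $-T_V=T_{-V}$, appended by zeros if necessary. $\chi_\Omega$ is the characteristic function of $\Omega$. The relation $\lambda_n=e^{-2n\log n+O(n)}$ means $\log\lambda_n=-2n\log n+O(n)$. *)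

(* Defs.v *)
From HB Require Import structures.
From mathcomp Require Import all_boot all_order all_algebra.
From mathcomp Require Import all_classical all_reals all_analysis.
From mathcomp Require Import complex.

Set Implicit Arguments.
Unset Strict Implicit.
Unset Printing Implicit Defensive.

Import Order.TTheory GRing.Theory Num.Theory.
Import numFieldNormedType.Exports.

Local Open Scope classical_set_scope.
Local Open Scope ring_scope.
Local Open Scope complex_scope.

(* The complex plane is [R[i]^o]: its topology is the one induced by the modulus
   and derivatives on it are complex derivatives. *)

(* [R[i]] carries no measurable structure in the library, so [dm] is the planar
   Lebesgue measure on pairs (real part, imaginary part). *)
Definition planar_lebesgue (R : realType) :
    {measure set (measurableTypeR R * measurableTypeR R)%type -> \bar R} :=
  (@lebesgue_measure R \x @lebesgue_measure R)%E.

Definition to_complex (R : realType) (p : R * R) : R[i]^o := p.1 +i* p.2.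

(* Lebesgue measurability on C, as equality almost everywhere with a Borel
   function. *)
Definition lebesgue_measurable_fun (R : realType) (v : R[i]^o -> R) : Prop :=
  exists2 g : (measurableTypeR R * measurableTypeR R)%type -> measurableTypeR R,
    measurable_fun [set: (measurableTypeR R * measurableTypeR R)%type] g &
    {ae planar_lebesgue R, forall p, v (to_complex p) = g p}.

Definition gauss_weight (R : realType) (z : R[i]^o) : R :=
  expR (- Normc.normc z ^+ 2).

Definition cintegral (R : realType) (F : R[i]^o -> R[i]^o) : R[i]^o :=
  Rintegral (planar_lebesgue R) setT (fun p => complex.Re (F (to_complex p))) +i*
  Rintegral (planar_lebesgue R) setT (fun p => complex.Im (F (to_complex p))).

Definition fock_dot (R : realType) (f g : R[i]^o -> R[i]^o) : R[i]^o :=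
  cintegral (fun z => f z * (g z)^* * (gauss_weight z)%:C).

Definition entire (R : realType) (f : R[i]^o -> R[i]^o) : Prop :=
  forall z, derivable f z 1.

Definition fock (R : realType) : set (R[i]^o -> R[i]^o) :=
  [set f | entire f /\
    (\int[planar_lebesgue R]_p
       (Normc.normc (f (to_complex p)) ^+ 2 * gauss_weight (to_complex p))%:E
     < +oo)%E].

(* The orthogonal projection of [h] (an L^2 function for the Gaussian weight) on
   the Fock space: the element [g] of the Fock space with [h - g] orthogonal to
   the Fock space.  It exists because the Fock space is closed; the default
   value [0] of [xget] is never used on L^2 functions. *)
Definition fock_proj (R : realType) (h : R[i]^o -> R[i]^o) : R[i]^o -> R[i]^o :=
  xget (fun=> 0) [set g | fock g /\
    forall k, fock k -> fock_dot (fun z => h z - g z) k = 0].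

Definition toeplitz (R : realType) (V : R[i]^o -> R) (f : R[i]^o -> R[i]^o) :
    R[i]^o -> R[i]^o :=
  fock_proj (fun z => (V z)%:C * f z).

Definition toeplitz_eigenspace (R : realType) (V : R[i]^o -> R) (mu : R) :
    set (R[i]^o -> R[i]^o) :=
  [set f | fock f /\ forall z, toeplitz V f z = mu%:C * f z].

Definition has_dimension (R : realType) (E : set (R[i]^o -> R[i]^o)) (k : nat) :
    Prop :=
  exists e : 'I_k -> R[i]^o -> R[i]^o,
    (forall i, E (e i)) /\
    (forall f, E f -> exists! c : 'rV[R[i]]_k,
       forall z, f z = \sum_(i < k) c 0 i * e i z).

(* [lam 1 >= lam 2 >= ...] enumerates the positive eigenvalues of [T_V] with
   multiplicities, followed by zeros if there are finitely many of them; [lam 0]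
   is irrelevant.  When [mu] is not an eigenvalue the last clause holds with
   [k = 0], i.e., [mu] is not a value of [lam]. *)
Definition positive_eigenvalues (R : realType) (V : R[i]^o -> R)
    (lam : nat -> R) : Prop :=
  [/\ forall n, (0 < n)%N -> 0 <= lam n,
      forall m n, (0 < m)%N -> (m <= n)%N -> lam n <= lam m &
      forall mu : R, 0 < mu -> exists2 k : nat,
        has_dimension (toeplitz_eigenspace V mu) k &
        ([set n | (0 < n)%N /\ lam n = mu] #= `I_k)%card].

(* A domain is a nonempty connected open set; a compact domain is the closure of
   a bounded one. *)
Definition compact_domain (R : realType) (Omega : set R[i]^o) : Prop :=
  compact Omega /\
  exists D : set R[i]^o,
    [/\ open D, connected D, D !=set0 & Omega = closure D].

(* Near each boundary point [p], in the orthonormal coordinates (s, t) given by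
   [z = p + u * (s +i* t)] with [u] unimodular, the set is the closed region
   above the graph of a Lipschitz function. *)
Definition lipschitz_boundary (R : realType) (Omega : set R[i]^o) : Prop :=
  forall p : R[i]^o, (closure Omega `\` interior Omega) p ->
  exists (u : R[i]^o) (r L : R) (g : R^o -> R^o),
    [/\ `|u| = 1, 0 < r, L.-lipschitz g &
        forall z : R[i]^o, Normc.normc (z - p) < r ->
          (Omega z <-> g (complex.Re ((z - p) / u)) <= complex.Im ((z - p) / u))].

(* Scalars are complex here, but [{i01 R[i]}] is the real segment [0, 1]
   because the elements of [R[i]] comparable with 0 are real. *)
Definition closed_convex_hull (R : realType) (A : set R[i]^o) : set R[i]^o :=
  smallest [set B : set R[i]^o |
    closed B /\ convex_set (B : set (convex_lmodType R[i]^o))] A.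

Definition expi (R : realType) (theta : R) : R[i]^o := cos theta +i* sin theta.

Definition signed_symbol (R : realType) (vp vm : R[i]^o -> R)
    (Op Om : set R[i]^o) : R[i]^o -> R :=
  fun z => vp z * \1_Op z - vm z * \1_Om z.

(* exp(- n log n / delta + o(n log n)) <= lam n <=
   exp(- n log n / Delta + o(n log n)) as n -> oo. *)
Definition nlogn_bounds (R : realType) (lam : nat -> R) (delta Delta : R) :
    Prop :=
  exists r1 r2 : nat -> R^o,
    [/\ r1 =o_\oo (fun n => n%:R * ln n%:R : R^o),
        r2 =o_\oo (fun n => n%:R * ln n%:R : R^o) &
        \forall n \near \oo,
          expR (- (n%:R * ln n%:R / delta) + r1 n) <= lam n /\
          lam n <= expR (- (n%:R * ln n%:R / Delta) + r2 n)].

(* log (lam n) = - 2 n log n + O(n); eventual positivity is explicit since the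
   library sets [ln x = 0] for [x <= 0]. *)
Definition sharp_asymptotics (R : realType) (lam : nat -> R) : Prop :=
  (\forall n \near \oo, 0 < lam n) /\
  (fun n => ln (lam n) : R^o) =
    (fun n => - (2 * n%:R * ln n%:R)) +O_\oo (fun n => n%:R : R^o).

(* Main.v *)
Require Import Defs.
From HB Require Import structures.
From mathcomp Require Import all_boot all_order all_algebra.
From mathcomp Require Import all_classical all_reals all_analysis.
From mathcomp Require Import complex.
From mathcomp Require Import measurable_realfun spectral ring lra zify.

Set Implicit Arguments.
Unset Strict Implicit.
Unset Printing Implicit Defensive.

Import Order.TTheory GRing.Theory Num.Theory.
Import numFieldNormedType.Exports.

Local Open Scope classical_set_scope.
Local Open Scope ring_scope.
Local Open Scope complex_scope.

(* Write q(f) = <V f, f>; it suffices to treat the positive eigenvalues, for V and for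
   -V.  On polynomials of degree < 2n consider the Hermitian form
   h(p) = int_{Op} |p|^2 - int_{Om} |p|^2.  The symmetry p |-> p o phi (conjugated if
   phi is antiholomorphic) changes its sign, so h >= 0 on some subspace of dimension n,
   and h <= 0 on another one.  Strict separation of the convex hulls gives a linear
   polynomial w with |w| larger on Op than on Om; multiplication by a fixed power w^m
   absorbs the bounds of v+, v- and of the Gaussian weight.

   Lower bound: this gives n dimensions of polynomials of degree < N = 2n + m with
   q(f) >= c int_{Op} |f|^2 >= e^(-C n) ||f||^2 / N!, the last step being Parseval on a
   disc contained in Op.  By the variational principle lam_n >= e^(-C n) / (2n + m)!.

   Upper bound: combine the first n eigenfunctions with n' = n - m - 1 polynomials
   on which, by the same argument, the form is nonpositive.  As n + n' > 2n' + m = N,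
   some combination f of the eigenfunctions has the same Taylor coefficients below
   N as a polynomial p of the second family.  On the disc containing Op and Om,
   |f - p|^2 <= C^N ||f||^2 / N!, so lam_n ||f||^2 <= q(f) <= C^N ||f||^2 / N!. *)

(** * The complex plane *)

Section ComplexBasics.
Context {R : realType}.
Local Notation nc := (@Normc.normc R).

(** The rate comes from a dimension count. A sign of [h] is available on only half of the
    polynomials, so [n] dimensions cost degree about 2n. The squared Fock norm of z^k is of order
    k!, whereas masses on a bounded set grow at most geometrically; the ratio is 1 / (2n)! up to
    C^n, with logarithm -2 n log n + O(n). Shifting the degree by the fixed [m] changes this by
    O(log n) only.

    The obstacle is that the symmetry preserves Lebesgue measure but neither the Gaussian weight nor
    the functions v+ and v-. It can act only on the bare form [h], and returning to [q] multiplies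
    the two masses by different constants. A power of [w] repairs this because on the multiples of
    w^m one mass exceeds the other by any prescribed factor.

    The sequence of eigenvalues is known only through the dimensions of eigenspaces. The variational
    principle therefore has to produce an eigenfunction itself, by maximising [q] on the orthogonal
    complement of those already counted; one with too large an eigenvalue then contradicts the
    enumeration. *)

Lemma normC_normc (z : R[i]) : `|z| = (nc z)%:C.
Proof. by rewrite normc_def; case: z. Qed.

Lemma normc_ge0 (z : R[i]) : 0 <= nc z.
Proof. by case: z => a b; exact: sqrtr_ge0. Qed.

Lemma normc_sqr (z : R[i]) : nc z ^+ 2 = complex.Re z ^+ 2 + complex.Im z ^+ 2.
Proof. by case: z => a b /=; rewrite sqr_sqrtr// addr_ge0 ?sqr_ge0. Qed.

Lemma normc_eq0 (z : R[i]) : (nc z == 0) = (z == 0).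
Proof. by apply/eqP/eqP => [/Normc.eq0_normc//|->]; exact: Normc.normc0. Qed.

Lemma normc_gt0 (z : R[i]) : (0 < nc z) = (z != 0).
Proof. by rewrite lt_def normc_ge0 normc_eq0 andbT. Qed.

Lemma normc_Re (z : R[i]) : `|complex.Re z| <= nc z.
Proof.
rewrite -(@ler_pXn2r _ 2) ?nnegrE ?normc_ge0 ?normr_ge0// normc_sqr real_normK ?num_real//.
by rewrite lerDl sqr_ge0.
Qed.

Lemma normc_Im (z : R[i]) : `|complex.Im z| <= nc z.
Proof.
rewrite -(@ler_pXn2r _ 2) ?nnegrE ?normc_ge0 ?normr_ge0// normc_sqr real_normK ?num_real//.
by rewrite lerDr sqr_ge0.
Qed.

Lemma normc_le_ReIm (z : R[i]) : nc z <= `|complex.Re z| + `|complex.Im z|.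
Proof.
rewrite -(@ler_pXn2r _ 2) ?nnegrE ?normc_ge0 ?addr_ge0 ?normr_ge0// normc_sqr.
rewrite sqrrD !real_normK ?num_real// -addrA lerD2l lerDr.
by rewrite mulrn_wge0// mulr_ge0.
Qed.

Lemma normcX (z : R[i]) (n : nat) : nc (z ^+ n) = nc z ^+ n.
Proof.
elim: n => [|n ih]; first by rewrite !expr0 Normc.normc1.
by rewrite !exprS Normc.normcM ih.
Qed.

Lemma normc_real (x : R) : nc x%:C = `|x|.
Proof. by rewrite /= expr0n addr0 sqrtr_sqr. Qed.

Lemma normc_conj (z : R[i]) : nc z^* = nc z.
Proof. by case: z => a b /=; rewrite sqrrN. Qed.

Lemma normcB (z w : R[i]) : nc (z - w) = nc (w - z).
Proof. by rewrite -opprB normcN. Qed.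

Lemma normc_trans (z w v : R[i]) : nc (z - w) <= nc (z - v) + nc (v - w).
Proof. by rewrite -[z - w](subrKA v) le_normcD. Qed.

Lemma normc_sum (I : Type) (s : seq I) (P : pred I) (F : I -> R[i]) :
  nc (\sum_(i <- s | P i) F i) <= \sum_(i <- s | P i) nc (F i).
Proof.
elim/big_ind2 : _ => [|x1 x2 y1 y2 h1 h2|//]; first by rewrite Normc.normc0.
by rewrite (le_trans (le_normcD _ _))// lerD.
Qed.

(** The norm of [R[i]] takes its values in [R[i]]. This trades it for the real modulus, in which all
    later estimates are written. *)
Lemma derivable_normcP (f : R[i]^o -> R[i]^o) (z : R[i]^o) : derivable f z 1 <->
  exists l, forall e, 0 < e -> exists2 d, 0 < d & forall h, nc h < d ->
    nc (f (z + h) - f z - l * h) <= e * nc h.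
Proof.
split.
- move=> /cvg_ex[/= l /cvgrPdist_le fl]; exists l => e e0.
  have := fl e%:C; rewrite ltcR => /(_ e0)[/= d d0 fd].
  have dE : d = (complex.Re d)%:C by rewrite RRe_real// gtr0_real.
  exists (complex.Re d); first by move: d0; rewrite /= dE ltcR.
  move=> h hd; have [->|h0] := eqVneq h 0.
    by rewrite addr0 subrr mulr0 subrr Normc.normc0 mulr0.
  have := fd h; rewrite /= sub0r normrN !normC_normc {1}dE ltcR lecR => /(_ hd h0).
  rewrite -[l - _]opprB normcN => H.
  have -> : f (z + h) - f z - l * h = h * (h^-1 * (f (h *: 1 + z) - f z) - l).
    by rewrite mulrBr mulVKf// -[h%:A]/(h * 1) mulr1 (addrC h) (mulrC l).
  by rewrite Normc.normcM mulrC ler_wpM2r ?normc_ge0.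
- move=> [l fl]; apply/cvg_ex; exists l; apply/cvgrPdist_le => /= e e0.
  have eE : e = (complex.Re e)%:C by rewrite RRe_real// gtr0_real.
  have e0' : 0 < complex.Re e by move: e0; rewrite {1}eE ltcR.
  have [d d0 fd] := fl _ e0'.
  exists d%:C; first by rewrite /= ltcR.
  move=> h /=; rewrite sub0r normrN !normC_normc eE ltcR lecR => hd h0.
  have := fd _ hd.
  have -> : f (z + h) - f z - l * h = h * (h^-1 * (f (h *: 1 + z) - f z) - l).
    by rewrite mulrBr mulVKf// -[h%:A]/(h * 1) mulr1 (addrC h) (mulrC l).
  rewrite Normc.normcM mulrC ler_pM2r ?normc_gt0// => H.
  by rewrite -[l - _]opprB normcN.
Qed.

End ComplexBasics.

(** * Integrals over segments *)

Section RealInterval.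
Context {R : realType}.

Definition rint (a b : R) (f : R -> R) : R := Rintegral lebesgue_measure `[a, b] f.

Lemma rint_integrable (a b : R) (f : R -> R) : continuous (f : R^o -> R^o) ->
  lebesgue_measure.-integrable `[a, b] (EFin \o f).
Proof.
move=> cf; apply: continuous_compact_integrable; first exact: segment_compact.
by apply: continuous_subspaceT => x; exact: cf.
Qed.

Lemma rint_FTC (a b : R) (f : R -> R) (F : R -> R) : a <= b -> continuous (f : R^o -> R^o) ->
  (forall x, is_derive (x : R^o) 1 (F : R^o -> R^o) (f x)) -> rint a b f = F b - F a.
Proof.
rewrite le_eqVlt => /predU1P[<- _ _|ab cf dF].
  by rewrite /rint set_itv1 Rintegral_set1 subrr.
have cF x : {for x, continuous (F : R^o -> R^o)}.
  by apply: differentiable_continuous; apply/derivable1_diffP; have [] := dF x.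
rewrite /rint /Rintegral (@continuous_FTC2 _ f F a b)//.
- by apply: continuous_subspaceT => x; exact: cf.
- split.
  + by move=> x _; have [] := dF x.
  + by apply: cvg_at_right_filter; exact: cF.
  + by apply: cvg_at_left_filter; exact: cF.
- by move=> x _; rewrite derive1E; have [] := dF x.
Qed.

Lemma rint_split (a b c : R) (f : R -> R) : a <= b -> b <= c -> continuous (f : R^o -> R^o) ->
  rint a c f = rint a b f + rint b c f.
Proof.
move=> ab bc cf; rewrite /rint.
rewrite -(@Rintegral_itv_obnd_cbnd _ b (BRight c)); last first.
  by apply: integrableS (rint_integrable b c cf) => //; exact: subset_itv_oc_cc.
have := @Rintegral_itvB _ f (BLeft a) (BRight c) b (rint_integrable a c cf).
by rewrite !bnd_simp => <-//; rewrite addrC subrK.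
Qed.

Lemma rintD a b (f g : R -> R) : continuous (f : R^o -> R^o) -> continuous (g : R^o -> R^o) ->
  rint a b (fun x => f x + g x) = rint a b f + rint a b g.
Proof. by move=> cf cg; apply: RintegralD => //; exact: rint_integrable. Qed.

Lemma rintZ a b r (f : R -> R) : continuous (f : R^o -> R^o) ->
  rint a b (fun x => r * f x) = r * rint a b f.
Proof. by move=> cf; apply: RintegralZl => //; exact: rint_integrable. Qed.

Lemma rint_norm a b (f : R -> R) M : a <= b -> continuous (f : R^o -> R^o) ->
  (forall x, a <= x <= b -> `|f x| <= M) -> `|rint a b f| <= M * (b - a).
Proof.
move=> ab cf fM.
have icf := rint_integrable a b cf.
rewrite (le_trans (le_normr_Rintegral _ icf))//.
have -> : M * (b - a) = \int[lebesgue_measure]_(x in `[a, b]) M.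
  by rewrite Rintegral_cst//= lebesgue_measure_itv/= lte_fin; case: ltgtP ab => // -> _; rewrite subrr !mulr0.
apply: le_Rintegral => //.
- exact: integrable_norm icf.
- have cM : continuous ((fun=> M) : R^o -> R^o) by move=> x; exact: cvg_cst.
  exact: (rint_integrable a b cM).
Qed.

End RealInterval.

Section ComplexInterval.
Context {R : realType}.
Local Notation nc := (@Normc.normc R).

Definition ccont (F : R -> R[i]) :=
  continuous ((fun x => complex.Re (F x)) : R^o -> R^o) /\
  continuous ((fun x => complex.Im (F x)) : R^o -> R^o).

Lemma ccontP (F : R -> R[i]) : ccont F <-> forall x e, 0 < e -> exists2 d, 0 < d &
  forall y, `|y - x| < d -> nc (F y - F x) <= e.
Proof.
split.
- move=> [cr ci] x e e0.
  have e2 : 0 < e / 2 by rewrite divr_gt0.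
  have /cvgrPdist_le/(_ _ e2)[d1 /= d10 h1] := cr x.
  have /cvgrPdist_le/(_ _ e2)[d2 /= d20 h2] := ci x.
  exists (Num.min d1 d2); first by rewrite lt_min d10.
  move=> y; rewrite lt_min distrC => /andP[/h1 H1 /h2 H2].
  rewrite normcB (le_trans (normc_le_ReIm _))// [e]splitr lerD//.
    by move: H1; case: (F x) (F y) => ? ? [].
  by move: H2; case: (F x) (F y) => ? ? [].
- move=> H; split=> x; apply/cvgrPdist_le => e e0; have [d d0 h] := H x _ e0;
  exists d => //= y yd; have {}h : nc (F y - F x) <= e by apply: h; rewrite distrC.
  + rewrite distrC (le_trans _ h)// (le_trans _ (normc_Re _))//.
    by case: (F x) (F y) => ? ? [].
  + rewrite distrC (le_trans _ h)// (le_trans _ (normc_Im _))//.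
    by case: (F x) (F y) => ? ? [].
Qed.

Lemma ccont_cst (c : R[i]) : ccont (fun=> c).
Proof. by split=> x; exact: cvg_cst. Qed.

Lemma ccontD (F G : R -> R[i]) : ccont F -> ccont G -> ccont (fun x => F x + G x).
Proof.
move=> [F1 F2] [G1 G2]; split=> x.
  under eq_fun do rewrite raddfD; apply: cvgD; [exact: F1|exact: G1].
under eq_fun do rewrite raddfD; apply: cvgD; [exact: F2|exact: G2].
Qed.

Lemma ccontM (F G : R -> R[i]) : ccont F -> ccont G -> ccont (fun x => F x * G x).
Proof.
move=> [F1 F2] [G1 G2]; split=> x.
  have -> : (fun x => complex.Re (F x * G x)) = (fun x => complex.Re (F x) * complex.Re (G x) - complex.Im (F x) * complex.Im (G x)).
    by apply/funext => y; case: (F y) (G y) => ? ? [].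
  by apply: cvgB; apply: cvgM; [exact: F1|exact: G1|exact: F2|exact: G2].
have -> : (fun x => complex.Im (F x * G x)) = (fun x => complex.Re (F x) * complex.Im (G x) + complex.Im (F x) * complex.Re (G x)).
  by apply/funext => y; case: (F y) (G y) => ? ? [].
by apply: cvgD; apply: cvgM; [exact: F1|exact: G2|exact: F2|exact: G1].
Qed.

Definition cint (a b : R) (F : R -> R[i]) : R[i] :=
  rint a b (fun x => complex.Re (F x)) +i* rint a b (fun x => complex.Im (F x)).

Lemma cint_split (a b c : R) F : a <= b -> b <= c -> ccont F ->
  cint a c F = cint a b F + cint b c F.
Proof. by move=> ab bc [F1 F2]; rewrite /cint (rint_split ab bc F1) (rint_split ab bc F2). Qed.

Lemma cintD a b F G : ccont F -> ccont G ->
  cint a b (fun x => F x + G x) = cint a b F + cint a b G.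
Proof.
move=> [F1 F2] [G1 G2]; rewrite /cint.
under [in LHS]eq_fun do rewrite raddfD.
rewrite rintD//; congr (_ +i* _).
by under [in LHS]eq_fun do rewrite raddfD; rewrite rintD.
Qed.

Lemma cintZ a b c F : ccont F ->
  cint a b (fun x => c * F x) = c * cint a b F.
Proof.
move=> [F1 F2]; rewrite /cint; case: c => c d.
have -> : (fun x => complex.Re ((c +i* d) * F x)) = (fun x => c * complex.Re (F x) + (- d) * complex.Im (F x)).
  by apply/funext => x; case: (F x) => ? ? /=; rewrite mulNr.
have -> : (fun x => complex.Im ((c +i* d) * F x)) = (fun x => c * complex.Im (F x) + d * complex.Re (F x)).
  by apply/funext => x; case: (F x) => ? ? /=.
have cZ r f : continuous (f : R^o -> R^o) -> continuous ((fun x => r * f x) : R^o -> R^o).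
  by move=> cf x; apply: cvgM; [exact: cvg_cst|exact: cf].
by rewrite !rintD ?rintZ//; try exact: cZ; rewrite mulNr.
Qed.

(** The factor 2 comes from bounding real and imaginary parts separately; constants of this kind are
    harmless throughout. *)
Lemma cint_norm a b F M : a <= b -> ccont F ->
  (forall x, a <= x <= b -> nc (F x) <= M) -> nc (cint a b F) <= 2 * (M * (b - a)).
Proof.
move=> ab [F1 F2] FM; rewrite (le_trans (normc_le_ReIm _))//= mulr_natl mulr2n lerD//.
  by apply: rint_norm => // x /FM; apply: le_trans; exact: normc_Re.
by apply: rint_norm => // x /FM; apply: le_trans; exact: normc_Im.
Qed.

Lemma cint_FTC a b F (G : R -> R[i]) : a <= b -> ccont F ->
  (forall x, is_derive (x : R^o) 1 ((fun y => complex.Re (G y)) : R^o -> R^o) (complex.Re (F x))) ->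
  (forall x, is_derive (x : R^o) 1 ((fun y => complex.Im (G y)) : R^o -> R^o) (complex.Im (F x))) ->
  cint a b F = G b - G a.
Proof.
move=> ab [F1 F2] dR dI; rewrite /cint (rint_FTC ab F1 dR) (rint_FTC ab F2 dI).
by case: (G a) (G b) => ? ? [].
Qed.

Lemma ccont_comp (f : R[i]^o -> R[i]^o) (F : R -> R[i]) : entire f -> ccont F ->
  ccont (fun x => f (F x)).
Proof.
move=> ef /ccontP cF; apply/ccontP => x e e0.
have /derivable_normcP[l fl] := ef (F x).
have [d d0 fd] := fl _ ltr01.
have nl : 0 < nc l + 1 by rewrite ltr_wpDl ?normc_ge0.
have m0 : 0 < Num.min (d / 2) (e / (nc l + 1)) by rewrite lt_min !divr_gt0.
have [d' d'0 Fd'] := cF x _ m0.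
exists d' => // y /Fd'; rewrite le_min => /andP[h1 h2].
have {}h1 : nc (F y - F x) < d by rewrite (le_lt_trans h1)// ltr_pdivrMr// ltr_pMr// ltr1n.
have := fd _ h1; rewrite (addrC (F x)) subrK mul1r => H.
have -> : f (F y) - f (F x) = (f (F y) - f (F x) - l * (F y - F x)) + l * (F y - F x) by rewrite subrK.
rewrite (le_trans (le_normcD _ _))// Normc.normcM.
rewrite (le_trans (lerD H (lexx _)))// -[X in X + _]mul1r -mulrDl addrC.
by rewrite mulrC -ler_pdivlMr// addrC.
Qed.

End ComplexInterval.

(** * Cauchy formula *)

Lemma nested_point {R : realType} (a b : nat -> R) :
  (forall n, a n <= a n.+1) -> (forall n, b n.+1 <= b n) ->
  (forall n, a n <= b n) -> exists x, forall n, a n <= x <= b n.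
Proof.
move=> an bn ab.
have an' : {homo a : n m / (n <= m)%N >-> n <= m} by apply: homo_leq => //; exact: le_trans.
have bn' : {homo b : n m / (n <= m)%N >-> m <= n}.
  by apply: homo_leq => // ? ? ? h1 h2; exact: le_trans h2 h1.
have abnm n m : a n <= b m.
  by case/orP: (leq_total n m) => nm; [rewrite (le_trans (an' _ _ nm))|rewrite (le_trans (ab n))// bn'].
have hs : has_sup (range a).
  by split; [exists (a 0%N); exists 0%N|exists (b 0%N) => _ [n _ <-]].
exists (sup (range a)) => n; apply/andP; split.
  by apply: ub_le_sup; [case: hs|exists n].
by apply: ge_sup; [case: hs|move=> _ [m _ <-]].
Qed.

(* Goursat: an additive function of rectangles that is [o(area)] near every point
   vanishes, since bisection halves it at best by 4 at each step. *)
Section Bisection.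
Context {R : realType}.
Local Notation nc := (@Normc.normc R).
Variable mu : R -> R -> R -> R -> R[i].
Hypothesis mu_s : forall a b c t t', a <= b -> b <= c -> t <= t' ->
  mu a c t t' = mu a b t t' + mu b c t t'.
Hypothesis mu_t : forall a b t t' t'', a <= b -> t <= t' -> t' <= t'' ->
  mu a b t t'' = mu a b t t' + mu a b t' t''.
Variables (s1 s2 t1 t2 : R).
Hypotheses (s12 : s1 <= s2) (t12 : t1 <= t2).
(** The squared half-perimeter stands for the area: both sides are halved at each stage, so both
    quantities scale by 4^-n. *)
Hypothesis mu_local : forall x y, s1 <= x <= s2 -> t1 <= y <= t2 ->
  forall e, 0 < e -> exists2 d, 0 < d & forall a b t t',
    s1 <= a -> b <= s2 -> t1 <= t -> t' <= t2 ->
    a <= x <= b -> t <= y <= t' -> b - a < d -> t' - t < d ->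
    nc (mu a b t t') <= e * ((b - a) + (t' - t)) ^+ 2.

(** Keeps the left half if it carries at least half of the modulus; otherwise additivity forces the
    right half to do so. *)
Let step_s (q : (R * R) * (R * R)) : (R * R) * (R * R) :=
  let m := (q.1.1 + q.1.2) / 2 in
  if nc (mu q.1.1 q.1.2 q.2.1 q.2.2) <= 2 * nc (mu q.1.1 m q.2.1 q.2.2)
  then ((q.1.1, m), q.2) else ((m, q.1.2), q.2).
Let step_t (q : (R * R) * (R * R)) : (R * R) * (R * R) :=
  let m := (q.2.1 + q.2.2) / 2 in
  if nc (mu q.1.1 q.1.2 q.2.1 q.2.2) <= 2 * nc (mu q.1.1 q.1.2 q.2.1 m)
  then (q.1, (q.2.1, m)) else (q.1, (m, q.2.2)).
Let Q n := iter n (fun q => step_t (step_s q)) ((s1, s2), (t1, t2)).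
Let mq (q : (R * R) * (R * R)) := nc (mu q.1.1 q.1.2 q.2.1 q.2.2).

Lemma half_between (a b : R) : a <= b -> a <= (a + b) / 2 <= b.
Proof. by move=> ab; rewrite ler_pdivlMr// ler_pdivrMr// !mulr_natr !mulr2n lerD2l lerD2r ab. Qed.

Lemma step_sP q : q.1.1 <= q.1.2 -> q.2.1 <= q.2.2 ->
  [/\ q.1.1 <= (step_s q).1.1 <= (step_s q).1.2, (step_s q).1.2 <= q.1.2, (step_s q).2 = q.2,
  (step_s q).1.2 - (step_s q).1.1 = (q.1.2 - q.1.1) / 2 & mq q <= 2 * mq (step_s q)].
Proof.
move=> ab tt; rewrite /step_s.
have /andP[h1 h2] := half_between ab.
case: ifPn => [H|/negP/negP]; last rewrite -ltNge => H; split => //=; rewrite ?h1 ?h2//.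
- by lra.
- by lra.
- by lra.
- move: H; rewrite /mq /= => H.
  have := le_normcD (mu q.1.1 ((q.1.1 + q.1.2) / 2) q.2.1 q.2.2) (mu ((q.1.1 + q.1.2) / 2) q.1.2 q.2.1 q.2.2).
  by rewrite -mu_s//; lra.
Qed.

Lemma step_tP q : q.1.1 <= q.1.2 -> q.2.1 <= q.2.2 ->
  [/\ q.2.1 <= (step_t q).2.1 <= (step_t q).2.2, (step_t q).2.2 <= q.2.2, (step_t q).1 = q.1,
  (step_t q).2.2 - (step_t q).2.1 = (q.2.2 - q.2.1) / 2 & mq q <= 2 * mq (step_t q)].
Proof.
move=> ab tt; rewrite /step_t.
have /andP[h1 h2] := half_between tt.
case: ifPn => [H|/negP/negP]; last rewrite -ltNge => H; split => //=; rewrite ?h1 ?h2//.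
- by lra.
- by lra.
- by lra.
- move: H; rewrite /mq /= => H.
  have := le_normcD (mu q.1.1 q.1.2 q.2.1 ((q.2.1 + q.2.2) / 2)) (mu q.1.1 q.1.2 ((q.2.1 + q.2.2) / 2) q.2.2).
  by rewrite -mu_t//; lra.
Qed.

Lemma bisection_zero : mu s1 s2 t1 t2 = 0.
Proof.
have QS n : Q n.+1 = step_t (step_s (Q n)) by [].
have Qle n : (Q n).1.1 <= (Q n).1.2 /\ (Q n).2.1 <= (Q n).2.2.
  elim: n => [//|n [i1 i2]].
  have [/andP[_ a1] a2 a3 _ _] := step_sP i1 i2.
  have i2' : (step_s (Q n)).2.1 <= (step_s (Q n)).2.2 by rewrite a3.
  have [/andP[_ b1] b2 b3 _ _] := step_tP a1 i2'.
  by rewrite QS b3.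
have Qstep n : [/\ (Q n).1.1 <= (Q n.+1).1.1, (Q n.+1).1.2 <= (Q n).1.2,
   (Q n).2.1 <= (Q n.+1).2.1 & (Q n.+1).2.2 <= (Q n).2.2] /\
   [/\ (Q n.+1).1.2 - (Q n.+1).1.1 = ((Q n).1.2 - (Q n).1.1) / 2,
   (Q n.+1).2.2 - (Q n.+1).2.1 = ((Q n).2.2 - (Q n).2.1) / 2 &
   mq (Q n) <= 4 * mq (Q n.+1)].
  have [i1 i2] := Qle n.
  have [/andP[a0 a1] a2 a3 a4 a5] := step_sP i1 i2.
  have i2' : (step_s (Q n)).2.1 <= (step_s (Q n)).2.2 by rewrite a3.
  have [/andP[b0 b1] b2 b3 b4 b5] := step_tP a1 i2'.
  rewrite QS b3 b4 a3 a4; split; split=> //; rewrite -?a3//; lra.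
have [D1 D2] : (forall n, (Q n).1.2 - (Q n).1.1 = (s2 - s1) / 2 ^+ n) /\
    (forall n, (Q n).2.2 - (Q n).2.1 = (t2 - t1) / 2 ^+ n).
  split; elim=> [|n ih]; rewrite ?expr0 ?divr1//; have [_ [e1 e2 _]] := Qstep n.
    by rewrite e1 ih exprSr invfM mulrA.
  by rewrite e2 ih exprSr invfM mulrA.
have mq0 n : mq (Q 0) <= 4 ^+ n * mq (Q n).
  elim: n => [|n ih]; first by rewrite expr0 mul1r.
  by rewrite (le_trans ih)// exprSr -mulrA ler_wpM2l ?exprn_ge0//; have [_ []] := Qstep n.
have [x xQ] : exists x, forall n, (Q n).1.1 <= x <= (Q n).1.2.
  by apply: nested_point => n; [have [[]] := Qstep n|have [[]] := Qstep n|have [] := Qle n].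
have [y yQ] : exists x, forall n, (Q n).2.1 <= x <= (Q n).2.2.
  by apply: nested_point => n; [have [[]] := Qstep n|have [[]] := Qstep n|have [] := Qle n].
have Qin n : [/\ s1 <= (Q n).1.1, (Q n).1.2 <= s2, t1 <= (Q n).2.1 & (Q n).2.2 <= t2].
  elim: n => [//|n [i1 i2 i3 i4]]; have [[j1 j2 j3 j4] _] := Qstep n.
  by rewrite (le_trans i1)// (le_trans j2)// (le_trans i3)// (le_trans j4).
apply/eqP; rewrite -normc_eq0 eq_le normc_ge0 andbT.
apply/ler_addgt0Pr => e e0; rewrite add0r.
pose S := (s2 - s1) + (t2 - t1).
have S0 : 0 <= S by rewrite addr_ge0 ?subr_ge0.
(* The half-perimeter [S] is divided by 2^n at stage [n], and its square cancels the factor 4^n of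
   [mq0]. The 1 in [S + 1] covers degenerate rectangles. *)
have e'0 : 0 < e / (S + 1) ^+ 2 by rewrite divr_gt0// exprn_gt0// ltr_wpDl.
have [d d0 H] := mu_local (xQ 0%N) (yQ 0%N) e'0.
have [n nd] : exists n, S / 2 ^+ n < d.
  exists (Num.truncn (S / d)).+1; rewrite ltr_pdivrMr ?exprn_gt0//.
  rewrite mulrC -ltr_pdivrMr//.
  rewrite (lt_le_trans (truncnS_gt _))// -natrX ler_nat ltnW// ltn_expl//.
have [q1 q2 q3 q4] := Qin n.
have n0 : 0 < (2 : R) ^+ n by rewrite exprn_gt0.
have := H _ _ _ _ q1 q2 q3 q4 (xQ n) (yQ n).
rewrite D1 D2 -mulrDl -/S.
have h1 : (s2 - s1) / 2 ^+ n < d by rewrite (le_lt_trans _ nd)// ler_pM2r ?invr_gt0// lerDl subr_ge0.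
have h2 : (t2 - t1) / 2 ^+ n < d by rewrite (le_lt_trans _ nd)// ler_pM2r ?invr_gt0// lerDr subr_ge0.
move=> /(_ h1 h2) {}H.
have := mq0 n; rewrite {1}/mq /= => /le_trans; apply.
have -> : e = 4 ^+ n * (e / (S + 1) ^+ 2 * ((S + 1) / 2 ^+ n) ^+ 2).
  have -> : (4 : R) = 2 ^+ 2 by rewrite -natrX.
  rewrite -exprM mulnC exprM expr_div_n.
  by field; rewrite ?gt_eqF// ltr_wpDl.
rewrite ler_wpM2l ?exprn_ge0// (le_trans H)// ler_wpM2l ?(ltW e'0)//.
have S1 : 0 <= S + 1 by rewrite addr_ge0.
rewrite ler_pXn2r ?nnegrE ?divr_ge0 ?(ltW n0)//.
by rewrite ler_pM2r ?invr_gt0// lerDl.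
Qed.
End Bisection.

(** * The unit circle and exponential functions *)

Section ExpiTheory.
Context {R : realType}.
Local Notation nc := (@Normc.normc R).

Lemma normc_expi (t : R) : nc (expi t) = 1.
Proof. by rewrite /= cos2Dsin2 sqrtr1. Qed.

Lemma expi0 : expi (0 : R) = 1.
Proof. by rewrite /expi cos0 sin0. Qed.

Lemma expi2pi : expi (pi *+ 2 : R) = 1.
Proof. by rewrite /expi cos2pi mulr2n sinD sinpi mul0r mulr0 addr0. Qed.

Lemma expiD (s t : R) : expi (s + t) = expi s * expi t.
Proof. by rewrite /expi sinD cosD; simpc; congr (_ +i* _); rewrite addrC. Qed.

Lemma expi_neq0 (t : R) : expi t != 0.
Proof. by rewrite -normc_eq0 normc_expi oner_eq0. Qed.

Lemma expiN (t : R) : expi (- t) = (expi t)^-1.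
Proof.
apply: (mulfI (expi_neq0 t)); rewrite -expiD subrr expi0 divff//.
exact: expi_neq0.
Qed.

Lemma expiMn (t : R) n : expi (n%:R * t) = expi t ^+ n.
Proof.
elim: n => [|n ih]; first by rewrite mul0r expi0 expr0.
by rewrite exprS -ih -expiD -natr1 mulrDl mul1r addrC.
Qed.

Lemma ccont_expi : ccont (@expi R).
Proof. by split=> x /=; [exact: continuous_cos|exact: continuous_sin]. Qed.

Lemma ccontV (F : R -> R[i]) : ccont F -> (forall x, F x != 0) -> ccont (fun x => (F x)^-1).
Proof.
move=> [F1 F2] F0.
have n0 x : complex.Re (F x) ^+ 2 + complex.Im (F x) ^+ 2 != 0.
  by rewrite -normc_sqr expf_neq0// normc_eq0.
have cN : continuous ((fun x => complex.Re (F x) ^+ 2 + complex.Im (F x) ^+ 2) : R^o -> R^o).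
  by move=> x; apply: cvgD; apply: cvgM; [exact: F1|exact: F1|exact: F2|exact: F2].
split=> x.
  have -> : (fun x => complex.Re (F x)^-1) = (fun x => complex.Re (F x) / (complex.Re (F x) ^+ 2 + complex.Im (F x) ^+ 2)).
    by apply/funext => y; case: (F y).
  apply: cvgM; [exact: F1|apply: cvgV; [exact: n0|exact: cN]].
have -> : (fun x => complex.Im (F x)^-1) = (fun x => - (complex.Im (F x) / (complex.Re (F x) ^+ 2 + complex.Im (F x) ^+ 2))).
  by apply/funext => y; case: (F y) => a b /=.
apply: cvgN; apply: cvgM; [exact: F2|apply: cvgV; [exact: n0|exact: cN]].
Qed.

Lemma ccont_bounded (a b : R) (F : R -> R[i]) : a <= b -> ccont F ->
  exists2 M, 0 < M & forall x, a <= x <= b -> nc (F x) <= M.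
Proof.
move=> ab [F1 F2].
pose G x := `|complex.Re (F x)| + `|complex.Im (F x)|.
have cG : {within `[a, b], continuous (G : R^o -> R^o)}.
  apply: continuous_subspaceT => x; apply: cvgD.
    by apply: (@cvg_norm R R^o); exact: F1.
  by apply: (@cvg_norm R R^o); exact: F2.
have [c _ Gc] := EVT_max ab cG.
exists (G c + 1); first by rewrite ltr_wpDl// addr_ge0.
move=> x xab; rewrite (le_trans (normc_le_ReIm _))// -/(G x) ler_wpDr//.
by apply: Gc; rewrite in_itv.
Qed.

Lemma cint_expi (a b : R) : a <= b -> cint a b (fun t => 'i * expi t) = expi b - expi a.
Proof.
move=> ab; apply: cint_FTC => //.
- by apply: ccontM; [exact: ccont_cst|exact: ccont_expi].
- move=> x /=; rewrite mul0r sub0r mul1r; exact: is_derive_cos.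
- move=> x /=; rewrite mul0r add0r mul1r; exact: is_derive_sin.
Qed.

Lemma cint_expR (a b : R) : a <= b -> cint a b (fun s => (expR s)%:C) = (expR b)%:C - (expR a)%:C.
Proof.
move=> ab; apply: (cint_FTC (G := fun s => (expR s)%:C)) => //.
- by split=> x /=; [exact: continuous_expR|exact: cvg_cst].
- by move=> x /=; exact: is_derive_cst.
Qed.

Lemma cint_cst (a b : R) (c : R[i]) : a <= b -> cint a b (fun=> c) = (b - a)%:C * c.
Proof.
move=> ab; rewrite [(fun=> c)](_ : _ = (fun=> c * 1)); last by apply/funext => x; rewrite mulr1.
rewrite cintZ; last exact: ccont_cst.
rewrite mulrC; congr (_ * _).
rewrite rmorphB; apply: (cint_FTC (G := fun s => s%:C)) => //.
- exact: ccont_cst.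
- by move=> x /=; exact: is_derive_cst.
Qed.

Lemma cint_expiN (n : nat) : (0 < n)%N -> cint 0 (pi *+ 2) (fun t : R => expi t ^- n) = 0.
Proof.
move=> n0.
have n0' : (n%:R : R) != 0 by rewrite pnatr_eq0 -lt0n.
have E : (fun t : R => expi t ^- n) = (fun t => expi (- (n%:R * t))).
  by apply/funext => t; rewrite expiN expiMn.
(* This function, (sin nt + i cos nt) / n, is a primitive of exp(-int) and has period 2 pi. *)
have E2 (G : R -> R[i]) : G = (fun t => (n%:R^-1 * sin (n%:R * t)) +i* (n%:R^-1 * cos (n%:R * t))) ->
   G (pi *+ 2) - G 0 = 0.
  move=> ->; rewrite mulr0 sin0 cos0.
  have := expiMn (pi *+ 2) n; rewrite expi2pi expr1n => -[-> ->].
  by rewrite subrr.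
apply: eq_trans (E2 _ erefl); apply: (cint_FTC (G := fun t => (n%:R^-1 * sin (n%:R * t)) +i* (n%:R^-1 * cos (n%:R * t)))).
- by rewrite mulrn_wge0// pi_ge0.
- rewrite E; split=> x /=; under eq_fun do rewrite ?cosN ?sinN.
    apply: continuous_comp; [apply: cvgM; [exact: cvg_cst|exact: cvg_id]|exact: continuous_cos].
  apply: cvgN; apply: continuous_comp; [apply: cvgM; [exact: cvg_cst|exact: cvg_id]|exact: continuous_sin].
- move=> x; rewrite -[expi x ^- n]/((fun t => expi t ^- n) x) E /= cosN.
  have dl : is_derive (x : R^o) 1 ((fun y => n%:R * y) : R^o -> R^o) n%:R.
    by have := @is_deriveZ _ _ _ (@id R^o) n%:R x 1 1 (is_derive_id _ _); rewrite /GRing.scale/= mulr1.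
  have := is_deriveZ n%:R^-1 (is_derive1_comp (is_derive_sin (n%:R * x)) dl).
  by rewrite /GRing.scale/= mulrCA mulVf// mulr1.
- move=> x; rewrite -[expi x ^- n]/((fun t => expi t ^- n) x) E /= sinN.
  have dl : is_derive (x : R^o) 1 ((fun y => n%:R * y) : R^o -> R^o) n%:R.
    by have := @is_deriveZ _ _ _ (@id R^o) n%:R x 1 1 (is_derive_id _ _); rewrite /GRing.scale/= mulr1.
  have := is_deriveZ n%:R^-1 (is_derive1_comp (is_derive_cos (n%:R * x)) dl).
  by rewrite /GRing.scale/= mulrCA mulVf// mulr1.
Qed.

Lemma expR_lip (x s : R) : x <= 0 -> s <= 0 -> `|expR s - expR x| <= `|s - x|.
Proof.
wlog : x s / x <= s.
  move=> H x0 s0; case/orP: (le_total x s) => xs; first exact: H.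
  by rewrite distrC (distrC s); exact: H.
move=> xs x0 s0; rewrite !ger0_norm ?subr_ge0 ?ler_expR//.
have -> : expR x = expR s * expR (x - s) by rewrite -expRD addrC subrK.
have h1 : expR s <= 1 by rewrite -expR0 ler_expR.
have h2 : 1 + (x - s) <= expR (x - s) by exact: expR_ge1Dx.
have h3 := expR_gt0 s.
have h4 : expR (x - s) <= 1 by rewrite -expR0 ler_expR subr_le0.
nra.
Qed.

Lemma expi_lip (x s : R) : nc (expi s - expi x) <= 2 * `|s - x|.
Proof.
wlog : x s / x <= s.
  move=> H; case/orP: (le_total x s) => xs; first exact: H.
  by rewrite normcB distrC; exact: H.
move=> xs; rewrite -cint_expi// ger0_norm ?subr_ge0//.
have ce : ccont (fun t : R => 'i * expi t) by apply: ccontM; [exact: ccont_cst|exact: ccont_expi].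
have := cint_norm (M := 1) xs ce; rewrite mul1r; apply => y _.
by rewrite Normc.normcM normc_expi mulr1 /= expr0n expr1n add0r sqrtr1.
Qed.

Lemma ccontN (F : R -> R[i]) : ccont F -> ccont (fun x => - F x).
Proof.
move=> cF; rewrite (_ : (fun x => - F x) = (fun x => -1 * F x)); last by apply/funext => x; rewrite mulN1r.
by apply: ccontM => //; exact: ccont_cst.
Qed.
Lemma ccontB (F G : R -> R[i]) : ccont F -> ccont G -> ccont (fun x => F x - G x).
Proof. by move=> cF cG; apply: ccontD => //; exact: ccontN. Qed.
Lemma cintB (a b : R) (F G : R -> R[i]) : ccont F -> ccont G ->
  cint a b (fun x => F x - G x) = cint a b F - cint a b G.
Proof.
move=> cF cG; rewrite cintD//; last exact: ccontN.
congr (_ + _); rewrite (_ : (fun x => - G x) = (fun x => -1 * G x)); last by apply/funext => x; rewrite mulN1r.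
by rewrite cintZ// mulN1r.
Qed.

End ExpiTheory.

Section CauchyFormula.
Context {R : realType}.
Local Notation nc := (@Normc.normc R).
Variables (f : R[i]^o -> R[i]^o) (z0 : R[i]) (r : R).
Hypotheses (ef : entire f) (z0r : nc z0 < r).

Let w (t : R) : R[i] := r%:C * expi t.
(** [K t dt] is dw / (w - z0) along the circle. *)
Let K (t : R) : R[i] := 'i * w t / (w t - z0).
Let Z (s t : R) : R[i] := z0 + (expR s)%:C * (w t - z0).
Let u (s t : R) : R[i] := f (Z s t).

Let r0 : 0 < r. Proof. exact: le_lt_trans (normc_ge0 _) z0r. Qed.
Let nw t : nc (w t) = r.
Proof. by rewrite Normc.normcM normc_expi mulr1 normc_real gtr0_norm. Qed.
Let ni : nc 'i = 1.
Proof. by rewrite /= expr0n expr1n add0r sqrtr1. Qed.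

Let dist_w t : r - nc z0 <= nc (w t - z0).
Proof. by have := le_normcD (w t - z0) z0; rewrite subrK nw; lra. Qed.

Let wz0 t : w t - z0 != 0.
Proof. by rewrite -normc_gt0 (lt_le_trans _ (dist_w t))// subr_gt0. Qed.

Let cw : ccont w. Proof. by apply: ccontM; [exact: ccont_cst|exact: ccont_expi]. Qed.
Let cwz : ccont (fun t => w t - z0). Proof. by apply: ccontD => //; exact: ccont_cst. Qed.
Let cK : ccont K.
Proof.
apply: ccontM; first by apply: ccontM => //; exact: ccont_cst.
exact: ccontV.
Qed.
Let cu s : ccont (u s).
Proof.
apply: ccont_comp => //; apply: ccontD; first exact: ccont_cst.
by apply: ccontM => //; exact: ccont_cst.
Qed.
Let cexpR : ccont (fun s : R => (expR s)%:C).
Proof. by split=> x /=; [exact: continuous_expR|exact: cvg_cst]. Qed.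
Let cu' t : ccont (u^~ t).
Proof.
apply: ccont_comp => //; apply: ccontD; first exact: ccont_cst.
by apply: ccontM => //; exact: ccont_cst.
Qed.
Let Kmax := r / (r - nc z0).
Let Kmax0 : 0 < Kmax. Proof. by rewrite divr_gt0// subr_gt0. Qed.
Let nK t : nc (K t) <= Kmax.
Proof.
rewrite (Normc.normcM ('i * w t)) (Normc.normcM 'i) Normc.normcV ni mul1r nw ler_wpM2l ?(ltW r0)//.
by rewrite lef_pV2 ?posrE ?normc_gt0 ?subr_gt0// dist_w.
Qed.

(* In the coordinates [Z s t = z0 + e^s (w t - z0)] the form [f(Z) dZ / (Z - z0)] is
   [u ds + u K dt]; [mu] is its boundary integral over a rectangle.  The left edge
   of the domain goes to [z0] as [s -> -oo]. *)
Let mu (a b t t' : R) : R[i] :=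
  cint t t' (fun x => (u b x - u a x) * K x) - cint a b (fun s => u s t' - u s t).

Let Zlip s x t y : s <= 0 -> x <= 0 -> nc (Z s t - Z x y) <= 2 * r * (`|s - x| + `|t - y|).
Proof.
move=> s0 x0.
have -> : Z s t - Z x y = (expR s - expR x)%:C * (w t - z0) + (expR x)%:C * (r%:C * (expi t - expi y)).
  by rewrite /Z /w rmorphB /=; ring.
rewrite (le_trans (le_normcD _ _))// !Normc.normcM !normc_real mulrDr.
have h1 := expR_lip x0 s0; have h2 := expi_lip y t.
have h3 : `|expR x| <= 1 by rewrite ger0_norm ?expR_ge0// -expR0 ler_expR.
have h4 : nc (w t - z0) <= 2 * r.
  by rewrite (le_trans (le_normcD _ _))// nw normcN; move: z0r; lra.
rewrite (gtr0_norm r0) lerD//.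
  by rewrite mulrC ler_pM ?normc_ge0.
rewrite (le_trans (ler_pM _ _ h3 (lexx _)))// ?mulr_ge0 ?normc_ge0 ?(ltW r0)//.
by rewrite mul1r (mulrC 2) -mulrA ler_wpM2l ?(ltW r0).
Qed.

(** Near [Z x y] the affine part of [f] has an exact primitive and drops out of [mu]. Only the
    remainder [Er] is left; it is o(distance) and is integrated over sides of the same order, which
    gives the local smallness that [bisection_zero] asks for. *)
Lemma cauchy_rectangle (S : R) : 0 <= S -> mu (- S) 0 0 (pi *+ 2) = 0.
Proof.
move=> S0; apply: bisection_zero.
- move=> a b c t t' ab bc tt'; rewrite /mu.
  rewrite (cint_split ab bc); last exact: ccontB.
  have -> : (fun x => (u c x - u a x) * K x) = (fun x => (u b x - u a x) * K x + (u c x - u b x) * K x).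
    by apply/funext => x; rewrite -mulrDl [in RHS]addrC addrA subrK.
  have c1 p q : ccont (fun x => (u q x - u p x) * K x) by apply: ccontM => //; exact: ccontB.
  rewrite (cintD _ _ (c1 a b) (c1 b c)).
  by rewrite opprD addrACA.
- move=> a b t t' t'' ab tt tt'; rewrite /mu.
  rewrite (cint_split tt tt'); last by apply: ccontM => //; exact: ccontB.
  have -> : (fun s => u s t'' - u s t) = (fun s => (u s t' - u s t) + (u s t'' - u s t')).
    by apply/funext => x; rewrite [in RHS]addrC addrA subrK.
  have c1 p q : ccont (fun s => u s q - u s p) by exact: ccontB.
  rewrite (cintD _ _ (c1 t t') (c1 t' t'')).
  by rewrite opprD addrACA.
- by rewrite oppr_le0.
- by rewrite mulrn_wge0// pi_ge0.
move=> x y /andP[_ x0] _ e e0.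
have /derivable_normcP[l fl] : derivable f (Z x y) 1 by exact: ef.
(* The 8 is a product of three factors 2: one from the Lipschitz bound of [Z], one from a difference
   of two values of [Er], one from [cint_norm]. *)
pose e' := e / (8 * r * (Kmax + 1)).
have e'0 : 0 < e' by rewrite divr_gt0// !mulr_gt0// ltr_wpDl// ltW.
have [d d0 fd] := fl _ e'0.
exists (d / (4 * r)); first by rewrite divr_gt0// mulr_gt0.
move=> a b t t' _ b0 _ _ /andP[ax xb] /andP[ty yt'] dab dt.
have ab := le_trans ax xb; have tt' := le_trans ty yt'.
pose D := (b - a) + (t' - t).
have D0 : 0 <= D by rewrite addr_ge0 ?subr_ge0.
pose Er s th := u s th - f (Z x y) - l * (Z s th - Z x y).
have nEr s th : a <= s <= b -> t <= th <= t' -> nc (Er s th) <= e' * (2 * r * D).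
  move=> /andP[as_ sb] /andP[tth tht'].
  have s0 : s <= 0 by exact: le_trans b0.
  have nZ : nc (Z s th - Z x y) <= 2 * r * D.
    rewrite (le_trans (Zlip _ _ s0 x0))// ler_wpM2l ?mulr_ge0 ?(ltW r0)//.
    by rewrite lerD// ler_norml; apply/andP; split; lra.
  have := fd (Z s th - Z x y).
  rewrite [Z x y + _]addrC subrK => H; rewrite (le_trans (H _))//; last by rewrite ler_wpM2l// ltW.
  rewrite (le_lt_trans nZ)//.
  move: dab dt; rewrite !ltr_pdivlMr ?mulr_gt0// /D => *; lra.
have cEr s : ccont (Er s).
  apply: ccontB; first by apply: ccontB => //; exact: ccont_cst.
  apply: ccontM; first exact: ccont_cst.
  apply: ccontB; last exact: ccont_cst.
  apply: ccontD; first exact: ccont_cst.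
  by apply: ccontM => //; exact: ccont_cst.
have cEr' th : ccont (Er^~ th).
  apply: ccontB; first by apply: ccontB => //; exact: ccont_cst.
  apply: ccontM; first exact: ccont_cst.
  apply: ccontB; last exact: ccont_cst.
  apply: ccontD; first exact: ccont_cst.
  by apply: ccontM => //; exact: ccont_cst.
(* The affine contributions in [E1] and [E2] both integrate to l r (e^b - e^a) (e^(it') - e^(it)),
   and [mu] subtracts one from the other. *)
have E1 : (fun x => (u b x - u a x) * K x) =
    (fun x => (l * (expR b - expR a)%:C * r%:C) * ('i * expi x) + (Er b x - Er a x) * K x).
  apply/funext => th; rewrite /Er.
  have Kw : (w th - z0) * K th = 'i * w th by rewrite /K mulrCA divff// mulr1.
  transitivity (l * (Z b th - Z a th) * K th + (u b th - u a th - l * (Z b th - Z a th)) * K th); first by ring.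
  congr (_ + _); last by congr (_ * _); ring.
  have -> : Z b th - Z a th = (expR b - expR a)%:C * (w th - z0) by rewrite /Z rmorphB/=; ring.
  transitivity (l * (expR b - expR a)%:C * ((w th - z0) * K th)); first by rewrite !mulrA.
  by rewrite Kw /w; ring.
have E2 : (fun s => u s t' - u s t) =
    (fun s => (l * r%:C * (expi t' - expi t)) * (expR s)%:C + (Er s t' - Er s t)).
  by apply/funext => s; rewrite /Er /Z /w; ring.
have c1 : ccont (fun th => (Er b th - Er a th) * K th) by apply: ccontM => //; exact: ccontB.
have c2 : ccont (fun s => Er s t' - Er s t) by exact: ccontB.
have ciexp : ccont (fun x : R => 'i * expi x) by apply: ccontM; [exact: ccont_cst|exact: ccont_expi].
have ce1 : ccont (fun x : R => (l * (expR b - expR a)%:C * r%:C) * ('i * expi x)).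
  by apply: ccontM => //; exact: ccont_cst.
have ce2 : ccont (fun s : R => (l * r%:C * (expi t' - expi t)) * (expR s)%:C).
  by apply: ccontM => //; exact: ccont_cst.
have -> : mu a b t t' = cint t t' (fun th => (Er b th - Er a th) * K th) -
    cint a b (fun s => Er s t' - Er s t).
  rewrite /mu E1 E2 (cintD _ _ ce1 c1) (cintD _ _ ce2 c2).
  rewrite (cintZ _ _ _ ciexp) (cintZ _ _ _ cexpR) (cint_expi tt') (cint_expR ab).
  by rewrite rmorphB/=; ring.
rewrite (le_trans (le_normcD _ _))// normcN -/D.
have B1 := cint_norm (M := 2 * (e' * (2 * r * D)) * Kmax) tt' c1.
have B2 := cint_norm (M := 2 * (e' * (2 * r * D))) ab c2.
have {}B1 := B1 _; have {}B2 := B2 _.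
rewrite (le_trans (lerD (B1 _) (B2 _)))//.
- move=> th thtt; rewrite Normc.normcM ler_pM ?normc_ge0//.
  rewrite (le_trans (le_normcD _ _))// normcN mulr_natl mulr2n lerD// nEr// ?lexx ?ab//.
- move=> s sab; rewrite (le_trans (le_normcD _ _))// normcN mulr_natl mulr2n lerD// nEr// ?lexx ?tt'//.
- have -> : e = e' * (8 * r * (Kmax + 1)).
    by rewrite divfK// gt_eqF// !mulr_gt0// ltr_wpDl// ltW.
  have h1 : t' - t <= D by rewrite lerDr subr_ge0.
  have h2 : b - a <= D by rewrite lerDl subr_ge0.
  have -> : 2 * (2 * (e' * (2 * r * D)) * Kmax * (t' - t)) + 2 * (2 * (e' * (2 * r * D)) * (b - a)) =
    8 * e' * r * D * (Kmax * (t' - t) + (b - a)) by ring.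
  have -> : e' * (8 * r * (Kmax + 1)) * D ^+ 2 = 8 * e' * r * D * (Kmax * D + D) by ring.
  have P : 0 <= 8 * e' * r * D by apply: mulr_ge0 D0; apply: mulr_ge0 (ltW r0); apply: mulr_ge0 (ltW e'0).
  by rewrite (ler_wpM2l P)// lerD// ler_wpM2l// ltW.
Qed.

(** By periodicity the sides t = 0 and t = 2 pi of the rectangle cancel. The circle can thus be
    replaced by its contraction z0 + e^(-S) (w - z0), on which f - f(z0) is O(e^(-S)). *)
Lemma cauchy_integral : cint 0 (pi *+ 2) (fun t => (f (w t) - f z0) * K t) = 0.
Proof.
have pi20 : 0 <= (pi *+ 2 : R) by rewrite mulrn_wge0// pi_ge0.
have cfw : ccont (fun t => f (w t)) by exact: ccont_comp.
apply/eqP; rewrite -normc_eq0 eq_le normc_ge0 andbT.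
apply/ler_addgt0Pr => e e0; rewrite add0r.
have /derivable_normcP[l fl] : derivable f (z0 : R[i]^o) 1 by exact: ef.
have [d d0 fd] := fl _ ltr01.
pose C := 2 * (nc l + 1) * (2 * r) * Kmax * (pi *+ 2).
have nl : 0 < nc l + 1 by rewrite ltr_wpDl ?normc_ge0.
have C0 : 0 <= C.
  apply: mulr_ge0 pi20; apply: mulr_ge0 (ltW Kmax0); apply: mulr_ge0; first by rewrite mulr_ge0// ltW.
  by rewrite mulr_ge0// ltW.
pose S := Num.max (C / e) (2 * r / d).
have S0 : 0 <= S by rewrite le_max divr_ge0// ltW.
(* With this, smallness of a multiple of e^(-S) follows from a lower bound on [S] that is linear, so
   that [S] is chosen as a maximum of two quotients. *)
have eS1 : expR (- S) * (1 + S) <= 1.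
  by rewrite expRN mulrC ler_pdivrMr ?expR_gt0// mul1r expR_ge1Dx.
have eS0 := expR_gt0 (- S).
have eS : expR (- S) * C <= e.
  have : C <= e * S by rewrite mulrC -ler_pdivrMr// le_max lexx.
  nra.
have eSd : expR (- S) * (2 * r) < d.
  have : 2 * r <= d * S by rewrite (mulrC d) -ler_pdivrMr// le_max lexx orbT.
  nra.
have := cauchy_rectangle S0.
rewrite /mu [X in _ - X](_ : _ = 0); last first.
  rewrite [X in cint _ _ X](_ : _ = (fun=> 0)); last first.
    by apply/funext => s; rewrite /u /Z /w expi2pi expi0 subrr.
  by rewrite cint_cst ?mulr0// oppr_le0.
rewrite subr0 => H.
have {H} -> : cint 0 (pi *+ 2) (fun t => (f (w t) - f z0) * K t) =
   cint 0 (pi *+ 2) (fun t => (u (- S) t - f z0) * K t).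
  apply/eqP; rewrite -subr_eq0 -cintB; last 2 first.
  - by apply: ccontM => //; apply: ccontB => //; exact: ccont_cst.
  - by apply: ccontM => //; apply: ccontB => //; exact: ccont_cst.
  rewrite -[X in _ == X]H; apply/eqP; congr (cint _ _ _); apply/funext => t.
  rewrite -mulrBl; congr (_ * _).
  by rewrite {2}/u /Z expR0 mul1r (addrC z0) subrK; ring.
have c1 : ccont (fun t => (u (- S) t - f z0) * K t).
  by apply: ccontM => //; apply: ccontB => //; exact: ccont_cst.
have := cint_norm (M := (nc l + 1) * (expR (- S) * (2 * r)) * Kmax) pi20 c1.
rewrite subr0 => H; rewrite (le_trans (H _))//.
- move=> t _; rewrite Normc.normcM ler_pM ?normc_ge0//.
  have nh : nc ((expR (- S))%:C * (w t - z0)) <= expR (- S) * (2 * r).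
    rewrite Normc.normcM normc_real gtr0_norm ?expR_gt0// ler_wpM2l ?expR_ge0//.
    by rewrite (le_trans (le_normcD _ _))// nw normcN; move: z0r; lra.
  have := fd _ (le_lt_trans nh eSd); rewrite mul1r.
  set h := _%:C * _ in nh * => {}H.
  have -> : u (- S) t - f z0 = (f (z0 + h) - f z0 - l * h) + l * h by rewrite subrK.
  rewrite (le_trans (le_normcD _ _))// Normc.normcM.
  rewrite (le_trans (lerD H (lexx _)))// -[X in X + _]mul1r -mulrDl addrC ler_wpM2l//.
  exact: ltW.
- by rewrite (le_trans _ eS)// le_eqVlt; apply/orP; left; apply/eqP; rewrite /C; ring.
Qed.

End CauchyFormula.

(** * Taylor expansion of entire functions *)

Section Taylor.
Context {R : realType}.
Local Notation nc := (@Normc.normc R).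

(** Stands for a passage to the limit: truncation errors below all have the form [D / 2 ^+ M], and
    an inequality valid up to such an error for every [M] is exact. *)
Lemma geo_small (x D : R) : (forall M : nat, x <= D / 2 ^+ M) -> x <= 0.
Proof.
move=> H; apply/ler_addgt0Pr => e e0; rewrite add0r.
have D0 : 0 <= `|D| by [].
pose M := (Num.truncn (`|D| / e)).+1.
rewrite (le_trans (H M))// (@le_trans _ _ (`|D| / 2 ^+ M))//.
  by rewrite ler_pM2r ?invr_gt0 ?exprn_gt0// ler_norm.
rewrite ler_pdivrMr ?exprn_gt0// mulrC -ler_pdivrMr// ltW//.
by rewrite (lt_le_trans (truncnS_gt _))// -natrX ler_nat ltnW// ltn_expl.
Qed.

Section Disc.
Variables (r : R) (z0 : R[i]).
Hypotheses (r0 : 0 < r) (z0r : nc z0 <= r / 2).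
Let w (t : R) : R[i] := r%:C * expi t.
Let K (t : R) : R[i] := 'i * w t / (w t - z0).
Let nw t : nc (w t) = r.
Proof. by rewrite Normc.normcM normc_expi mulr1 normc_real gtr0_norm. Qed.
Let ni : nc 'i = 1.
Proof. by rewrite /= expr0n expr1n add0r sqrtr1. Qed.
Let w0 t : w t != 0. Proof. by rewrite -normc_gt0 nw. Qed.
Let dist_w t : r / 2 <= nc (w t - z0).
Proof. by have := le_normcD (w t - z0) z0; rewrite subrK nw; move: z0r; lra. Qed.
Let wz0 t : w t - z0 != 0.
Proof. by rewrite -normc_gt0 (lt_le_trans _ (dist_w t))// divr_gt0. Qed.
Let cw : ccont w. Proof. by apply: ccontM; [exact: ccont_cst|exact: ccont_expi]. Qed.
Let cX (F : R -> R[i]) n : ccont F -> ccont (fun t => F t ^+ n).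
Proof.
move=> cF; elim: n => [|n ih]; first exact: ccont_cst.
by under eq_fun do rewrite exprS; exact: ccontM.
Qed.
Let cK : ccont K.
Proof.
apply: ccontM; first by apply: ccontM => //; exact: ccont_cst.
by apply: ccontV => //; apply: ccontB => //; exact: ccont_cst.
Qed.
Let pi20 : 0 <= (pi *+ 2 : R). Proof. by rewrite mulrn_wge0// pi_ge0. Qed.

Let K_split M t : K t = 'i * \sum_(k < M) z0 ^+ k * w t ^- k + z0 ^+ M * w t ^- M * K t.
Proof.
rewrite /K; have w0' := w0 t; have wz' := wz0 t.
apply: (mulIf wz'); rewrite mulrDl !divfK//.
rewrite -[in RHS](mulrA _ (K t)) -/(K t) /K divfK//.
elim: M => [|M ih]; first by rewrite big_ord0 mulr0 mul0r !expr0 invr1 !mul1r add0r.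
have E : z0 ^+ M.+1 / w t ^+ M.+1 * ('i * w t) = z0 ^+ M / w t ^+ M * ('i * z0).
  transitivity (z0 ^+ M / w t ^+ M * ('i * z0) * (w t / w t)); last by rewrite divff// mulr1.
  by rewrite !exprS invfM; ring.
by rewrite E {1}ih big_ord_recr/=; ring.
Qed.

Let cint_sum (F : nat -> R -> R[i]) M : (forall k, ccont (F k)) ->
  ccont (fun t => \sum_(k < M) F k t) /\
  cint 0 (pi *+ 2) (fun t => \sum_(k < M) F k t) = \sum_(k < M) cint 0 (pi *+ 2) (F k).
Proof.
move=> cF; elim: M => [|M [ih1 ih2]].
  under eq_fun do rewrite big_ord0; rewrite big_ord0 cint_cst// mulr0; split => //.
  exact: ccont_cst.
under eq_fun do rewrite big_ord_recr/=; rewrite big_ord_recr/= cintD// ih2; split => //.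
exact: ccontD.
Qed.

(** Since |z0| <= r / 2, the geometric series of w / (w - z0) has ratio at most 1/2 on the circle,
    and the remainder factor [K] has modulus at most 2. *)
Lemma cauchy_kernel_expansion (g : R -> R[i]) B : ccont g ->
  (forall t, 0 <= t <= pi *+ 2 -> nc (g t) <= B) -> forall M,
  nc (cint 0 (pi *+ 2) (fun t => g t * K t) -
      'i * \sum_(k < M) z0 ^+ k * cint 0 (pi *+ 2) (fun t => g t * w t ^- k))
    <= (2 * (B * 2 * (pi *+ 2))) / 2 ^+ M.
Proof.
move=> cg gB M.
have cwV k : ccont (fun t => w t ^- k).
  by apply: ccontV; [exact: cX|move=> t; rewrite expf_neq0].
have cF k : ccont (fun t => z0 ^+ k * (g t * w t ^- k)).
  by apply: ccontM; [exact: ccont_cst|exact: ccontM].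
have [cS IS] := cint_sum M cF.
have cR : ccont (fun t => g t * (z0 ^+ M * w t ^- M * K t)).
  by apply: ccontM => //; apply: ccontM => //; apply: ccontM => //; exact: ccont_cst.
have ciS : ccont (fun t => 'i * \sum_(k < M) z0 ^+ k * (g t * w t ^- k)).
  by apply: ccontM => //; exact: ccont_cst.
have -> : (fun t => g t * K t) = (fun t => 'i * \sum_(k < M) z0 ^+ k * (g t * w t ^- k) +
    g t * (z0 ^+ M * w t ^- M * K t)).
  apply/funext => t; rewrite {1}(K_split M t) mulrDr; congr (_ + _).
  by rewrite mulrCA mulr_sumr; congr (_ * _); apply: eq_bigr => k _; rewrite mulrCA.
rewrite (cintD _ _ ciS cR) (cintZ _ _ _ cS) IS.
rewrite (eq_bigr (fun k : 'I_M => z0 ^+ k * cint 0 (pi *+ 2) (fun t => g t * w t ^- k))); last first.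
  by move=> k _; rewrite cintZ//; exact: ccontM.
rewrite addrAC subrr add0r.
have := cint_norm (M := B * 2 / 2 ^+ M) pi20 cR; rewrite subr0 => H.
rewrite (le_trans (H _))//; last first.
  by rewrite le_eqVlt; apply/orP; left; apply/eqP; field; rewrite expf_neq0.
have nK t : nc (K t) <= 2.
  rewrite (Normc.normcM ('i * w t)) (Normc.normcM 'i) Normc.normcV ni mul1r nw.
  rewrite ler_pdivrMr ?(lt_le_trans _ (dist_w t)) ?divr_gt0//.
  by have := dist_w t; lra.
move=> t t2; rewrite (Normc.normcM (g t)) (Normc.normcM _ (K t)) (Normc.normcM (z0 ^+ M)) Normc.normcV !normcX nw.
have h : nc z0 ^+ M / r ^+ M <= 1 / 2 ^+ M.
  rewrite mul1r -!exprVn -exprMn; apply: lerXn2r; rewrite ?nnegrE ?invr_ge0// ?divr_ge0 ?normc_ge0 ?(ltW r0)//.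
  by rewrite ler_pdivrMr// mulrC.
rewrite -(mulrA B) ler_pM ?normc_ge0 ?gB//.
  by rewrite mulr_ge0 ?normc_ge0// divr_ge0 ?exprn_ge0 ?normc_ge0// ltW.
by rewrite mulrC ler_pM ?normc_ge0// ?divr_ge0 ?exprn_ge0 ?normc_ge0 ?(ltW r0)// -[leRHS]mul1r.
Qed.

(** The expansion with constant [g]: all terms but the one with k = 0 integrate to zero by
    [cint_expiN]. *)
Lemma cauchy_kernel_integral : cint 0 (pi *+ 2) K = (pi *+ 2)%:C * 'i.
Proof.
apply/eqP; rewrite -subr_eq0 -normc_eq0 eq_le normc_ge0 andbT.
apply: (@geo_small _ (2 * (1 * 2 * (pi *+ 2)) )) => M.
have c1 : ccont (fun=> 1 : R[i]) by exact: ccont_cst.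
have n1 (t : R) : 0 <= t <= pi *+ 2 -> nc ((fun=> 1) t) <= 1 by rewrite Normc.normc1.
have := cauchy_kernel_expansion c1 n1 M.+1.
have -> : (fun t => 1 * K t) = K by apply/funext => t; rewrite mul1r.
have -> : \sum_(k < M.+1) z0 ^+ k * cint 0 (pi *+ 2) (fun t => 1 * w t ^- k) = (pi *+ 2)%:C.
  rewrite big_ord_recl [X in _ + X]big1 ?addr0.
    rewrite (_ : (fun t => _) = (fun=> 1)); last by apply/funext => t; rewrite expr0 invr1 mul1r.
    by rewrite expr0 mul1r cint_cst// subr0 mulr1.
  move=> k _; rewrite (_ : (fun t => _) = (fun t => (r%:C ^- k.+1) * (expi t ^- k.+1))); last first.
    by apply/funext => t; rewrite mul1r /w exprMn invfM.
  rewrite cintZ; last by apply: ccontV; [apply: cX; exact: ccont_expi|move=> t; rewrite expf_neq0// expi_neq0].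
  by rewrite (cint_expiN (ltn0Sn k)) !mulr0.
rewrite [_ * 'i]mulrC => H; rewrite (le_trans H)//.
rewrite ler_wpM2l ?mulr_ge0// lef_pV2 ?posrE ?exprn_gt0// exprS ler_peMl ?exprn_ge0//.
by rewrite ler1n.
Qed.

End Disc.

Lemma taylor_disc (f : R[i]^o -> R[i]^o) (r : R) : entire f -> 0 < r ->
  exists (a : nat -> R[i]) (D : R), forall z, nc z <= r / 2 -> forall M : nat,
    nc (f z - \sum_(k < M) a k * z ^+ k) <= D / 2 ^+ M.
Proof.
move=> ef r0.
have pi0 : (0 : R) < pi *+ 2 by rewrite mulrn_wgt0 // pi_gt0.
pose w (t : R) : R[i] := r%:C * expi t.
have cw : ccont w by apply: ccontM; [exact: ccont_cst|exact: ccont_expi].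
have cfw : ccont (fun t => f (w t)) by exact: ccont_comp.
have [B B0 fB] := ccont_bounded (ltW pi0) cfw.
pose c : R[i] := (pi *+ 2)%:C * 'i.
have c0 : c != 0 by rewrite -normc_gt0 Normc.normcM normc_real gtr0_norm// /= expr0n expr1n add0r sqrtr1 mulr1.
exists (fun k => 'i / c * cint 0 (pi *+ 2) (fun t => f (w t) * w t ^- k)).
exists (nc c^-1 * (2 * (B * 2 * (pi *+ 2)))) => z zr M.
have zr' : nc z < r by rewrite (le_lt_trans zr)// ltr_pdivrMr// ltr_pMr// ltr1n.
have := cauchy_kernel_expansion r0 zr cfw fB M.
have := cauchy_integral ef zr'.
rewrite -/(w _).
have wz t : w t - z != 0.
  apply: contraTneq zr' => /eqP; rewrite subr_eq0 => /eqP <-.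
  by rewrite Normc.normcM normc_expi mulr1 normc_real gtr0_norm// ltxx.
have cK : ccont (fun t => 'i * w t / (w t - z)).
  apply: ccontM; first by apply: ccontM => //; exact: ccont_cst.
  by apply: ccontV => //; apply: ccontB => //; exact: ccont_cst.
have -> : (fun t : R => (f (w t) - f z) * ('i * w t / (w t - z))) =
   (fun t => f (w t) * ('i * w t / (w t - z)) - f z * ('i * w t / (w t - z))).
  by apply/funext => t; rewrite mulrBl.
rewrite cintB; [|exact: ccontM|by apply: ccontM => //; exact: ccont_cst].
rewrite cintZ// (cauchy_kernel_integral r0 zr) -/c => /eqP; rewrite subr_eq0 => /eqP ->.
move=> H; have -> : f z - \sum_(k < M) 'i / c * cint 0 (pi *+ 2) (fun t => f (w t) * w t ^- k) * z ^+ k =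
  c^-1 * (f z * c - 'i * \sum_(k < M) z ^+ k * cint 0 (pi *+ 2) (fun t => f (w t) * w t ^- k)).
  rewrite mulrBr mulrCA mulVf// mulr1; congr (_ - _).
  rewrite mulrA mulr_sumr; apply: eq_bigr => k _; ring.
rewrite (Normc.normcM c^-1) -(mulrA (nc c^-1)); apply: ler_wpM2l H; exact: normc_ge0.
Qed.

(* The ratio 1/2 on every disc amounts to an infinite radius of convergence. *)
Definition expands (f : R[i] -> R[i]) (a : nat -> R[i]) :=
  forall A : R, exists D, forall z, nc z <= A -> forall M : nat,
    nc (f z - \sum_(k < M) a k * z ^+ k) <= D / 2 ^+ M.

Lemma expansion_coef_bound (f : R[i] -> R[i]) (a : nat -> R[i]) (A D : R) : 0 <= A ->
  (forall z, nc z <= A -> forall M : nat,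
    nc (f z - \sum_(k < M) a k * z ^+ k) <= D / 2 ^+ M) ->
  forall k, nc (a k) * A ^+ k <= 2 * D / 2 ^+ k.
Proof.
move=> A0 H k.
have nA : nc A%:C <= A by rewrite normc_real ger0_norm.
have h1 := H _ nA k; have h2 := H _ nA k.+1.
have -> : nc (a k) * A ^+ k = nc (a k * A%:C ^+ k) by rewrite Normc.normcM normcX normc_real ger0_norm.
have -> : a k * A%:C ^+ k = (f A%:C - \sum_(j < k) a j * A%:C ^+ j) - (f A%:C - \sum_(j < k.+1) a j * A%:C ^+ j).
  by rewrite big_ord_recr /=; ring.
rewrite (le_trans (le_normcD _ _))// normcN.
have D0 : 0 <= D / 2 ^+ k.+1 by exact: le_trans (normc_ge0 _) h2.
have : D / 2 ^+ k = 2 * (D / 2 ^+ k.+1) by rewrite exprS; field; rewrite expf_neq0.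
by move: h1 h2 D0; rewrite -[2 * D / _]mulrA; lra.
Qed.

Lemma expansion_unique (f : R[i] -> R[i]) (a b : nat -> R[i]) (A D : R) : 0 < A ->
  (forall z, nc z <= A -> forall M : nat,
    nc (f z - \sum_(k < M) a k * z ^+ k) <= D / 2 ^+ M) ->
  (forall z, nc z <= A -> forall M : nat,
    nc (f z - \sum_(k < M) b k * z ^+ k) <= D / 2 ^+ M) ->
  forall k, a k = b k.
Proof.
move=> A0 Ha Hb.
have {Ha Hb} : forall z, nc z <= A -> forall M : nat,
    nc (0 - \sum_(k < M) (a k - b k) * z ^+ k) <= (2 * D) / 2 ^+ M.
  move=> z zA M; have := le_normcD (f z - \sum_(k < M) a k * z ^+ k) (- (f z - \sum_(k < M) b k * z ^+ k)).
  rewrite normcN => H; rewrite -mulrA mulr_natl mulr2n (le_trans _ (lerD (Ha z zA M) (Hb z zA M)))//.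
  rewrite (le_trans _ H)// le_eqVlt; apply/orP; left; apply/eqP; congr nc.
  have -> : \sum_(k < M) (a k - b k) * z ^+ k = \sum_(k < M) a k * z ^+ k - \sum_(k < M) b k * z ^+ k.
    by rewrite -sumrB; apply: eq_bigr => k _; rewrite mulrBl.
  by ring.
set c := fun k => a k - b k; move: (2 * D) => D' H.
suff c0 : forall k, c k = 0 by move=> k; apply/eqP; rewrite -subr_eq0; apply/eqP/c0.
have cb := @expansion_coef_bound (fun=> 0) c A D' (ltW A0) H.
have D0 : 0 <= D'.
  have := cb 0%N; rewrite !expr0 mulr1 divr1 => /(le_trans (normc_ge0 _)).
  by rewrite pmulr_rge0.
elim/ltn_ind => k ih.
apply/eqP; rewrite -normc_eq0 eq_le normc_ge0 andbT.
(* The earlier coefficients vanish, so at the point [A * t] with t = 2^-n the term of degree [k] is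
   of order t^k and everything else of order t^(k+1). After division by t^k, letting [n] grow kills
   the coefficient. *)
rewrite -(pmulr_lle0 _ (exprn_gt0 k A0)).
apply: (@geo_small _ (4 * D' + D')) => n.
pose t : R := 2 ^- n.
have t0 : 0 < t by rewrite invr_gt0 exprn_gt0.
have t1 : t <= 1 by rewrite invf_le1 ?exprn_gt0// exprn_ege1// ler1n.
rewrite -/t.
have nz : nc (A * t)%:C <= A.
  by rewrite normc_real ger0_norm ?mulr_ge0 ?(ltW t0) ?(ltW A0)// ler_piMr// ltW.
(* Truncation at this order makes the error [D' / 2 ^+ N] at most D' t^(k+1). *)
pose N := (k.+1 + n * k.+1)%N.
have := H _ nz N.
rewrite sub0r normcN.
have -> : \sum_(j < N) (a j - b j) * (A * t)%:C ^+ j =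
  c k * (A * t)%:C ^+ k + \sum_(k.+1 <= j < N) c j * (A * t)%:C ^+ j.
  rewrite -(big_mkord xpredT (fun j => c j * (A * t)%:C ^+ j)).
  rewrite (big_cat_nat (n := k.+1))//= ?leq_addr//; congr (_ + _).
  rewrite big_nat_recr//= big_nat big1 ?add0r// => j /andP[_ /ih ->].
  by rewrite mul0r.
set S := \sum_(_ <= _ < _) _.
have nS : nc S <= 4 * D' * t ^+ k.+1.
  rewrite (le_trans (normc_sum _ _ _))//.
  rewrite (@le_trans _ _ (\sum_(k.+1 <= j < N) (2 * D' * t ^+ k.+1) / 2 ^+ j))//.
    apply: ler_sum_nat => j /andP[kj _].
    rewrite Normc.normcM normcX normc_real ger0_norm ?mulr_ge0 ?(ltW t0) ?(ltW A0)//.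
    rewrite exprMn mulrA (le_trans (ler_pM _ _ (cb j) (lexx _)))//.
    - by rewrite mulr_ge0 ?normc_ge0 ?exprn_ge0 ?(ltW A0).
    - by rewrite exprn_ge0// ltW.
    rewrite mulrAC ler_pM2r ?invr_gt0 ?exprn_gt0//.
    by rewrite ler_wpM2l ?mulr_ge0// ler_wiXn2l// ltW.
  rewrite -mulr_sumr [leRHS](_ : _ = 2 * D' * t ^+ k.+1 * 2); last by ring.
  rewrite ler_wpM2l ?mulr_ge0 ?exprn_ge0 ?(ltW t0)//.
  have gs m : \sum_(0 <= j < m) (2 : R) ^- j = 2 - 2 * 2 ^- m.
    elim: m => [|m IH]; first by rewrite big_nil expr0 invr1 mulr1 subrr.
    rewrite big_nat_recr//= IH exprS; field.
    by rewrite expf_neq0.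
  have := gs N; rewrite (big_cat_nat (n := k.+1))//= ?leq_addr//.
  have : 0 <= \sum_(0 <= i < k.+1) (2 : R) ^- i by apply: sumr_ge0 => i _; rewrite invr_ge0 exprn_ge0.
  have : 0 < (2 : R) ^- N by rewrite invr_gt0 exprn_gt0.
  by lra.
have -> : D' / 2 ^+ N = D' * t ^+ k.+1 / 2 ^+ k.+1.
  by rewrite /N exprD exprM invfM /t exprVn; ring.
move=> hN.
have : nc (c k * (A * t)%:C ^+ k) <= D' * t ^+ k.+1 + 4 * D' * t ^+ k.+1.
  have -> : c k * (A * t)%:C ^+ k = (c k * (A * t)%:C ^+ k + S) - S by rewrite addrK.
  rewrite (le_trans (le_normcD _ _))// normcN lerD//.
  rewrite (le_trans hN)// ler_pdivrMr ?exprn_gt0// ler_peMr ?mulr_ge0 ?exprn_ge0 ?(ltW t0)//.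
  by rewrite exprn_ege1// ler1n.
rewrite Normc.normcM normcX normc_real ger0_norm ?mulr_ge0 ?(ltW t0) ?(ltW A0)//.
rewrite exprMn mulrA exprS => h.
have tk : 0 < t ^+ k by rewrite exprn_gt0.
rewrite -(ler_pM2r tk) (le_trans h)// le_eqVlt; apply/orP; left; apply/eqP; ring.
Qed.

(** The coefficients are taken from the circle of radius 2, which controls only the unit disc. A
    larger disc uses a larger circle, and uniqueness on the unit disc shows that its coefficients
    are the same. *)
Lemma entire_expands (f : R[i]^o -> R[i]^o) : entire f -> exists a, expands f a.
Proof.
move=> ef.
have [a [D aD]] := taylor_disc ef (ltr0Sn R 1).
exists a => A.
pose r := Num.max 2 (2 * A).
have r0 : 0 < r by rewrite lt_max ltr0n.
have [b [D' bD]] := taylor_disc ef r0.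
exists D' => z zA M.
have -> : \sum_(k < M) a k * z ^+ k = \sum_(k < M) b k * z ^+ k.
  apply: eq_bigr => k _; congr (_ * _).
  have h1 x : nc x <= 1 -> forall M : nat, nc (f x - \sum_(k < M) a k * x ^+ k) <= Num.max D D' / 2 ^+ M.
    move=> x1 m; rewrite (le_trans (aD x _ m))// ?divff ?pnatr_eq0//.
    by rewrite ler_pM2r ?invr_gt0 ?exprn_gt0// le_max lexx.
  have h2 x : nc x <= 1 -> forall M : nat, nc (f x - \sum_(k < M) b k * x ^+ k) <= Num.max D D' / 2 ^+ M.
    move=> x1 m; rewrite (le_trans (bD x _ m))//.
      by rewrite (le_trans x1)// ler_pdivlMr// mul1r le_max lexx.
    by rewrite ler_pM2r ?invr_gt0 ?exprn_gt0// le_max lexx orbT.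
  exact: expansion_unique ltr01 h1 h2 k.
by apply: bD; rewrite (le_trans zA)// ler_pdivlMr// mulrC le_max lexx orbT.
Qed.

End Taylor.

(** * Lebesgue measure on the plane *)

Section PlaneInvariance.
Context {R : realType}.
Local Notation mR := (measurableTypeR R).
Local Notation plane := (mR * mR)%type.
Local Notation lam := (@lebesgue_measure R).
Local Notation mu := (planar_lebesgue R).
Local Open Scope ereal_scope.

Lemma lebesgue_shift (c : R) (A : set mR) : measurable A ->
  pushforward lam (fun x : mR => (x + c)%R : mR) A = lam A.
Proof.
have ms : measurable_fun setT (fun x : mR => (x + c)%R : mR).
  by apply: measurable_funD; [exact: measurable_id|exact: measurable_cst].
move=> mA; apply/esym; apply: (@lebesgue_measure_unique R (pushforward lam (fun x : mR => (x + c)%R : mR))) => // X.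
case=> -[a b] _ <- /=; rewrite /pushforward.
have -> : ((fun x : mR => (x + c)%R) @^-1` `]a, b]%classic = `](a - c)%R, (b - c)%R]%classic :> set R).
  by apply/seteqP; split => x /=; rewrite !in_itv/= ltrBlDr lerBrDr.
rewrite !lebesgue_measure_itv/= !lte_fin ltrD2r; case: ifPn => // _.
by rewrite -!EFinD; congr EFin; ring.
Qed.

Lemma ge0_integral_shift (c : R) (f : mR -> \bar R) : measurable_fun setT f ->
  (forall x, 0 <= f x) -> \int[lam]_x f (x + c)%R = \int[lam]_x f x.
Proof.
move=> mf f0.
have ms : measurable_fun setT (fun x : mR => (x + c)%R : mR).
  by apply: measurable_funD; [exact: measurable_id|exact: measurable_cst].
have := @ge0_integral_pushforward _ _ _ _ _ _ ms lam setT f measurableT mf (fun y _ => f0 y).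
rewrite preimage_setT => <-.
apply: eq_measure_integral => A mA _; exact: lebesgue_shift.
Qed.

(** Stated for nonnegative functions, where Tonelli applies without integrability; signed functions
    follow through positive and negative parts in [Rintegral_preserving]. *)
Definition preserving (phi : plane -> plane) :=
  measurable_fun setT phi /\ forall F : plane -> \bar R, measurable_fun setT F ->
  (forall p, 0 <= F p) -> \int[mu]_p F (phi p) = \int[mu]_p F p.

Lemma preserving_comp phi psi : preserving phi -> preserving psi -> preserving (phi \o psi).
Proof.
move=> [m1 H1] [m2 H2]; split; first exact: measurableT_comp.
move=> F mF F0; rewrite (H2 (F \o phi))//.
- by rewrite H1.
- exact: measurableT_comp.
- by move=> p; exact: F0.
Qed.

Lemma preserving_swap : preserving (fun p => (p.2, p.1)).
Proof.
have ms : measurable_fun setT (fun p : plane => (p.2, p.1) : plane).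
  by apply: measurable_fun_pair; [exact: measurable_snd|exact: measurable_fst].
split=> // F mF F0.
rewrite /planar_lebesgue (@fubini_tonelli1 _ _ _ _ _ lam lam (F \o (fun p : plane => (p.2, p.1) : plane))) //.
- by rewrite (@fubini_tonelli2 _ _ _ _ _ lam lam F).
- exact: measurableT_comp.
- by move=> p; exact: F0.
Qed.

Lemma preserving_shear (a c : R) : preserving (fun p => ((p.1 + (a * p.2 + c))%R, p.2)).
Proof.
have ms : measurable_fun setT (fun p : plane => ((p.1 + (a * p.2 + c))%R, p.2) : plane).
  apply: measurable_fun_pair; last exact: measurable_snd.
  apply: measurable_funD; first exact: measurable_fst.
  apply: measurable_funD; last exact: measurable_cst.
  by apply: measurable_funM; [exact: measurable_cst|exact: measurable_snd].
split=> // F mF F0.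
rewrite /planar_lebesgue (@fubini_tonelli2 _ _ _ _ _ lam lam (F \o (fun p : plane => ((p.1 + (a * p.2 + c))%R, p.2) : plane))) //; last 2 first.
- exact: measurableT_comp.
- by move=> p; exact: F0.
rewrite [RHS](@fubini_tonelli2 _ _ _ _ _ lam lam F mF F0).
apply: eq_integral => y _; rewrite /fubini_G /=.
apply: (@ge0_integral_shift (a * y + c)%R (fun x => F (x, y))) => //.
by exact: measurable_fun_pair1.
Qed.

Lemma preserving_id : preserving id.
Proof. by split. Qed.

Lemma preserving_ext phi psi : phi =1 psi -> preserving phi -> preserving psi.
Proof. by move=> /funext ->. Qed.

(** A rotation with s != 0 is a product of three shears, two horizontal ones of slope -t around a
    vertical one of slope s, where t = (1 - c) / s is the tangent of the half angle. For s = 0 it is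
    the identity or the square of the quarter turn. *)
Lemma preserving_rot (c s : R) : (c ^+ 2 + s ^+ 2 = 1)%R ->
  preserving (fun p => ((c * p.1 - s * p.2)%R, (s * p.1 + c * p.2)%R)).
Proof.
have rot1 c' s' : (s' != 0 -> c' ^+ 2 + s' ^+ 2 = 1)%R -> (s' != 0)%R ->
    preserving (fun p => ((c' * p.1 - s' * p.2)%R, (s' * p.1 + c' * p.2)%R)).
  move=> /[swap] s0 /(_ s0) cs; pose t := ((1 - c') / s')%R.
  have Sy := preserving_comp preserving_swap (preserving_comp (preserving_shear s' 0) preserving_swap).
  apply: preserving_ext (preserving_comp (preserving_shear (- t) 0) (preserving_comp Sy (preserving_shear (- t) 0))) => p /=.
  have ts : (t * s' = 1 - c')%R by rewrite /t divfK.
  have tc : (t * (1 + c') = s')%R.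
    by apply: (mulIf s0); rewrite mulrAC ts -expr2; move: cs => /(congr1 (fun x => x - c' ^+ 2)%R); rewrite addrAC subrr add0r => ->; ring.
  case: p => x y /=; move: (x : R) (y : R) => {}x {}y.
  clearbody t; congr pair.
    have -> : (x + (- t * y + 0) + (- t * (y + (s' * (x + (- t * y + 0)) + 0)) + 0) =
      x - (t * s') * x - (t * (1 + (1 - t * s'))) * y)%R by ring.
    by rewrite ts -[in RHS]tc; ring.
  have -> : (y + (s' * (x + (- t * y + 0)) + 0) = s' * x + (1 - t * s') * y)%R by ring.
  by rewrite ts; ring.
move=> cs; have [s0|s0] := eqVneq s 0%R; last exact: rot1.
have : (c ^+ 2 == 1)%R by rewrite -cs s0 expr0n addr0.
rewrite sqrf_eq1 => /orP[]/eqP ->; rewrite s0.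
  apply: preserving_ext preserving_id => p /=.
  by rewrite !mul0r !mul1r subr0 add0r -surjective_pairing.
have r90 : preserving (fun p => ((0 * p.1 - 1 * p.2)%R, (1 * p.1 + 0 * p.2)%R)).
  by apply: rot1; rewrite ?oner_eq0// => _; rewrite expr0n expr1n add0r.
apply: preserving_ext (preserving_comp r90 r90) => p /=.
by rewrite !mul0r !mul1r; congr pair; ring.
Qed.

Lemma preserving_shift (a b : R) : preserving (fun p => ((p.1 + a)%R, (p.2 + b)%R)).
Proof.
have Sy := preserving_comp preserving_swap (preserving_comp (preserving_shear 0 b) preserving_swap).
apply: preserving_ext (preserving_comp (preserving_shear 0 a) Sy) => p /=.
by congr pair; ring.
Qed.

Lemma preserving_conj : preserving (fun p => (p.1, (- p.2)%R)).
Proof.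
have r90 : preserving (fun p => ((0 * p.1 - (-1) * p.2)%R, ((-1) * p.1 + 0 * p.2)%R)).
  by apply: preserving_rot; rewrite expr0n sqrrN expr1n add0r.
apply: preserving_ext (preserving_comp r90 preserving_swap) => p /=.
by congr pair; ring.
Qed.

Lemma Rintegral_preserving phi (F : plane -> R) : preserving phi ->
  measurable_fun setT (F : plane -> mR) ->
  (\int[mu]_p F (phi p) = \int[mu]_p F p)%R.
Proof.
move=> [mphi H] mF; rewrite /Rintegral; congr fine.
rewrite integralE [in RHS]integralE.
have mF' : measurable_fun setT (EFin \o F) by exact/measurable_EFinP.
have Hp := H ((EFin \o F)^\+) (measurable_funepos mF') (funepos_ge0 _).
have Hn := H ((EFin \o F)^\-) (measurable_funeneg mF') (funeneg_ge0 _).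
rewrite (funepos_comp (EFin \o F) phi) (funeneg_comp (EFin \o F) phi).
by rewrite Hp Hn.
Qed.

Lemma integrable_preserving phi (F : plane -> R) : preserving phi ->
  mu.-integrable setT (EFin \o F) -> mu.-integrable setT (EFin \o (F \o phi)).
Proof.
move=> [mphi H] /integrableP[mF iF]; apply/integrableP; split.
  exact: measurableT_comp mF mphi.
rewrite (_ : (fun x => _) = (fun p => ((abse \o (EFin \o F)) (phi p)))) // H//.
- by apply: measurableT_comp mF; exact: abse_measurable.
- by move=> p; exact: abse_ge0.
Qed.

End PlaneInvariance.

(** * Real integrals over the plane *)

Section PlaneIntegral.
Context {R : realType}.
Local Notation mR := (measurableTypeR R).
Local Notation plane := (mR * mR)%type.
Local Notation mu := (planar_lebesgue R).

Definition mfun (F : R * R -> R) := measurable_fun [set: plane] (F : plane -> mR).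
Definition integ (F : R * R -> R) := mu.-integrable setT (EFin \o (F : plane -> R)).
Definition plane_int (F : R * R -> R) : R := Rintegral mu setT F.

Lemma integ_mfun F : integ F -> mfun F.
Proof. by move=> /integrableP[mF _]; exact/measurable_EFinP. Qed.

Lemma mfun_cst (c : R) : mfun (fun=> c).
Proof. exact: measurable_cst. Qed.

Lemma mfunD F G : mfun F -> mfun G -> mfun (fun p => F p + G p).
Proof. exact: measurable_funD. Qed.

Lemma mfunM F G : mfun F -> mfun G -> mfun (fun p => F p * G p).
Proof. exact: measurable_funM. Qed.

Lemma mfunN F : mfun F -> mfun (fun p => - F p).
Proof. exact: measurable_funN. Qed.

Lemma mfunB F G : mfun F -> mfun G -> mfun (fun p => F p - G p).
Proof. exact: measurable_funB. Qed.

Lemma mfunX F n : mfun F -> mfun (fun p => F p ^+ n).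
Proof. by move=> mF; exact: measurable_funX. Qed.

Lemma mfun_lim (h : nat -> R * R -> R) F : (forall n, mfun (h n)) ->
  (forall p, h n p @[n --> \oo] --> F p) -> mfun F.
Proof. by move=> mh hF; apply: (@measurable_fun_cvg _ plane R setT h F). Qed.

Lemma mfun_expR F : mfun F -> mfun (fun p => expR (F p)).
Proof. by move=> mF; apply: measurableT_comp mF; exact: measurable_expR. Qed.

Lemma mfun_indic (A : set plane) : measurable A -> mfun (\1_A).
Proof. exact: measurable_indic. Qed.

Lemma integ0 : integ (fun=> 0).
Proof. exact: integrable0. Qed.

Lemma integD F G : integ F -> integ G -> integ (fun p => F p + G p).
Proof. by move=> iF iG; have := integrableD measurableT iF iG. Qed.

Lemma integZ c F : integ F -> integ (fun p => c * F p).
Proof. by move=> iF; have := integrableZl measurableT c iF. Qed.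

Lemma integN F : integ F -> integ (fun p => - F p).
Proof. by move=> /(integZ (-1)); under eq_fun do rewrite mulN1r. Qed.

Lemma integB F G : integ F -> integ G -> integ (fun p => F p - G p).
Proof. by move=> iF iG; apply: integD => //; exact: integN. Qed.

Lemma integ_le F G : mfun F -> (forall p, `|F p| <= G p) -> integ G -> integ F.
Proof.
move=> mF FG; apply: le_integrable => //; first exact/measurable_EFinP.
by move=> p _; rewrite lee_fin (le_trans (FG p))// ler_norm.
Qed.

Lemma integ_norm F : integ F -> integ (fun p => `|F p|).
Proof. exact: integrable_norm. Qed.

Lemma plane_intD F G : integ F -> integ G -> plane_int (fun p => F p + G p) = plane_int F + plane_int G.
Proof. by move=> iF iG; apply: RintegralD. Qed.

Lemma plane_intZ c F : integ F -> plane_int (fun p => c * F p) = c * plane_int F.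
Proof. by move=> iF; apply: RintegralZl. Qed.

Lemma plane_intN F : integ F -> plane_int (fun p => - F p) = - plane_int F.
Proof. by move=> iF; rewrite -mulN1r -plane_intZ//; congr plane_int; apply/funext => p; rewrite mulN1r. Qed.

Lemma plane_intB F G : integ F -> integ G -> plane_int (fun p => F p - G p) = plane_int F - plane_int G.
Proof. by move=> iF iG; apply: RintegralB. Qed.

Lemma plane_int0 : plane_int (fun=> 0) = 0.
Proof. by rewrite /plane_int /Rintegral integral0. Qed.

Lemma plane_int_le F G : integ F -> integ G -> (forall p, F p <= G p) -> plane_int F <= plane_int G.
Proof. by move=> iF iG FG; apply: le_Rintegral. Qed.

Lemma plane_int_ge0 F : (forall p, 0 <= F p) -> 0 <= plane_int F.
Proof. by move=> F0; apply: Rintegral_ge0. Qed.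

Lemma plane_int_norm F : integ F -> `|plane_int F| <= plane_int (fun p => `|F p|).
Proof. by move=> iF; apply: le_normr_Rintegral. Qed.

Lemma integ_sum (F : nat -> R * R -> R) M : (forall k, (k < M)%N -> integ (F k)) ->
  integ (fun p => \sum_(k < M) F k p) /\ plane_int (fun p => \sum_(k < M) F k p) = \sum_(k < M) plane_int (F k).
Proof.
elim: M => [_|M ih H].
  under eq_fun do rewrite big_ord0; rewrite big_ord0 plane_int0; split => //; exact: integ0.
have [ih1 ih2] := ih (fun k kM => H k (ltnW kM)).
have iM := H M (ltnSn M).
under eq_fun do rewrite big_ord_recr/=; rewrite big_ord_recr/= plane_intD// ih2; split => //.
exact: integD.
Qed.

Lemma integ_EFin F : mfun F -> (forall p, 0 <= F p) ->
  (\int[mu]_p (F p)%:E < +oo)%E -> integ F.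
Proof.
move=> mF F0 H; apply/integrableP; split; first exact/measurable_EFinP.
rewrite [X in (X < _)%E](_ : _ = \int[mu]_p (F p)%:E)%E//.
by apply: eq_integral => p _ /=; rewrite ger0_norm.
Qed.

Lemma plane_int_EFin F : integ F -> (\int[mu]_p (F p)%:E = (plane_int F)%:E)%E.
Proof.
move=> iF; rewrite /plane_int /Rintegral fineK//.
exact: integrable_fin_num iF.
Qed.

(** Fatou's lemma in the form used for Bessel's inequality and for the sums of power series:
    integrability of the limit comes with the bound. *)
Lemma plane_int_fatou (h : nat -> R * R -> R) F B : (forall n, integ (h n)) ->
  (forall n p, 0 <= h n p) -> (forall p, h n p @[n --> \oo] --> F p) ->
  (forall n, plane_int (h n) <= B) -> integ F /\ plane_int F <= B.
Proof.
move=> ih h0 hF hB.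
have F0 p : 0 <= F p.
  rewrite -(cvg_lim _ (hF p))//; apply: limr_ge; first by apply: cvgP; exact: hF.
  by near=> n; exact: h0.
have mF : mfun F by apply: mfun_lim hF => n; exact: integ_mfun.
have mh n : measurable_fun setT (fun p : plane => (h n p)%:E).
  by apply/measurable_EFinP; exact: integ_mfun.
have h0' n (p : plane) : setT p -> (0 <= (h n p)%:E)%E by rewrite lee_fin.
have := fatou mu measurableT mh h0'.
have -> : (fun p : plane => limn_einf ((fun n => (h n p)%:E))) = (fun p => (F p)%:E).
  apply/funext => p.
  have hE : (fun n => (h n p)%:E) @ \oo --> (F p)%:E by apply: cvg_EFin (hF p); exact: nearW.
  by rewrite (cvg_limn_einf_sup hE).1.
have -> : (fun n => \int[mu]_p (h n p)%:E)%E = (fun n => (plane_int (h n))%:E).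
  by apply/funext => n; rewrite plane_int_EFin.
move=> H.
have {}H : (\int[mu]_p (F p)%:E <= B%:E)%E.
  rewrite (le_trans H)//; rewrite limn_einf_lim; apply: lime_le; first exact: is_cvg_einfs.
  apply: nearW => n; apply: (@le_trans _ _ (plane_int (h n))%:E); last by rewrite lee_fin.
  by apply: ereal_inf_lbound; exists n => /=.
have iF : integ F by apply: integ_EFin => //; exact: le_lt_trans H (ltry _).
by split => //; rewrite -lee_fin -plane_int_EFin.
Unshelve. all: by end_near. Qed.

End PlaneIntegral.

(** * Complex integrals over the plane *)

Section ComplexIntegral.
Context {R : realType}.
Local Notation nc := (@Normc.normc R).
Local Notation tc := (@to_complex R).

Definition cmeas (f : R[i] -> R[i]) :=
  mfun (fun p => complex.Re (f (tc p))) /\ mfun (fun p => complex.Im (f (tc p))).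

Lemma cmeas_cst (c : R[i]) : cmeas (fun=> c).
Proof. by split; exact: mfun_cst. Qed.

Lemma cmeas_id : cmeas id.
Proof. by split; [exact: measurable_fst|exact: measurable_snd]. Qed.

Lemma cmeasD f g : cmeas f -> cmeas g -> cmeas (fun z => f z + g z).
Proof.
move=> [f1 f2] [g1 g2]; split; under eq_fun do rewrite raddfD; exact: mfunD.
Qed.

Lemma cmeasM f g : cmeas f -> cmeas g -> cmeas (fun z => f z * g z).
Proof.
move=> [f1 f2] [g1 g2]; split.
  rewrite (_ : (fun p => _) = (fun p => complex.Re (f (tc p)) * complex.Re (g (tc p)) - complex.Im (f (tc p)) * complex.Im (g (tc p)))).
    by apply: mfunB; exact: mfunM.
  by apply/funext => p; case: (f (tc p)) (g (tc p)) => ? ? [].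
rewrite (_ : (fun p => _) = (fun p => complex.Re (f (tc p)) * complex.Im (g (tc p)) + complex.Im (f (tc p)) * complex.Re (g (tc p)))).
  by apply: mfunD; exact: mfunM.
by apply/funext => p; case: (f (tc p)) (g (tc p)) => ? ? [].
Qed.

Lemma cmeas_conj f : cmeas f -> cmeas (fun z => (f z)^*).
Proof.
move=> [f1 f2]; split.
  by rewrite (_ : (fun p => _) = (fun p => complex.Re (f (tc p))))//; apply/funext => p; case: (f (tc p)).
rewrite (_ : (fun p => _) = (fun p => - complex.Im (f (tc p)))); first exact: mfunN.
by apply/funext => p; case: (f (tc p)).
Qed.

Lemma cmeas_real (F : R[i] -> R) : mfun (fun p => F (tc p)) -> cmeas (fun z => (F z)%:C).
Proof. by split => //; exact: mfun_cst. Qed.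

Lemma cmeasB f g : cmeas f -> cmeas g -> cmeas (fun z => f z - g z).
Proof.
move=> mf mg; rewrite (_ : (fun z => _) = (fun z => f z + (-1) * g z)).
  by apply: cmeasD => //; apply: cmeasM => //; exact: cmeas_cst.
by apply/funext => z; rewrite mulN1r.
Qed.

Lemma cmeasX f n : cmeas f -> cmeas (fun z => f z ^+ n).
Proof.
move=> mf; elim: n => [|n ih]; first exact: cmeas_cst.
by under eq_fun do rewrite exprS; exact: cmeasM.
Qed.

Lemma cmeas_sum (F : nat -> R[i] -> R[i]) M : (forall k, cmeas (F k)) ->
  cmeas (fun z => \sum_(k < M) F k z).
Proof.
move=> mF; elim: M => [|M ih].
  by under eq_fun do rewrite big_ord0; exact: cmeas_cst.
by under eq_fun do rewrite big_ord_recr/=; exact: cmeasD.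
Qed.

Lemma cmeas_poly (a : nat -> R[i]) M : cmeas (fun z => \sum_(k < M) a k * z ^+ k).
Proof.
apply: (@cmeas_sum (fun k z => a k * z ^+ k)) => k.
by apply: cmeasM; [exact: cmeas_cst|apply: cmeasX; exact: cmeas_id].
Qed.

Lemma mfun_normc2 f : cmeas f -> mfun (fun p => nc (f (tc p)) ^+ 2).
Proof.
move=> [f1 f2]; under eq_fun do rewrite normc_sqr.
by apply: mfunD; exact: mfunX.
Qed.

Lemma cvg_geometric_bound (u : nat -> R) (l D : R) :
  (forall M, `|l - u M| <= D / 2 ^+ M) -> u n @[n --> \oo] --> l.
Proof.
move=> H; apply/cvgrPdist_le => e e0.
have D0 : 0 <= `|D| by [].
exists (Num.truncn (`|D| / e)).+1 => // M /= NM.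
rewrite (le_trans (H M))// (@le_trans _ _ (`|D| / 2 ^+ M))//.
  by rewrite ler_pM2r ?invr_gt0 ?exprn_gt0// ler_norm.
rewrite ler_pdivrMr ?exprn_gt0// mulrC -ler_pdivrMr// ltW//.
rewrite (lt_le_trans (truncnS_gt _))// -natrX ler_nat (leq_trans NM)// ltnW// ltn_expl//.
Qed.

Lemma expands_cvg f a p : expands f a ->
  complex.Re (\sum_(k < n) a k * (tc p) ^+ k) @[n --> \oo] --> complex.Re (f (tc p)) /\
  complex.Im (\sum_(k < n) a k * (tc p) ^+ k) @[n --> \oo] --> complex.Im (f (tc p)).
Proof.
move=> /(_ (nc (tc p)))[D H]; split; apply: (@cvg_geometric_bound _ _ D) => M.
  by rewrite -raddfB (le_trans (normc_Re _))// H.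
by rewrite -raddfB (le_trans (normc_Im _))// H.
Qed.

Lemma cmeas_expands f a : expands f a -> cmeas f.
Proof.
move=> fa; split.
  apply: (@mfun_lim R (fun n p => complex.Re (\sum_(k < n) a k * (tc p) ^+ k))) => [n|p].
    by have [] := cmeas_poly a n.
  by have [] := expands_cvg p fa.
apply: (@mfun_lim R (fun n p => complex.Im (\sum_(k < n) a k * (tc p) ^+ k))) => [n|p].
  by have [] := cmeas_poly a n.
by have [] := expands_cvg p fa.
Qed.

Definition cinteg (F : R[i] -> R[i]) :=
  integ (fun p => complex.Re (F (tc p))) /\ integ (fun p => complex.Im (F (tc p))).

Lemma cintegD F G : cinteg F -> cinteg G -> cinteg (fun z => F z + G z).
Proof.
move=> [f1 f2] [g1 g2]; split; under eq_fun do rewrite raddfD; exact: integD.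
Qed.

Lemma cintegralD (F G : R[i]^o -> R[i]^o) : cinteg F -> cinteg G ->
  cintegral (fun z => F z + G z) = cintegral F + cintegral G.
Proof.
move=> [f1 f2] [g1 g2]; rewrite /cintegral -!/(plane_int _).
under [in LHS]eq_fun do rewrite raddfD; rewrite plane_intD//; congr (_ +i* _).
by under [in LHS]eq_fun do rewrite raddfD; rewrite plane_intD.
Qed.

Lemma cintegZ_subproof (c : R[i]) (F : R[i]^o -> R[i]^o) : cinteg F ->
  cinteg (fun z => c * F z) /\ cintegral (fun z => c * F z) = c * cintegral F.
Proof.
move=> [f1 f2]; case: c => a b; rewrite /cinteg /cintegral -!/(plane_int _).
have -> : (fun p => complex.Re ((a +i* b) * F (tc p))) = (fun p => a * complex.Re (F (tc p)) + (- b) * complex.Im (F (tc p))).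
  by apply/funext => p; case: (F (tc p)) => ? ? /=; rewrite mulNr.
have -> : (fun p => complex.Im ((a +i* b) * F (tc p))) = (fun p => a * complex.Im (F (tc p)) + b * complex.Re (F (tc p))).
  by apply/funext => p; case: (F (tc p)) => ? ? /=.
split; first by split; apply: integD; exact: integZ.
by rewrite !plane_intD ?plane_intZ//; try exact: integZ; rewrite mulNr.
Qed.

Lemma cintegZ (c : R[i]) F : cinteg F -> cinteg (fun z => c * F z).
Proof. by move=> /(cintegZ_subproof c)[]. Qed.

Lemma cintegralZ (c : R[i]) (F : R[i]^o -> R[i]^o) : cinteg F -> cintegral (fun z => c * F z) = c * cintegral F.
Proof. by move=> /(cintegZ_subproof c)[]. Qed.

Lemma cintegral_conj (F : R[i]^o -> R[i]^o) : cinteg F -> cintegral (fun z => (F z)^*) = (cintegral F)^*.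
Proof.
move=> [f1 f2]; rewrite /cintegral -!/(plane_int _).
have -> : (fun p => complex.Re (F (tc p))^*) = (fun p => complex.Re (F (tc p))).
  by apply/funext => p; case: (F (tc p)).
have -> : (fun p => complex.Im (F (tc p))^*) = (fun p => - complex.Im (F (tc p))).
  by apply/funext => p; case: (F (tc p)).
by rewrite plane_intN.
Qed.

Lemma cintegral0 : cintegral (fun=> 0 : R[i]^o) = 0.
Proof. by rewrite /cintegral -!/(plane_int _) plane_int0. Qed.

Lemma cinteg_le (F : R[i] -> R[i]) (G : R * R -> R) : cmeas F -> (forall p, nc (F (tc p)) <= G p) ->
  integ G -> cinteg F.
Proof.
move=> [f1 f2] FG iG; split; apply: integ_le iG => // p; rewrite (le_trans _ (FG p))//.
  exact: normc_Re.
exact: normc_Im.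
Qed.

Lemma cintegral_norm (F : R[i]^o -> R[i]^o) (G : R * R -> R) : cinteg F ->
  (forall p, nc (F (tc p)) <= G p) -> integ G -> nc (cintegral F) <= 2 * plane_int G.
Proof.
move=> [f1 f2] FG iG; rewrite (le_trans (normc_le_ReIm _))//= mulr_natl mulr2n lerD//.
  rewrite (le_trans (plane_int_norm f1))//; apply: plane_int_le => //; first exact: integ_norm.
  by move=> p; rewrite (le_trans (normc_Re _)).
rewrite (le_trans (plane_int_norm f2))//; apply: plane_int_le => //; first exact: integ_norm.
by move=> p; rewrite (le_trans (normc_Im _)).
Qed.

Lemma tc_rot (t : R) p : tc (cos t * p.1 - sin t * p.2, sin t * p.1 + cos t * p.2) = expi t * tc p.
Proof. by apply/eqP; rewrite eq_complex /= eqxx [X in X == _]addrC eqxx. Qed.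

Lemma preserving_expi (t : R) : preserving (fun p : measurableTypeR R * measurableTypeR R =>
   ((cos t * p.1 - sin t * p.2)%R : measurableTypeR R, (sin t * p.1 + cos t * p.2)%R : measurableTypeR R)).
Proof. by apply: preserving_rot; exact: cos2Dsin2. Qed.

Lemma cintegral_rot (F : R[i]^o -> R[i]^o) (t : R) : cmeas F ->
  cintegral (fun z => F (expi t * z)) = cintegral F.
Proof.
move=> [f1 f2]; rewrite /cintegral.
have := Rintegral_preserving (preserving_expi t) f1.
have := Rintegral_preserving (preserving_expi t) f2.
under eq_fun do rewrite tc_rot.
move=> ->; under eq_fun do rewrite tc_rot.
by move=> ->.
Qed.

Lemma cintegral_anti (F : R[i]^o -> R[i]^o) (t : R) : cmeas F -> cinteg F ->
  (forall z, F (expi t * z) = - F z) -> cintegral F = 0.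
Proof.
move=> mF iF H; have := cintegral_rot t mF.
under eq_fun do rewrite H -mulN1r.
rewrite cintegralZ// mulN1r => /eqP; rewrite eq_sym -subr_eq0 opprK -mulr2n.
by rewrite mulrn_eq0/= => /eqP.
Qed.

End ComplexIntegral.

(** * Parseval's identity for radial weights *)

Section RadialParseval.
Context {R : realType}.
Local Notation nc := (@Normc.normc R).
Local Notation tc := (@to_complex R).
Variable W : R[i] -> R.
Hypothesis (mW : mfun (fun p => W (tc p))) (W0 : forall z, 0 <= W z)
  (W_rot : forall t z, W (expi t * z) = W z)
  (W_moments : forall k, integ (fun p => nc (tc p) ^+ k * W (tc p))).

Lemma radial_cmeas (m n : nat) : cmeas (fun z => z ^+ m * (z ^+ n)^* * (W z)%:C).
Proof.
apply: cmeasM; last exact: cmeas_real.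
apply: cmeasM; first by apply: cmeasX; exact: cmeas_id.
by apply: cmeas_conj; apply: cmeasX; exact: cmeas_id.
Qed.

Lemma radial_cinteg (m n : nat) : cinteg (fun z => z ^+ m * (z ^+ n)^* * (W z)%:C).
Proof.
apply: cinteg_le (W_moments (m + n)); first exact: radial_cmeas.
move=> p; rewrite !Normc.normcM normc_conj !normcX normc_real ger0_norm// exprD//.
Qed.

(** Rotation by pi / (b - a) preserves [W] and multiplies z^b conj(z)^a by exp(i pi) = -1, so the
    integral equals its own opposite. No polar coordinates are involved. *)
Lemma radial_orthogonal (m n : nat) : m != n ->
  cintegral (fun z : R[i]^o => z ^+ m * (z ^+ n)^* * (W z)%:C : R[i]^o) = 0.
Proof.
have main (a b : nat) : (a < b)%N -> cintegral (fun z : R[i]^o => z ^+ b * (z ^+ a)^* * (W z)%:C : R[i]^o) = 0.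
  move=> ab; apply: (cintegral_anti (t := pi / (b - a)%:R)) => [||z].
  - exact: radial_cmeas.
  - exact: radial_cinteg.
  rewrite W_rot !exprMn rmorphM/=.
  set e := expi _; have ee : e ^+ b * (e ^+ a)^* = -1.
    have -> : b = ((b - a) + a)%N by rewrite subnK// ltnW.
    rewrite exprD -mulrA.
    have -> : e ^+ a * (e ^+ a)^* = 1.
      by rewrite -sqr_normc normC_normc normcX normc_expi expr1n rmorph1 expr1n.
    rewrite mulr1 -expiMn mulrC divfK; last by rewrite pnatr_eq0 -lt0n subn_gt0.
    by rewrite /expi cospi sinpi; apply/eqP; rewrite eq_complex/= oppr0 !eqxx.
  by rewrite mulrACA ee mulN1r mulNr.
rewrite neq_ltn => /orP[mn|nm]; last exact: main.
have := main _ _ mn => H.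
have -> : (fun z : R[i]^o => z ^+ m * (z ^+ n)^* * (W z)%:C : R[i]^o) =
   (fun z => (z ^+ n * (z ^+ m)^* * (W z)%:C)^*).
  apply/funext => z; move: (z ^+ m) (z ^+ n) (W z) => [x1 x2] [y1 y2] r.
  by apply/eqP; rewrite eq_complex /=; apply/andP; split; apply/eqP; ring.
by rewrite cintegral_conj ?H ?conjc0//; exact: radial_cinteg.
Qed.

(** [W] is kept general for three uses: the Gaussian for Fock norms, the Gaussian cut off to a disc
    for Bessel's inequality, and the indicator of a disc for lower bounds of masses. *)
Lemma radial_parseval (a : nat -> R[i]) M :
  integ (fun p => nc (\sum_(k < M) a k * tc p ^+ k) ^+ 2 * W (tc p)) /\
  plane_int (fun p => nc (\sum_(k < M) a k * tc p ^+ k) ^+ 2 * W (tc p)) =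
    \sum_(k < M) nc (a k) ^+ 2 * plane_int (fun p => nc (tc p) ^+ (2 * k) * W (tc p)).
Proof.
elim: M => [|M [ih1 ih2]].
  under eq_fun do rewrite big_ord0 Normc.normc0 expr0n mul0r.
  by rewrite big_ord0 plane_int0; split => //; exact: integ0.
pose S z := \sum_(k < M) a k * z ^+ k.
pose X z : R[i]^o := \sum_(k < M) (a k * (a M)^*) * (z ^+ k * (z ^+ M)^* * (W z)%:C).
have [iX X0] : cinteg X /\ cintegral X = 0.
  pose Xm m (z : R[i]^o) : R[i]^o := \sum_(k < m) (a k * (a M)^*) * (z ^+ k * (z ^+ M)^* * (W z)%:C).
  suff H m : (m <= M)%N -> cinteg (Xm m) /\ cintegral (Xm m) = 0 by exact: (H M (leqnn M)).
  rewrite /Xm; elim: m => [_|m IH mM].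
    under eq_fun do rewrite big_ord0; split; last exact: cintegral0.
    by split; exact: integ0.
  have [IH1 IH2] := IH (ltnW mM).
  under eq_fun do rewrite big_ord_recr/=.
  have ic := cintegZ (a m * (a M)^*) (radial_cinteg m M).
  split; first exact: cintegD.
  rewrite cintegralD// IH2 add0r cintegralZ; last exact: radial_cinteg.
  by rewrite radial_orthogonal ?mulr0// ltn_eqF.
have E : (fun p => nc (\sum_(k < M.+1) a k * tc p ^+ k) ^+ 2 * W (tc p)) =
   (fun p => (nc (\sum_(k < M) a k * tc p ^+ k) ^+ 2 * W (tc p) + nc (a M) ^+ 2 * (nc (tc p) ^+ (2 * M) * W (tc p)))
      + 2 * complex.Re (X (tc p))).
  apply/funext => p; rewrite big_ord_recr/=.
  have nD (x y : R[i]) : nc (x + y) ^+ 2 = nc x ^+ 2 + nc y ^+ 2 + 2 * complex.Re (x * y^*).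
    by rewrite !normc_sqr; case: x y => ? ? [] ? ? /=; ring.
  rewrite nD Normc.normcM exprMn normcX -exprM mulnC.
  have -> : X (tc p) = (S (tc p) * (a M * tc p ^+ M)^*) * (W (tc p))%:C.
    rewrite /X /S mulr_suml mulr_suml; apply: eq_bigr => k _.
    by rewrite rmorphM /=; ring.
  have -> : complex.Re (S (tc p) * (a M * tc p ^+ M)^* * (W (tc p))%:C) =
     complex.Re (S (tc p) * (a M * tc p ^+ M)^*) * W (tc p).
    by case: (S _ * _) => ? ? /=; ring.
  by rewrite -/(S (tc p)); ring.
rewrite E big_ord_recr/= -ih2.
have i2 := W_moments (2 * M).
have i3 := integZ (nc (a M) ^+ 2) i2.
have [iX1 iX2] := iX.
have i4 := integZ 2 iX1.
split; first by apply: integD => //; exact: integD.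
rewrite plane_intD//; last exact: integD.
rewrite plane_intD// plane_intZ// plane_intZ//.
have -> : plane_int (fun p => complex.Re (X (tc p))) = complex.Re (cintegral X) by [].
by rewrite X0 /= mulr0 addr0.
Qed.

End RadialParseval.

(** * Gaussian moments *)

Lemma fact_le_expn n : (n`! <= n ^ n)%N.
Proof.
elim: n => [|n ih]//; rewrite factS expnS leq_mul// (leq_trans ih)//.
by case: n {ih} => // n; rewrite leq_exp2r.
Qed.

Section GaussianMoments.
Context {R : realType}.
Local Notation nc := (@Normc.normc R).
Local Notation tc := (@to_complex R).
Local Notation mR := (measurableTypeR R).
Local Notation mu := (planar_lebesgue R).
Local Notation gw := (@gauss_weight R).

Lemma normc_tc (p : R * R) : nc (tc p) ^+ 2 = p.1 ^+ 2 + p.2 ^+ 2.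
Proof. by rewrite normc_sqr. Qed.

Lemma mfun_normc : mfun (fun p : R * R => nc (tc p)).
Proof.
have m2 : mfun (fun p : R * R => nc (tc p) ^+ 2) by apply: (mfun_normc2 (f := id)); exact: cmeas_id.
have -> : (fun p : R * R => nc (tc p)) = (fun p : R * R => Num.sqrt (nc (tc p) ^+ 2)).
  by apply/funext => p; rewrite sqrtr_sqr ger0_norm// normc_ge0.
apply: measurableT_comp m2; apply: continuous_measurable_fun; exact: sqrt_continuous.
Qed.

Lemma mfun_gauss : mfun (fun p => gw (tc p)).
Proof. by apply: mfun_expR; apply: mfunN; apply: mfunX; exact: mfun_normc. Qed.

Lemma gauss_gt0 z : 0 < gw z.
Proof. exact: expR_gt0. Qed.

Lemma gauss_le1 z : gw z <= 1.
Proof. by rewrite -expR0 ler_expR oppr_le0 exprn_ge0// normc_ge0. Qed.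

Lemma gauss_rot (t : R) z : gw (expi t * z) = gw z.
Proof. by rewrite /gauss_weight Normc.normcM normc_expi mul1r. Qed.

(** The integrand is a constant multiple of the standard normal density, whose total mass is 1. *)
Lemma lebesgue_half_gauss :
  (\int[@lebesgue_measure R]_x (expR (- (x ^+ 2 / 2)))%:E < +oo)%E.
Proof.
have := integral_normal_pdf (0 : R) 1; rewrite normal_pdfE ?oner_eq0//.
have E : (fun x : mR => (normal_peak 1 * normal_fun 0 1 x)%:E) =
   (fun x : mR => (normal_peak 1)%:E * (expR (- (x ^+ 2 / 2)))%:E)%E.
  by apply/funext => x; rewrite -EFinM /normal_fun subr0 expr1n mulNr.
have pk : (0 : R) < normal_peak 1 by apply: normal_peak_gt0; rewrite oner_eq0.
rewrite E ge0_integralZl_EFin//; last 2 first.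
- apply/measurable_EFinP; apply: measurableT_comp; first exact: measurable_expR.
  apply: measurable_funN; apply: measurable_funM; last exact: measurable_cst.
  exact: measurable_funX.
- exact: ltW.
case: (\int[_]_x _)%E => [r _|/eqP|/eqP]; first exact: ltry.
  by rewrite mulry gtr0_sg// mul1e.
by rewrite mulrNy gtr0_sg// mul1e.
Qed.

Lemma integ_half_gauss : integ (fun p : R * R => expR (- (nc (tc p) ^+ 2 / 2))).
Proof.
have mh : measurable_fun setT (fun x : mR => (expR (- (x ^+ 2 / 2)))%:E).
  apply/measurable_EFinP; apply: measurableT_comp; first exact: measurable_expR.
  apply: measurable_funN; apply: measurable_funM; last exact: measurable_cst.
  exact: measurable_funX.
have mF : mfun (fun p : R * R => expR (- (nc (tc p) ^+ 2 / 2))).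
  apply: mfun_expR; apply: mfunN; apply: mfunM; last exact: mfun_cst.
  by apply: mfunX; exact: mfun_normc.
apply: integ_EFin => //.
have h0 x : (0 <= (expR (- (x ^+ 2 / 2)) : R)%:E)%E by rewrite lee_fin expR_ge0.
have mF' : measurable_fun setT (fun p : mR * mR => (expR (- (nc (tc p) ^+ 2 / 2)))%:E) by exact/measurable_EFinP.
rewrite /planar_lebesgue (@fubini_tonelli1 _ _ _ _ _ (@lebesgue_measure R) (@lebesgue_measure R) _ mF') //.
have l := lebesgue_half_gauss.
have l0 : (0 <= \int[@lebesgue_measure R]_x (expR (- (x ^+ 2 / 2)))%:E)%E by exact: integral_ge0.
have cfin : (\int[@lebesgue_measure R]_x (expR (- (x ^+ 2 / 2)))%:E)%E \is a fin_num by rewrite ge0_fin_numE.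
rewrite (eq_integral (fun x : mR => ((fine (\int[@lebesgue_measure R]_x (expR (- (x ^+ 2 / 2)))%:E)%E))%:E * (expR (- (x ^+ 2 / 2)))%:E)%E).
  rewrite ge0_integralZl_EFin//; last by rewrite fine_ge0.
  by rewrite lte_mul_pinfty// ?lee_fin ?fine_ge0.
move=> x _; rewrite /fubini_F fineK//.
rewrite (eq_integral (fun y : mR => ((expR (- (x ^+ 2 / 2)))%:E * (expR (- (y ^+ 2 / 2)))%:E)%E)).
  by rewrite ge0_integralZl_EFin ?expR_ge0// muleC.
by move=> y _; rewrite -EFinM -expRD normc_tc/=; congr (expR _)%:E; ring.
Qed.

Lemma pow_le_expR (x : R) (k : nat) : 0 <= x -> x ^+ k <= k`!%:R * expR x.
Proof.
case: k => [x0|k x0]; first by rewrite expr0 fact0 mul1r -expR0 ler_expR.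
have := expR_ge1Dxn k x0 => H.
rewrite mulrC -ler_pdivrMr ?ltr0n ?fact_gt0// (le_trans _ H)//.
by rewrite lerDr.
Qed.

(** Half of the exponent absorbs the power: (t / 2)^k <= k! e^(t/2) with t = |z|^2. *)
Lemma gauss_moment_bound (k : nat) p :
  nc (tc p) ^+ (2 * k) * gw (tc p) <= (2 ^+ k * k`!%:R) * expR (- (nc (tc p) ^+ 2 / 2)).
Proof.
set t := nc (tc p) ^+ 2.
have t0 : 0 <= t / 2 by rewrite divr_ge0// exprn_ge0// normc_ge0.
have := pow_le_expR k t0.
have -> : gw (tc p) = expR (- (t / 2)) * expR (- (t / 2)).
  by rewrite /gauss_weight -/t -expRD; congr expR; field.
rewrite exprM -/t mulrA ler_pM2r ?expR_gt0// expRN ler_pdivrMr ?expR_gt0//.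
rewrite expr_div_n ler_pdivrMr ?exprn_gt0// => H.
by rewrite (le_trans H)// mulrC mulrA.
Qed.

Lemma integ_gauss_moment (k : nat) : integ (fun p => nc (tc p) ^+ k * gw (tc p)).
Proof.
have me j : integ (fun p => nc (tc p) ^+ (2 * j) * gw (tc p)).
  apply: integ_le (integZ (2 ^+ j * j`!%:R) integ_half_gauss).
    by apply: mfunM; [apply: mfunX; exact: mfun_normc|exact: mfun_gauss].
  move=> p; rewrite ger0_norm; first exact: gauss_moment_bound.
  by rewrite mulr_ge0 ?exprn_ge0 ?normc_ge0// ltW// gauss_gt0.
apply: integ_le (integD (me 0%N) (me k)).
  by apply: mfunM; [apply: mfunX; exact: mfun_normc|exact: mfun_gauss].
move=> p; rewrite ger0_norm; last first.
  by rewrite mulr_ge0 ?exprn_ge0 ?normc_ge0// ltW// gauss_gt0.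
rewrite -mulrDl ler_pM2r ?gauss_gt0// muln0 expr0.
have n0 := normc_ge0 (tc p).
have [h|h] := leP (nc (tc p)) 1.
  by rewrite (@le_trans _ _ 1)// ?exprn_ile1// lerDl exprn_ge0.
rewrite (@le_trans _ _ (nc (tc p) ^+ (2 * k)))//; last by rewrite lerDr.
by rewrite ler_weXn2l ?(ltW h)// mul2n -addnn leq_addr.
Qed.

(** The squared norm of z^k, whose exact value is pi k!. Bounds by k! up to a factor C^k suffice,
    and these are all that is established. *)
Definition gauss_moment (k : nat) : R := plane_int (fun p => nc (tc p) ^+ (2 * k) * gw (tc p)).

Lemma gauss_moment_le k : gauss_moment k <= 2 ^+ k * k`!%:R * plane_int (fun p : R * R => expR (- (nc (tc p) ^+ 2 / 2))).
Proof.
rewrite -plane_intZ; last exact: integ_half_gauss.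
apply: plane_int_le; [exact: integ_gauss_moment|exact: integZ integ_half_gauss|exact: gauss_moment_bound].
Qed.

Definition square (a b : R) : set (mR * mR) := `[a, b]%classic `*` `[a, b]%classic.

Lemma measurable_square (a b : R) : measurable (square a b).
Proof. by apply: measurableX. Qed.

Lemma square_integral (a b : R) : a <= b -> integ (\1_(square a b)) /\ plane_int (\1_(square a b)) = (b - a) ^+ 2.
Proof.
move=> ab.
have E : (mu (square a b) = ((b - a) ^+ 2)%:E)%E.
  transitivity (lebesgue_measure (`[a, b]%classic : set mR) * lebesgue_measure (`[a, b]%classic : set mR))%E.
    exact: product_measure1E.
  rewrite lebesgue_measure_itv/= lte_fin.
  move: ab; rewrite le_eqVlt => /predU1P[->|ab1]; first by rewrite ltxx mul0e subrr expr0n.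
  by rewrite ab1 -EFinB -EFinM expr2.
have H : (\int[mu]_p (\1_(square a b) p)%:E = ((b - a) ^+ 2)%:E)%E.
  by rewrite integral_indic//= ?setIT//; exact: measurable_square.
split; last by rewrite /plane_int /Rintegral H.
apply: integ_EFin; first by apply: mfun_indic; exact: measurable_square.
  by move=> p; rewrite indicE ler0n.
by rewrite H ltry.
Qed.

Lemma squareP (a b : R) (p : R * R) : square a b p -> a <= p.1 <= b /\ a <= p.2 <= b.
Proof. by case; rewrite /= !in_itv/=. Qed.

(** Integrate only over the unit square with lower left corner (a, a), where 2 a^2 = k. There |z|^2
    lies between k and 2k + 4, so the power is at least k^k >= k! and the weight at least
    e^(-2k-4). *)
Lemma gauss_moment_ge k : k`!%:R * expR (- (2 * k%:R + 4)) <= gauss_moment k.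
Proof.
pose a : R := Num.sqrt (k%:R / 2).
have a0 : 0 <= a by exact: sqrtr_ge0.
have a2 : a ^+ 2 = k%:R / 2 by rewrite sqr_sqrtr// divr_ge0.
have aa1 : a <= a + 1 by rewrite lerDl.
have [iS IS] := square_integral aa1.
rewrite [leLHS](_ : _ = plane_int (fun p => (k`!%:R * expR (- (2 * k%:R + 4))) * \1_(square a (a + 1)) p)); last first.
  by rewrite plane_intZ// IS addrAC subrr add0r expr1n mulr1.
apply: plane_int_le; [exact: integZ|exact: integ_gauss_moment|] => p.
have g0 : 0 <= nc (tc p) ^+ (2 * k) * gw (tc p).
  by rewrite mulr_ge0 ?exprn_ge0 ?normc_ge0// ltW// gauss_gt0.
rewrite indicE; case: (boolP (p \in _)) => [/set_mem/squareP[/andP[x1 x2] /andP[y1 y2]]|_]; last by rewrite /= mulr0.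
rewrite /= mulr1.
have h1 : k%:R <= nc (tc p) ^+ 2.
  have : a ^+ 2 <= p.1 ^+ 2 by rewrite ler_pXn2r ?nnegrE// (le_trans a0).
  have : a ^+ 2 <= p.2 ^+ 2 by rewrite ler_pXn2r ?nnegrE// (le_trans a0).
  by rewrite normc_tc a2; lra.
have h2 : nc (tc p) ^+ 2 <= 2 * k%:R + 4.
  have : p.1 ^+ 2 <= (a + 1) ^+ 2 by rewrite ler_pXn2r ?nnegrE ?addr_ge0// (le_trans a0).
  have : p.2 ^+ 2 <= (a + 1) ^+ 2 by rewrite ler_pXn2r ?nnegrE ?addr_ge0// (le_trans a0).
  have : 0 <= (a - 1) ^+ 2 by exact: sqr_ge0.
  by rewrite normc_tc sqrrB sqrrD a2; lra.
rewrite ler_pM ?expR_ge0//; last by rewrite ler_expR lerN2.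
rewrite exprM (@le_trans _ _ (k%:R ^+ k))//; last by rewrite lerXn2r ?nnegrE// exprn_ge0// normc_ge0.
by rewrite -natrX ler_nat fact_le_expn.
Qed.

Lemma gauss_moment_gt0 k : 0 < gauss_moment k.
Proof. by rewrite (lt_le_trans _ (gauss_moment_ge k))// mulr_gt0 ?expR_gt0// ltr0n fact_gt0. Qed.

Lemma measurable_disc (r : R) : measurable [set p : mR * mR | nc (tc p) <= r].
Proof.
rewrite (_ : [set p | _] = setT `&` ((fun p : mR * mR => (nc (tc p) : mR)) @^-1` `]-oo, r]%classic)).
  by apply: mfun_normc.
by apply/seteqP; split => p /=; rewrite in_itv/= => // -[].
Qed.

Definition disc_weight (r : R) (z : R[i]) : R := \1_[set z : R[i] | nc z <= r] z.

Lemma disc_weightE (r : R) z : disc_weight r z = (nc z <= r)%R%:R.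
Proof. by rewrite /disc_weight indicE; congr (nat_of_bool _)%:R; apply/idP/idP => [/set_mem//|/mem_set]. Qed.

Lemma mfun_disc (r : R) : mfun (fun p => disc_weight r (tc p)).
Proof.
rewrite (_ : (fun p => _) = \1_[set p : mR * mR | nc (tc p) <= r]); first exact: mfun_indic (measurable_disc r).
by apply/funext => p; rewrite disc_weightE indicE; congr (nat_of_bool _)%:R; apply/idP/idP => [/mem_set|/set_mem].
Qed.

Lemma disc_weight_ge0 r z : 0 <= disc_weight r z.
Proof. by rewrite disc_weightE ler0n. Qed.

Lemma disc_weight_le1 r z : disc_weight r z <= 1.
Proof. by rewrite disc_weightE lern1 leq_b1. Qed.

Lemma disc_weight_rot r (t : R) z : disc_weight r (expi t * z) = disc_weight r z.
Proof. by rewrite !disc_weightE Normc.normcM normc_expi mul1r. Qed.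

Lemma disc_le_gauss r z : disc_weight r z <= expR (r ^+ 2) * gw z.
Proof.
rewrite disc_weightE; case: (boolP (nc z <= r)) => /= [h|_]; last by rewrite mulr_ge0 ?expR_ge0.
rewrite /gauss_weight -expRD -expR0 ler_expR subr_ge0.
by apply: lerXn2r => //; rewrite nnegrE ?normc_ge0// (le_trans _ h)// normc_ge0.
Qed.

Lemma integ_disc r : integ (fun p => disc_weight r (tc p)).
Proof.
have := integZ (expR (r ^+ 2)) (integ_gauss_moment 0); apply: integ_le; first exact: mfun_disc.
by move=> p; rewrite ger0_norm ?disc_weight_ge0// expr0 mul1r disc_le_gauss.
Qed.

(** The square [r/4, r/2]^2 has area r^2 / 16, lies in the disc, and satisfies |z|^2 >= r^2 / 8. *)
Lemma disc_moment_ge (r : R) (k : nat) : 0 < r ->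
  (r ^+ 2 / 8) ^+ k * (r ^+ 2 / 16) <= plane_int (fun p => nc (tc p) ^+ (2 * k) * disc_weight r (tc p)).
Proof.
move=> r0.
have r4 : r / 4 <= r / 2 by move: r0; lra.
have [iS IS] := square_integral r4.
rewrite [leLHS](_ : _ = plane_int (fun p => (r ^+ 2 / 8) ^+ k * \1_(square (r / 4) (r / 2)) p)); last first.
  by rewrite plane_intZ// IS; congr (_ * _); field.
apply: plane_int_le; [exact: integZ| |] => [|p].
  apply: integ_le (integZ (expR (r ^+ 2)) (integ_gauss_moment (2 * k))).
    by apply: mfunM; [apply: mfunX; exact: mfun_normc|exact: mfun_disc].
  move=> p; rewrite ger0_norm; last by rewrite mulr_ge0 ?exprn_ge0 ?normc_ge0// disc_weight_ge0.
  by rewrite mulrCA ler_wpM2l ?exprn_ge0 ?normc_ge0// disc_le_gauss.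
have g0 : 0 <= nc (tc p) ^+ (2 * k) * disc_weight r (tc p).
  by rewrite mulr_ge0 ?exprn_ge0 ?normc_ge0// disc_weight_ge0.
rewrite indicE; case: (boolP (p \in _)) => [/set_mem/squareP[/andP[x1 x2] /andP[y1 y2]]|_]; last by rewrite /= mulr0.
rewrite /= mulr1.
have h1 : r ^+ 2 / 8 <= nc (tc p) ^+ 2 by rewrite normc_tc; nra.
have h2 : nc (tc p) ^+ 2 <= r ^+ 2 by rewrite normc_tc; nra.
have -> : disc_weight r (tc p) = 1.
  by rewrite disc_weightE -(@ler_pXn2r _ 2) ?nnegrE ?normc_ge0 ?(ltW r0)// h2.
rewrite mulr1 exprM; apply: lerXn2r => //; rewrite nnegrE ?exprn_ge0 ?normc_ge0//.
by rewrite divr_ge0// exprn_ge0// ltW.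
Qed.

End GaussianMoments.

(** * Power series *)

Section PowerSeries.
Context {R : realType}.
Local Notation nc := (@Normc.normc R).

Lemma geo_complete (u : nat -> R[i]) (D : R) :
  (forall M, nc (u M.+1 - u M) <= D / 2 ^+ M) ->
  exists l, forall M, nc (l - u M) <= 4 * D / 2 ^+ M.
Proof.
move=> H.
have real (v : nat -> R) : (forall M, `|v M.+1 - v M| <= D / 2 ^+ M) ->
    exists x, forall M, `|x - v M| <= 2 * D / 2 ^+ M.
  move=> Hv; have D0 : 0 <= D by have := Hv 0%N; rewrite expr0 divr1; apply: le_trans.
  have P M : 2 * D / 2 ^+ M = 2 * D / 2 ^+ M.+1 + D / 2 ^+ M.
    by rewrite exprS; field; rewrite expf_neq0.
  (* The interval of radius 2 D / 2^M about [v M] contains the next one, since the increment is at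
     most half of this radius. *)
  have [||| x xP] := @nested_point R (fun M => v M - 2 * D / 2 ^+ M) (fun M => v M + 2 * D / 2 ^+ M).
  - by move=> M; have := Hv M; rewrite ler_norml (P M); lra.
  - by move=> M; have := Hv M; rewrite ler_norml (P M); lra.
  - move=> M; have : 0 <= 2 * D / 2 ^+ M by rewrite divr_ge0 ?mulr_ge0// exprn_ge0.
    by lra.
  by exists x => M; have := xP M; rewrite ler_norml; lra.
have [|x xP] := real (fun M => complex.Re (u M)).
  by move=> M; rewrite (le_trans _ (H M))// -raddfB normc_Re.
have [|y yP] := real (fun M => complex.Im (u M)).
  by move=> M; rewrite (le_trans _ (H M))// -raddfB normc_Im.
exists (x +i* y) => M; rewrite (le_trans (normc_le_ReIm _))//.
have -> : 4 * D / 2 ^+ M = 2 * D / 2 ^+ M + 2 * D / 2 ^+ M by rewrite -mulrDl -mulrDl; congr (_ * D / _); ring.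
by rewrite lerD//; [have := xP M|have := yP M]; case: (u M).
Qed.

Lemma power_series_sum (a : nat -> R[i]) :
  (forall A, 0 <= A -> exists D, forall k, nc (a k) * A ^+ k <= D / 2 ^+ k) ->
  exists f : R[i] -> R[i], (forall A D, 0 <= A ->
    (forall k, nc (a k) * A ^+ k <= D / 2 ^+ k) -> forall z, nc z <= A -> forall M,
    nc (f z - \sum_(k < M) a k * z ^+ k) <= 4 * D / 2 ^+ M).
Proof.
move=> aD.
have lim z A D : 0 <= A -> (forall k, nc (a k) * A ^+ k <= D / 2 ^+ k) -> nc z <= A ->
    exists l, forall M, nc (l - \sum_(k < M) a k * z ^+ k) <= 4 * D / 2 ^+ M.
  move=> A0 HD zA; apply: geo_complete => M.
  rewrite big_ord_recr/= addrAC subrr add0r Normc.normcM normcX (le_trans _ (HD M))//.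
  by rewrite ler_wpM2l ?normc_ge0// lerXn2r ?nnegrE ?normc_ge0.
have ex z : exists l, exists D, forall M, nc (l - \sum_(k < M) a k * z ^+ k) <= D / 2 ^+ M.
  have [D HD] := aD _ (normc_ge0 z).
  by have [l Hl] := lim z _ _ (normc_ge0 z) HD (lexx _); exists l, (4 * D).
(* The value at [z] is chosen from a bound on the circle through [z] only. Being a limit it is
   unique, hence it also obeys the estimate of any larger disc. *)
pose f z := sval (cid (ex z)).
exists f => A D A0 HD z zA M.
have [l Hl] := lim z A D A0 HD zA.
suff -> : f z = l by exact: Hl.
have [D' Hf] := svalP (cid (ex z)).
apply/eqP; rewrite -subr_eq0 -normc_eq0 eq_le normc_ge0 andbT.
apply: (@geo_small _ _ (D' + 4 * D)) => N.
rewrite (le_trans (normc_trans _ _ (\sum_(k < N) a k * z ^+ k)))// mulrDl lerD//.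
by rewrite normcB; exact: Hl.
Qed.

Lemma pow_second_order (z h : R[i]) (A : R) (k : nat) : 1 <= A -> nc z <= A -> nc (z + h) <= A ->
  nc ((z + h) ^+ k - z ^+ k - k%:R * z ^+ k.-1 * h) <= nc h ^+ 2 * (k%:R ^+ 2 * A ^+ k).
Proof.
move=> A1 zA zhA.
have A0 : 0 <= A by exact: le_trans A1.
have nk n : nc n%:R = (n%:R : R) by rewrite -[n%:R : R[i]](rmorph_nat (real_complex R)) normc_real ger0_norm.
elim: k => [|k ih].
  by rewrite !expr0 subrr mul0r mul0r subr0 Normc.normc0 expr0n mul0r mulr0.
have -> : (z + h) ^+ k.+1 - z ^+ k.+1 - k.+1%:R * z ^+ k.+1.-1 * h =
   (z + h) * ((z + h) ^+ k - z ^+ k - k%:R * z ^+ k.-1 * h) + h ^+ 2 * (k%:R * z ^+ k.-1).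
  case: k {ih} => [|k]; first by rewrite /=; ring.
  by rewrite /= !exprS -[k.+2%:R]natr1; ring.
rewrite (le_trans (le_normcD _ _))// !Normc.normcM !normcX nk.
rewrite (@le_trans _ _ (A * (nc h ^+ 2 * (k%:R ^+ 2 * A ^+ k)) + nc h ^+ 2 * (k%:R * A ^+ k)))//.
  apply: lerD.
    by apply: ler_pM => //; exact: normc_ge0.
  rewrite -expr2 ler_wpM2l ?exprn_ge0 ?normc_ge0// ler_wpM2l//.
  rewrite (@le_trans _ _ (A ^+ k.-1))// ?lerXn2r ?nnegrE ?normc_ge0//.
  by apply: ler_weXn2l => //; exact: leq_pred.
have -> : A * (nc h ^+ 2 * (k%:R ^+ 2 * A ^+ k)) + nc h ^+ 2 * (k%:R * A ^+ k) =
  nc h ^+ 2 * (k%:R ^+ 2 * A ^+ k.+1 + k%:R * A ^+ k) by rewrite (exprS A); ring.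
rewrite ler_wpM2l ?exprn_ge0 ?normc_ge0//.
have -> : k.+1%:R ^+ 2 * A ^+ k.+1 = k%:R ^+ 2 * A ^+ k.+1 + (2 * k%:R + 1) * A ^+ k.+1.
  by rewrite -natr1; ring.
rewrite lerD2l ler_pM// ?exprn_ge0//; last by apply: ler_weXn2l.
by rewrite (@le_trans _ _ (2 * k%:R))// ?lerDl// ler_peMl// ler1n.
Qed.

Lemma expands_coef (f : R[i] -> R[i]) a : expands f a ->
  forall A, 0 <= A -> exists D, forall k, nc (a k) * A ^+ k <= D / 2 ^+ k.
Proof.
move=> fa A A0; have [D HD] := fa A; exists (2 * D) => k.
exact: expansion_coef_bound A0 HD k.
Qed.

Lemma sqr_le_pow2 (k : nat) : (k ^ 2 <= 2 * 2 ^ k)%N.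
Proof.
case: k => [|[|[|k]]]//; elim: k => [//|k ih].
have h : (2 * k.+3 + 1 <= k.+3 * k.+3)%N by nia.
move: ih; rewrite -!mulnn (expnS 2 k.+3); move: (2 ^ k.+3)%N => x ih; nia.
Qed.

(** Termwise differentiation: the second-order remainders of the monomials sum to at most 4 D |h|^2,
    whatever the truncation. *)
Lemma expands_entire (f : R[i]^o -> R[i]^o) a : expands f a -> entire f.
Proof.
move=> fa z; apply/derivable_normcP.
pose A := nc z + 1.
have A1 : 1 <= A by rewrite lerDr normc_ge0.
have A0 : 0 <= A by exact: le_trans A1.
(* Decay is taken at radius 4A so that the factor 4^k absorbs the k^2 of [pow_second_order], leaving
   2^-k for summation. *)
have [D HD] := expands_coef fa (mulr_ge0 (ler0n R 4) A0).
have D0 : 0 <= D by have := HD 0%N; rewrite !expr0 mulr1 divr1; apply: le_trans; exact: normc_ge0.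
have nk n : nc n%:R = (n%:R : R) by rewrite -[n%:R : R[i]](rmorph_nat (real_complex R)) normc_real ger0_norm.
have cb k : nc (a k) * (k%:R ^+ 2 * A ^+ k) <= 2 * D / 2 ^+ k.
  have := HD k; rewrite exprMn => H.
  have k2 : (k%:R : R) ^+ 2 <= 2 * 2 ^+ k by rewrite -!natrX -natrM ler_nat sqr_le_pow2.
  have p2 : 0 < (2 : R) ^+ k by rewrite exprn_gt0.
  have -> : nc (a k) * (k%:R ^+ 2 * A ^+ k) = (k%:R ^+ 2 / 2 ^+ k / 2 ^+ k) * (nc (a k) * (4 ^+ k * A ^+ k)).
    have -> : (4 : R) ^+ k = 2 ^+ k * 2 ^+ k by rewrite -exprMn; congr (_ ^+ _); ring.
    by field; rewrite gt_eqF.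
  have h1 : k%:R ^+ 2 / 2 ^+ k / 2 ^+ k <= (2 : R).
    rewrite ler_pdivrMr// ler_pdivrMr// (le_trans k2)// ler_peMr ?mulr_ge0 ?(ltW p2)//.
    by rewrite exprn_ege1// ler1n.
  rewrite (le_trans (ler_pM _ _ h1 H))// ?mulr_ge0 ?invr_ge0 ?exprn_ge0 ?normc_ge0 ?(ltW p2)//.
  by rewrite mulrA.
have [l Hl] : exists l, forall M, nc (l - \sum_(k < M) a k * (k%:R * z ^+ k.-1)) <= 4 * (2 * D) / 2 ^+ M.
  apply: geo_complete => M.
  rewrite big_ord_recr/= addrAC subrr add0r Normc.normcM Normc.normcM nk normcX.
  rewrite (le_trans _ (cb M))// ler_wpM2l ?normc_ge0//.
  case: M => [|M]; first by rewrite mul0r mulr_ge0// exprn_ge0.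
  apply: ler_pM; rewrite ?exprn_ge0 ?normc_ge0//.
    by rewrite expr2 ler_peMl// ler1n.
  rewrite (@le_trans _ _ (A ^+ M))//; last by apply: ler_weXn2l.
  by rewrite lerXn2r ?nnegrE ?normc_ge0// lerDl.
exists l => e e0.
have K0 : 0 < 4 * D + 1 by rewrite ltr_wpDl// mulr_ge0.
exists (Num.min 1 (e / (4 * D + 1))); first by rewrite lt_min ltr01 divr_gt0.
move=> h; rewrite lt_min => /andP[h1 he].
have zA : nc z <= A by rewrite lerDl.
have zhA : nc (z + h) <= A by rewrite (le_trans (le_normcD _ _))// lerD2l ltW.
suff main : nc (f (z + h) - f z - l * h) <= nc h ^+ 2 * (4 * D).
  rewrite (le_trans main)// expr2 mulrAC ler_wpM2r ?normc_ge0//.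
  rewrite (@le_trans _ _ (nc h * (4 * D + 1)))//; last by rewrite -ler_pdivlMr// ltW.
  by rewrite ler_wpM2l ?normc_ge0// lerDl.
have [Df Hf] := fa A.
rewrite -subr_le0.
apply: (@geo_small _ _ (2 * Df + 4 * (2 * D) * nc h)) => M.
pose p (x : R[i]) := \sum_(k < M) a k * x ^+ k.
pose p' := \sum_(k < M) a k * (k%:R * z ^+ k.-1).
have E : f (z + h) - f z - l * h = (f (z + h) - p (z + h)) - (f z - p z) - (l - p') * h
   + (p (z + h) - p z - p' * h) by ring.
have hp : nc (p (z + h) - p z - p' * h) <= nc h ^+ 2 * (4 * D).
  have -> : p (z + h) - p z - p' * h = \sum_(k < M) a k * ((z + h) ^+ k - z ^+ k - k%:R * z ^+ k.-1 * h).
    rewrite /p /p' mulr_suml -!sumrB; apply: eq_bigr => k _; ring.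
  rewrite (le_trans (normc_sum _ _ _))//.
  rewrite (@le_trans _ _ (\sum_(k < M) nc h ^+ 2 * (2 * D / 2 ^+ k)))//.
    apply: ler_sum => k _; rewrite Normc.normcM (le_trans (ler_wpM2l _ (pow_second_order k A1 zA zhA)))// ?normc_ge0//.
    by rewrite mulrCA ler_wpM2l ?exprn_ge0 ?normc_ge0.
  rewrite -mulr_sumr ler_wpM2l ?exprn_ge0 ?normc_ge0// -mulr_sumr.
  have -> : 4 * D = 2 * D * 2 by ring.
  rewrite ler_wpM2l ?mulr_ge0//.
  suff -> : \sum_(i < M) (2 : R) ^- i = 2 - 2 / 2 ^+ M by rewrite gerBl divr_ge0// exprn_ge0.
  elim: (M) => [|m ih]; first by rewrite big_ord0 expr0 divr1 subrr.
  by rewrite big_ord_recr/= ih exprS; field; rewrite expf_neq0.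
have h1' := Hf _ zhA M; have h2' := Hf _ zA M; have h3' := Hl M.
have : nc (f (z + h) - f z - l * h) <= nc (f (z + h) - p (z + h)) + nc (f z - p z) + nc (l - p') * nc h
   + nc (p (z + h) - p z - p' * h).
  rewrite E (le_trans (le_normcD _ _))// lerD2r (le_trans (le_normcD _ _))// normcN Normc.normcM lerD2r.
  by rewrite (le_trans (le_normcD _ _))// normcN.
have h4' := ler_wpM2r (normc_ge0 h) h3'.
have -> : (2 * Df + 4 * (2 * D) * nc h) / 2 ^+ M = Df / 2 ^+ M + Df / 2 ^+ M + 4 * (2 * D) / 2 ^+ M * nc h.
  by rewrite mulrDl mulr_natl mulr2n mulrDl mulrAC.
by move=> H; rewrite lerBlDr; exact: le_trans H (lerD (lerD (lerD h1' h2') h4') hp).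
Qed.

Lemma expandsZ (f : R[i] -> R[i]) (c : R[i]) (a : nat -> R[i]) : expands f a -> expands (fun z => c * f z) (fun k => c * a k).
Proof.
move=> fa A; have [D HD] := fa A; exists (nc c * D) => z zA M.
have -> : \sum_(k < M) c * a k * z ^+ k = c * \sum_(k < M) a k * z ^+ k.
  by rewrite mulr_sumr; apply: eq_bigr => k _; rewrite mulrA.
by rewrite -mulrBr Normc.normcM -mulrA ler_wpM2l ?normc_ge0// HD.
Qed.

Lemma expandsD (f g : R[i] -> R[i]) (a b : nat -> R[i]) : expands f a -> expands g b -> expands (fun z => f z + g z) (fun k => a k + b k).
Proof.
move=> fa gb A; have [D HD] := fa A; have [D' HD'] := gb A; exists (D + D') => z zA M.
have -> : \sum_(k < M) (a k + b k) * z ^+ k = \sum_(k < M) a k * z ^+ k + \sum_(k < M) b k * z ^+ k.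
  by rewrite -big_split; apply: eq_bigr => k _; rewrite mulrDl.
by rewrite opprD addrACA mulrDl (le_trans (le_normcD _ _))// lerD ?HD ?HD'.
Qed.

Lemma sum_trunc (a : nat -> R[i]) (z : R[i]) N M :
  \sum_(k < M) (if (k < N)%N then a k else 0) * z ^+ k = \sum_(k < minn M N) a k * z ^+ k.
Proof.
rewrite -(big_mkord xpredT (fun k => (if (k < N)%N then a k else 0) * z ^+ k)).
rewrite -(big_mkord xpredT (fun k => a k * z ^+ k)).
rewrite (big_cat_nat (n := minn M N))//= ?geq_minl// [X in _ + X]big_nat_cond [X in _ + X]big1 ?addr0.
  rewrite big_nat_cond [RHS]big_nat_cond; apply: eq_bigr => k /andP[/andP[_ ]].
  by rewrite leq_min => /andP[_ ->].
move=> k /andP[/andP[h1 h2] _]; rewrite ifF ?mul0r//; apply/negbTE; rewrite -leqNgt.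
by move: h1; rewrite geq_min => /orP[|//]; rewrite leqNgt h2.
Qed.

Lemma expands_poly (a : nat -> R[i]) N :
  expands (fun z => \sum_(k < N) a k * z ^+ k) (fun k => if (k < N)%N then a k else 0).
Proof.
move=> A.
exists (2 ^+ N * \sum_(k < N) nc (a k) * (`|A| ^+ k)) => z zA M.
rewrite sum_trunc; have [MN|NM] := leqP N M.
  rewrite subrr Normc.normc0 divr_ge0 ?exprn_ge0// mulr_ge0 ?exprn_ge0// sumr_ge0// => k _.
  by rewrite mulr_ge0 ?normc_ge0 ?exprn_ge0.
rewrite -(big_mkord xpredT (fun k => a k * z ^+ k)) (big_cat_nat (n := M) (leq0n M) (ltnW NM))/=.
rewrite big_mkord addrAC subrr add0r (le_trans (normc_sum _ _ _))//.
have S0 i : 0 <= nc (a i) * `|A| ^+ i by rewrite mulr_ge0 ?normc_ge0 ?exprn_ge0.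
rewrite (@le_trans _ _ (\sum_(k < N) nc (a k) * (`|A| ^+ k)))//; last first.
  rewrite mulrAC ler_peMl ?sumr_ge0// ler_pdivlMr ?exprn_gt0// mul1r.
  by apply: ler_weXn2l; [rewrite ler1n|exact: ltnW].
rewrite -(big_mkord xpredT (fun k => nc (a k) * (`|A| ^+ k))) (big_cat_nat (n := M) (leq0n M) (ltnW NM))/=.
rewrite ler_wpDl ?sumr_ge0//; apply: ler_sum => k _.
rewrite Normc.normcM normcX ler_wpM2l ?normc_ge0// lerXn2r ?nnegrE ?normc_ge0//.
by rewrite (le_trans zA)// ler_norm.
Qed.

End PowerSeries.

(** * The Fock space *)

Section FockHilbert.
Context {R : realType}.
Local Notation nc := (@Normc.normc R).
Local Notation tc := (@to_complex R).
Local Notation gw := (@gauss_weight R).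
Local Notation CF := (R[i]^o -> R[i]^o).

Definition fock_norm2 (f : CF) : R := plane_int (fun p => nc (f (tc p)) ^+ 2 * gw (tc p)).

Definition L2 (f : CF) := cmeas f /\ integ (fun p => nc (f (tc p)) ^+ 2 * gw (tc p)).

Lemma fock_norm2_ge0 f : 0 <= fock_norm2 f.
Proof. by apply: plane_int_ge0 => p; rewrite mulr_ge0 ?exprn_ge0 ?normc_ge0// ltW// gauss_gt0. Qed.

Lemma normc_sqr_le (x y : R[i]) : nc (x + y) ^+ 2 <= 2 * nc x ^+ 2 + 2 * nc y ^+ 2.
Proof.
have := le_normcD x y; have := normc_ge0 x; have := normc_ge0 y; have := normc_ge0 (x + y).
have := sqr_ge0 (nc x - nc y); nra.
Qed.

Lemma L2D f g : L2 f -> L2 g -> L2 (fun z => f z + g z).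
Proof.
move=> [mf fi] [mg gi]; split; first exact: cmeasD.
apply: integ_le (integD (integZ 2 fi) (integZ 2 gi)).
  by apply: mfunM; [exact: (mfun_normc2 (cmeasD mf mg))|exact: mfun_gauss].
move=> p; rewrite ger0_norm; last by rewrite mulr_ge0 ?exprn_ge0 ?normc_ge0// ltW// gauss_gt0.
have h := normc_sqr_le (f (tc p)) (g (tc p)); have w0 := gauss_gt0 (tc p).
rewrite (le_trans (ler_wpM2r (ltW w0) h))// le_eqVlt; apply/orP; left; apply/eqP; ring.
Qed.

Lemma L2Z c f : L2 f -> L2 (fun z => c * f z).
Proof.
move=> [mf fi]; split; first by apply: cmeasM => //; exact: cmeas_cst.
have := integZ (nc c ^+ 2) fi; congr integ; apply/funext => p.
by rewrite Normc.normcM exprMn mulrA.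
Qed.

Lemma L2B f g : L2 f -> L2 g -> L2 (fun z => f z - g z).
Proof.
move=> lf lg; rewrite (_ : (fun z => _) = (fun z => f z + (-1) * g z)); last first.
  by apply/funext => z; rewrite mulN1r.
by apply: L2D => //; exact: L2Z.
Qed.

Lemma L2_0 : L2 (fun=> 0).
Proof.
split; first exact: cmeas_cst.
by under eq_fun do rewrite Normc.normc0 expr0n mul0r; exact: integ0.
Qed.

Lemma L2_sum (F : nat -> CF) M : (forall k, (k < M)%N -> L2 (F k)) -> L2 (fun z => \sum_(k < M) F k z).
Proof.
elim: M => [_|M ih H].
  by under eq_fun do rewrite big_ord0; exact: L2_0.
under eq_fun do rewrite big_ord_recr/=; apply: L2D; last exact: H.
by apply: ih => k kM; apply: H; exact: ltnW.
Qed.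

Lemma L2_mul (V : R[i] -> R) B f : mfun (fun p => V (tc p)) -> (forall z, `|V z| <= B) ->
  L2 f -> L2 (fun z => (V z)%:C * f z).
Proof.
move=> mV VB [mf fi]; split; first by apply: cmeasM => //; exact: cmeas_real.
apply: integ_le (integZ (B ^+ 2) fi).
  by apply: mfunM; [exact: (mfun_normc2 (cmeasM (cmeas_real mV) mf))|exact: mfun_gauss].
move=> p; rewrite ger0_norm; last by rewrite mulr_ge0 ?exprn_ge0 ?normc_ge0// ltW// gauss_gt0.
rewrite mulrA ler_pM2r ?gauss_gt0// Normc.normcM exprMn normc_real ler_wpM2r ?exprn_ge0 ?normc_ge0//.
by rewrite lerXn2r ?nnegrE// (le_trans _ (VB (tc p))).
Qed.

Lemma dot_cmeas f g : cmeas f -> cmeas g -> cmeas (fun z => f z * (g z)^* * (gw z)%:C).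
Proof.
move=> mf mg; apply: cmeasM; last by apply: cmeas_real; exact: mfun_gauss.
by apply: cmeasM => //; exact: cmeas_conj.
Qed.

(** The weighted arithmetic-geometric inequality. Its parameter is tuned later to make both terms
    small, in the role of Cauchy-Schwarz. *)
Lemma dot_bound (f g : CF) t p : 0 < t -> nc (f (tc p) * (g (tc p))^* * (gw (tc p))%:C) <=
  (t / 2) * (nc (f (tc p)) ^+ 2 * gw (tc p)) + (t^-1 / 2) * (nc (g (tc p)) ^+ 2 * gw (tc p)).
Proof.
move=> t0; rewrite !Normc.normcM normc_conj normc_real ger0_norm ?(ltW (gauss_gt0 _))//.
rewrite !mulrA -mulrDl ler_pM2r ?gauss_gt0//.
move: (nc (f _)) (nc (g _)) => x y.
rewrite -subr_ge0 (_ : _ - _ = (t * x - y) ^+ 2 / (2 * t)); last by field; rewrite gt_eqF.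
by rewrite divr_ge0 ?sqr_ge0// mulr_ge0// ltW.
Qed.

Lemma dot_cinteg f g : L2 f -> L2 g -> cinteg (fun z => f z * (g z)^* * (gw z)%:C).
Proof.
move=> [mf fi] [mg gi].
apply: cinteg_le (integD (integZ (1 / 2) fi) (integZ (1^-1 / 2) gi)); first exact: dot_cmeas.
by move=> p; exact: dot_bound.
Qed.

Lemma fock_dotDl f g k : L2 f -> L2 g -> L2 k ->
  fock_dot (fun z => f z + g z) k = fock_dot f k + fock_dot g k.
Proof.
move=> lf lg lk; rewrite /fock_dot -cintegralD; try exact: dot_cinteg.
by congr cintegral; apply/funext => z; rewrite !mulrDl.
Qed.

Lemma fock_dotZl c f k : L2 f -> L2 k ->
  fock_dot (fun z => c * f z) k = c * fock_dot f k.
Proof.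
move=> lf lk; rewrite /fock_dot -cintegralZ; last exact: dot_cinteg.
by congr cintegral; apply/funext => z; rewrite !mulrA.
Qed.

Lemma fock_dotC f k : L2 f -> L2 k -> fock_dot k f = (fock_dot f k)^*.
Proof.
move=> lf lk; rewrite /fock_dot -cintegral_conj; last exact: dot_cinteg.
congr cintegral; apply/funext => z; move: (k z) (f z) (gw z) => [x1 x2] [y1 y2] r.
by apply/eqP; rewrite eq_complex /=; apply/andP; split; apply/eqP; ring.
Qed.

Lemma fock_dotBl f g k : L2 f -> L2 g -> L2 k ->
  fock_dot (fun z => f z - g z) k = fock_dot f k - fock_dot g k.
Proof.
move=> lf lg lk; rewrite (_ : (fun z => _) = (fun z => f z + (-1) * g z)); last first.
  by apply/funext => z; rewrite mulN1r.
by rewrite fock_dotDl ?fock_dotZl ?mulN1r//; exact: L2Z.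
Qed.

Lemma fock_dotDr f g k : L2 f -> L2 g -> L2 k ->
  fock_dot k (fun z => f z + g z) = fock_dot k f + fock_dot k g.
Proof.
move=> lf lg lk; rewrite fock_dotC// ?fock_dotDl//; last exact: L2D.
by rewrite (fock_dotC lf lk) (fock_dotC lg lk) rmorphD.
Qed.

Lemma fock_dotZr c f k : L2 f -> L2 k ->
  fock_dot k (fun z => c * f z) = c^* * fock_dot k f.
Proof.
move=> lf lk; rewrite fock_dotC// ?fock_dotZl//; last exact: L2Z.
by rewrite (fock_dotC lf lk) rmorphM.
Qed.

Lemma fock_dotBr f g k : L2 f -> L2 g -> L2 k ->
  fock_dot k (fun z => f z - g z) = fock_dot k f - fock_dot k g.
Proof.
move=> lf lg lk; rewrite (_ : (fun z => _) = (fun z => f z + (-1) * g z)); last first.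
  by apply/funext => z; rewrite mulN1r.
by rewrite fock_dotDr ?fock_dotZr ?rmorphN1 ?mulN1r//; exact: L2Z.
Qed.

Lemma fock_dot0l (k : CF) : fock_dot (fun=> 0) k = 0.
Proof. by rewrite /fock_dot; under eq_fun do rewrite !mul0r; exact: cintegral0. Qed.

Lemma fock_dot_suml (F : nat -> CF) M k : (forall j, (j < M)%N -> L2 (F j)) -> L2 k ->
  fock_dot (fun z => \sum_(j < M) F j z) k = \sum_(j < M) fock_dot (F j) k.
Proof.
elim: M => [_ _|M ih H lk].
  by under eq_fun do rewrite big_ord0; rewrite big_ord0 fock_dot0l.
have HM j : (j < M)%N -> L2 (F j) by move=> jM; apply: H; exact: ltnW.
under eq_fun do rewrite big_ord_recr/=.
by rewrite big_ord_recr/= fock_dotDl ?ih//; [exact: L2_sum|exact: H].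
Qed.

Lemma fock_dot_self f : L2 f -> fock_dot f f = (fock_norm2 f)%:C.
Proof.
move=> [mf fi]; rewrite /fock_dot /cintegral /fock_norm2 -!/(plane_int _).
have E z : f z * (f z)^* * (gw z)%:C = (nc (f z) ^+ 2 * gw z)%:C.
  by rewrite rmorphM/=; congr (_ * _); rewrite -sqr_normc normC_normc rmorphXn.
by rewrite (_ : (fun p => complex.Re _) = (fun p => nc (f (tc p)) ^+ 2 * gw (tc p)));
  [rewrite (_ : (fun p => complex.Im _) = (fun=> 0)) ?plane_int0//|]; apply/funext => p; rewrite E.
Qed.

Lemma fock_dot_bound f g t : 0 < t -> L2 f -> L2 g ->
  nc (fock_dot f g) <= t * fock_norm2 f + t^-1 * fock_norm2 g.
Proof.
move=> t0 lf lg; have [mf fi] := lf; have [mg gi] := lg.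
have := cintegral_norm (dot_cinteg lf lg) (fun p => @dot_bound f g t p t0) (integD (integZ _ fi) (integZ _ gi)).
rewrite -/(fock_dot f g) plane_intD; try exact: integZ.
rewrite !plane_intZ// -/(fock_norm2 f) -/(fock_norm2 g) => H; rewrite (le_trans H)// le_eqVlt.
by apply/orP; left; apply/eqP; field; rewrite gt_eqF.
Qed.

Lemma fock_norm2D f g : L2 f -> L2 g ->
  fock_norm2 (fun z => f z + g z) = fock_norm2 f + fock_norm2 g + 2 * complex.Re (fock_dot f g).
Proof.
move=> lf lg; apply: complexI; rewrite -fock_dot_self; last exact: L2D.
rewrite fock_dotDl//; last exact: L2D.
rewrite !fock_dotDr// !fock_dot_self// (fock_dotC lf lg).
by case: (fock_dot f g) => x y; apply/eqP; rewrite eq_complex/=; apply/andP; split; apply/eqP; ring.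
Qed.

Lemma fock_norm2Z c f : L2 f -> fock_norm2 (fun z => c * f z) = nc c ^+ 2 * fock_norm2 f.
Proof.
move=> [_ fi]; rewrite /fock_norm2 -plane_intZ//; congr plane_int; apply/funext => p.
by rewrite Normc.normcM exprMn -mulrA.
Qed.

Lemma L2_poly (a : nat -> R[i]) M : L2 (fun z => \sum_(k < M) a k * z ^+ k).
Proof.
split; first exact: cmeas_poly.
have [] // := @radial_parseval R gw mfun_gauss _ gauss_rot integ_gauss_moment a M.
by move=> z; exact/ltW/gauss_gt0.
Qed.

Lemma fock_norm2_poly (a : nat -> R[i]) M :
  fock_norm2 (fun z => \sum_(k < M) a k * z ^+ k) = \sum_(k < M) nc (a k) ^+ 2 * gauss_moment k.
Proof.
have [] // := @radial_parseval R gw mfun_gauss _ gauss_rot integ_gauss_moment a M.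
by move=> z; exact/ltW/gauss_gt0.
Qed.

Lemma L2_mono n : L2 (fun z => z ^+ n).
Proof.
rewrite (_ : (fun z => _) = (fun z => \sum_(k < n.+1) ((k : nat) == n)%:R * z ^+ k)).
  exact: (L2_poly (fun k => (k == n)%:R)).
apply/funext => z; rewrite big_ord_recr/= eqxx mul1r big1 ?add0r// => k _.
by rewrite ltn_eqF ?mul0r.
Qed.

Lemma fock_dot_mono (m n : nat) :
  fock_dot (fun z => z ^+ m) (fun z => z ^+ n) = (if m == n then gauss_moment n else 0 : R)%:C.
Proof.
case: eqP => [->|/eqP mn]; last first.
  apply: (@radial_orthogonal R gw mfun_gauss _ gauss_rot integ_gauss_moment) => //.
  by move=> z; exact/ltW/gauss_gt0.
rewrite fock_dot_self; last exact: L2_mono.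
by congr (_%:C); rewrite /fock_norm2 /gauss_moment; congr plane_int; apply/funext => p; rewrite normcX -exprM mulnC.
Qed.

Lemma fock_dot_poly_mono (a : nat -> R[i]) M n : (n < M)%N ->
  fock_dot (fun z => \sum_(k < M) a k * z ^+ k) (fun z => z ^+ n) = a n * (gauss_moment n)%:C.
Proof.
move=> nM; rewrite (@fock_dot_suml (fun k z => a k * z ^+ k)); last 2 first.
- by move=> j _; exact/L2Z/L2_mono.
- exact: L2_mono.
rewrite (bigD1 (Ordinal nM))//= big1 ?addr0.
  by rewrite fock_dotZl ?fock_dot_mono ?eqxx//; exact: L2_mono.
move=> k kn; rewrite fock_dotZl; try exact: L2_mono.
by rewrite fock_dot_mono ifF ?mulr0//; apply/negbTE; apply: contra kn => /eqP kn; apply/eqP/val_inj.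
Qed.

(** Parseval is known for polynomials only, and the partial sums approach [f] uniformly only on
    discs. The weight is therefore first cut off to the disc of radius [r], where the comparison is
    possible, and Fatou's lemma lets [r] grow. *)
Lemma bessel_expansion (f : CF) (a : nat -> R[i]) : expands f a -> L2 f ->
  forall M, \sum_(k < M) nc (a k) ^+ 2 * gauss_moment k <= fock_norm2 f.
Proof.
move=> fa lf M; have [mf fi] := lf.
pose W (r : R) (z : R[i]) := disc_weight r z * gw z.
have W0 r z : 0 <= W r z by rewrite mulr_ge0 ?disc_weight_ge0// ltW// gauss_gt0.
have Wg r z : W r z <= gw z by rewrite ler_piMl ?disc_weight_le1// ltW// gauss_gt0.
have mW r : mfun (fun p => W r (tc p)) by apply: mfunM; [exact: mfun_disc|exact: mfun_gauss].
have Wrot r t z : W r (expi t * z) = W r z by rewrite /W disc_weight_rot gauss_rot.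
have iW r k : integ (fun p => nc (tc p) ^+ k * W r (tc p)).
  apply: integ_le (integ_gauss_moment k); first by apply: mfunM => //; apply: mfunX; exact: mfun_normc.
  move=> p; rewrite ger0_norm; last by rewrite mulr_ge0 ?exprn_ge0 ?normc_ge0.
  by rewrite ler_wpM2l ?exprn_ge0 ?normc_ge0.
have iW0 r : integ (fun p => W r (tc p)) by have := iW r 0%N; under eq_fun do rewrite expr0 mul1r.
have main r : \sum_(k < M) nc (a k) ^+ 2 * plane_int (fun p => nc (tc p) ^+ (2 * k) * W r (tc p)) <= fock_norm2 f.
  have [D HD] := fa r.
  rewrite -subr_le0; apply: (@geo_small _ _ (fock_norm2 f + 2 * D ^+ 2 * plane_int (fun p => W r (tc p)))) => N.
  pose m := maxn M N.
  have := radial_parseval (mW r) (W0 r) (Wrot r) (iW r) a m => -[ip Ip].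
  have le1 : \sum_(k < M) nc (a k) ^+ 2 * plane_int (fun p => nc (tc p) ^+ (2 * k) * W r (tc p)) <=
     \sum_(k < m) nc (a k) ^+ 2 * plane_int (fun p => nc (tc p) ^+ (2 * k) * W r (tc p)).
    rewrite -!(big_mkord xpredT (fun k => nc (a k) ^+ 2 * plane_int (fun p => nc (tc p) ^+ (2 * k) * W r (tc p)))).
    rewrite [leRHS](big_cat_nat (n := M))//= ?leq_maxl// lerDl sumr_ge0// => k _.
    by rewrite mulr_ge0 ?exprn_ge0 ?normc_ge0// plane_int_ge0// => p; rewrite mulr_ge0 ?exprn_ge0 ?normc_ge0.
  rewrite lerBlDl (le_trans le1)// -Ip.
  pose t : R := 2 ^- m.
  have t0 : 0 < t by rewrite invr_gt0 exprn_gt0.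
  have iB : integ (fun p => (1 + t) * (nc (f (tc p)) ^+ 2 * gw (tc p)) + (2 * D ^+ 2 * t) * W r (tc p)).
    by apply: integD; exact: integZ.
  (* On the disc the partial sum satisfies |S_m| <= |f| + D t with t = 2^-m, and the cross term is
     split so that |S_m|^2 <= (1 + t) |f|^2 + 2 D^2 t. *)
  apply: (@le_trans _ _ (plane_int (fun p => (1 + t) * (nc (f (tc p)) ^+ 2 * gw (tc p)) + (2 * D ^+ 2 * t) * W r (tc p)))).
    apply: plane_int_le => // p.
    have [pr|pr] := leP (nc (tc p)) r; last first.
      have -> : W r (tc p) = 0 by rewrite /W disc_weightE lt_geF// mul0r.
      rewrite !mulr0 addr0.
      by rewrite mulr_ge0 ?addr_ge0 ?(ltW t0)// mulr_ge0 ?exprn_ge0 ?normc_ge0// ltW// gauss_gt0.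
    have -> : W r (tc p) = gw (tc p) by rewrite /W disc_weightE pr mul1r.
    rewrite mulrA -mulrDl ler_pM2r ?gauss_gt0//.
    have := HD _ pr m; set x := f (tc p); set y := \sum_(_ < _) _.
    have := le_normcD x (y - x); rewrite addrC subrK [in nc (y - x)]normcB.
    rewrite -/t; move: (nc (x - y)) (nc x) (nc y) (normc_ge0 (x - y)) (normc_ge0 x) (normc_ge0 y) => u v w' u0 v0 w0 h1 h2.
    have t1 : t <= 1 by rewrite invf_le1 ?exprn_gt0// exprn_ege1// ler1n.
    have h3 : w' ^+ 2 <= (v + D * t) ^+ 2 by rewrite lerXn2r ?nnegrE//; [rewrite addr_ge0//; lra|lra].
    rewrite (le_trans h3)//.
    have : (v + D * t) ^+ 2 = v ^+ 2 + t * (2 * v * D) + D ^+ 2 * t * t by ring.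
    move=> ->.
    have h4 : 2 * v * D <= v ^+ 2 + D ^+ 2 by have := sqr_ge0 (v - D); nra.
    have h5 : D ^+ 2 * t * t <= D ^+ 2 * t by rewrite ler_piMr// mulr_ge0 ?sqr_ge0// ltW.
    have h6 : t * (2 * v * D) <= t * (v ^+ 2 + D ^+ 2) by rewrite ler_wpM2l// ltW.
    by lra.
  rewrite plane_intD; try exact: integZ.
  rewrite !plane_intZ// -/(fock_norm2 f).
  have tN : t <= 2 ^- N.
    by rewrite lef_pV2 ?posrE ?exprn_gt0// ler_weXn2l ?ler1n// leq_maxr.
  have -> : (1 + t) * fock_norm2 f + 2 * D ^+ 2 * t * plane_int (fun p => W r (tc p)) =
    fock_norm2 f + (fock_norm2 f + 2 * D ^+ 2 * plane_int (fun p => W r (tc p))) * t by ring.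
  rewrite lerD2l ler_wpM2l//; apply: addr_ge0; first exact: fock_norm2_ge0.
  apply: mulr_ge0; last by apply: plane_int_ge0 => p; exact: W0.
  by apply: mulr_ge0 => //; exact: sqr_ge0.
pose h (n : nat) (p : R * R) := \sum_(k < M) nc (a k) ^+ 2 * (nc (tc p) ^+ (2 * k) * W n%:R (tc p)).
have ih n k : (k < M)%N -> integ (fun p => nc (a k) ^+ 2 * (nc (tc p) ^+ (2 * k) * W n%:R (tc p))).
  by move=> _; exact: integZ.
have [||||i1 i2] := @plane_int_fatou R h (fun p => \sum_(k < M) nc (a k) ^+ 2 * (nc (tc p) ^+ (2 * k) * gw (tc p))) (fock_norm2 f).
- by move=> n; have [] := integ_sum (ih n).
- move=> n p; apply: sumr_ge0 => k _; by rewrite mulr_ge0 ?exprn_ge0 ?normc_ge0// mulr_ge0 ?exprn_ge0 ?normc_ge0.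
- move=> p; apply: cvg_near_cst.
  exists (Num.truncn (nc (tc p))).+1 => // n /= nt.
  apply: eq_bigr => k _; rewrite /W disc_weightE.
  have -> : nc (tc p) <= n%:R by rewrite (le_trans (ltW (truncnS_gt _)))// ler_nat.
  by rewrite mul1r.
- move=> n; have [_ ->] := integ_sum (ih n); rewrite (le_trans _ (main n%:R))//.
  by apply: ler_sum => k _; rewrite plane_intZ.
have iG k : (k < M)%N -> integ (fun p => nc (a k) ^+ 2 * (nc (tc p) ^+ (2 * k) * gw (tc p))).
  by move=> _; apply: integZ; exact: integ_gauss_moment.
rewrite (le_trans _ i2)//; have [_ ->] := integ_sum iG.
by apply: ler_sum => k _; rewrite plane_intZ//; exact: integ_gauss_moment.
Qed.

(** Converse of Bessel's inequality: the norms of the partial sums are explicit, and Fatou's lemma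
    passes to their pointwise limit. *)
Lemma fock_of_coefs (f : CF) (a : nat -> R[i]) B : expands f a ->
  (forall M, \sum_(k < M) nc (a k) ^+ 2 * gauss_moment k <= B) -> L2 f /\ fock_norm2 f <= B.
Proof.
move=> fa aB; have mf := cmeas_expands fa.
have [||||i1 i2] := @plane_int_fatou R (fun n p => nc (\sum_(k < n) a k * tc p ^+ k) ^+ 2 * gw (tc p))
   (fun p => nc (f (tc p)) ^+ 2 * gw (tc p)) B.
- by move=> n; have [] := L2_poly a n.
- by move=> n p; rewrite mulr_ge0 ?exprn_ge0 ?normc_ge0// ltW// gauss_gt0.
- move=> p; have [h1 h2] := expands_cvg p fa.
  under eq_fun do rewrite normc_sqr; rewrite normc_sqr.
  apply: cvgM; last exact: cvg_cst.
  by apply: cvgD; apply: cvgM.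
- by move=> n; rewrite -/(fock_norm2 (fun z => \sum_(k < n) a k * z ^+ k)) fock_norm2_poly.
by split.
Qed.

Lemma expands_tail (f : CF) (a : nat -> R[i]) N : expands f a ->
  expands (fun z => f z - \sum_(k < N) a k * z ^+ k) (fun k => if (k < N)%N then 0 else a k).
Proof.
move=> fa A; have [D HD] := expandsD fa (expandsZ (-1) (expands_poly a N)) A.
exists D => z zA M; have := HD z zA M; rewrite mulN1r => H.
rewrite (eq_bigr (fun k : 'I_M => (a k + -1 * (if (k < N)%N then a k else 0)) * z ^+ k))//.
by move=> k _; case: ifP => _; rewrite ?mulN1r ?subrr ?oppr0 ?addr0 ?mulr0 ?addr0.
Qed.

Lemma bessel_tail (f : CF) (a : nat -> R[i]) N B : expands f a ->
  (forall M, \sum_(N <= k < M) nc (a k) ^+ 2 * gauss_moment k <= B) -> 0 <= B ->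
  L2 (fun z => f z - \sum_(k < N) a k * z ^+ k) /\ fock_norm2 (fun z => f z - \sum_(k < N) a k * z ^+ k) <= B.
Proof.
move=> fa aB B0; apply: fock_of_coefs (expands_tail N fa) _ => M.
rewrite (@le_trans _ _ (\sum_(N <= k < M) nc (a k) ^+ 2 * gauss_moment k))//.
rewrite -(big_mkord xpredT (fun k => nc (if (k < N)%N then 0 else a k) ^+ 2 * gauss_moment k)).
have [NM|MN] := leqP N M.
  rewrite (big_cat_nat (n := N))//= big_nat_cond big1 ?add0r; last first.
    by move=> k /andP[/andP[_ ->] _]; rewrite Normc.normc0 expr0n mul0r.
  rewrite big_nat_cond [leRHS]big_nat_cond ler_sum// => k /andP[/andP[Nk _] _].
  by rewrite ltnNge Nk.
rewrite big_nat_cond big1 ?sumr_ge0//.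
  by move=> k _; rewrite mulr_ge0 ?exprn_ge0 ?normc_ge0// ltW// gauss_moment_gt0.
by move=> k /andP[/andP[_ kM] _]; rewrite (ltn_trans kM MN) Normc.normc0 expr0n mul0r.
Qed.

(** Density of polynomials: the partial sums of the coefficient series increase to a supremum, and
    beyond a nearly maximal one the tail is small. *)
Lemma fock_norm2_tail_small (f : CF) (a : nat -> R[i]) : expands f a -> L2 f ->
  forall e, 0 < e -> exists N, forall n, (N <= n)%N ->
    fock_norm2 (fun z => f z - \sum_(k < n) a k * z ^+ k) <= e.
Proof.
move=> fa lf e e0.
pose s M := \sum_(k < M) nc (a k) ^+ 2 * gauss_moment k.
have sB M : s M <= fock_norm2 f by exact: bessel_expansion.
have t0 k : 0 <= nc (a k) ^+ 2 * gauss_moment k by rewrite mulr_ge0 ?exprn_ge0 ?normc_ge0// ltW// gauss_moment_gt0.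
have hs : has_sup (range s) by split; [exists (s 0%N); exists 0%N|exists (fock_norm2 f) => _ [M _ <-]].
have [_ [N _ <-] Ns] := sup_adherent e0 hs.
have sm n m : (n <= m)%N -> s m = s n + \sum_(n <= k < m) nc (a k) ^+ 2 * gauss_moment k.
  move=> nm; rewrite /s -!(big_mkord xpredT (fun k => nc (a k) ^+ 2 * gauss_moment k)).
  by rewrite (big_cat_nat (n := n)).
exists N => n Nn; apply: (bessel_tail fa _ (ltW e0)).2 => M.
have [nM|Mn] := leqP n M; last by rewrite big_geq ?(ltnW Mn)// ltW.
have h1 : s M <= sup (range s) by apply: ub_le_sup; [case: hs|exists M].
have h2 := sm _ _ nM; have h3 := sm _ _ Nn.
have h4 : 0 <= \sum_(N <= k < n) nc (a k) ^+ 2 * gauss_moment k by exact: sumr_ge0.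
by lra.
Qed.

Lemma fock_dot_coef (f : CF) (a : nat -> R[i]) n : expands f a -> L2 f ->
  fock_dot f (fun z => z ^+ n) = a n * (gauss_moment n)%:C.
Proof.
move=> fa lf; have lz := L2_mono n.
apply/eqP; rewrite -subr_eq0 -normc_eq0 eq_le normc_ge0 andbT.
apply/ler_addgt0Pr => e e0; rewrite add0r.
pose t := 2 * gauss_moment n / e.
have t0 : 0 < t by rewrite divr_gt0// mulr_gt0// gauss_moment_gt0.
have e't : 0 < e / (2 * t) by rewrite divr_gt0// mulr_gt0.
have [N HN] := fock_norm2_tail_small fa lf e't.
pose m := maxn N n.+1.
have lp := L2_poly a m.
rewrite -(@fock_dot_poly_mono a m n) ?leq_maxr// -fock_dotBl//.
rewrite (le_trans (fock_dot_bound t0 (L2B lf lp) lz))//.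
have -> : fock_norm2 (fun z => z ^+ n) = gauss_moment n.
  by apply: complexI; rewrite -fock_dot_self// fock_dot_mono eqxx.
have h := HN m (leq_maxl _ _).
have : t * fock_norm2 (fun z => f z - \sum_(k < m) a k * z ^+ k) <= t * (e / (2 * t)) by rewrite ler_wpM2l// ltW.
have -> : t * (e / (2 * t)) = e / 2 by field; rewrite gt_eqF.
have -> : t^-1 * gauss_moment n = e / 2 by rewrite /t; field; rewrite !gt_eqF// gauss_moment_gt0.
by lra.
Qed.

Lemma fock_dot_density (h : CF) : L2 h -> (forall n, fock_dot h (fun z => z ^+ n) = 0) ->
  forall (k : CF) (a : nat -> R[i]), expands k a -> L2 k -> fock_dot h k = 0.
Proof.
move=> lh h0 k a ka lk.
apply/eqP; rewrite -normc_eq0 eq_le normc_ge0 andbT.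
apply/ler_addgt0Pr => e e0; rewrite add0r.
have n1 : 0 < fock_norm2 h + 1 by rewrite ltr_wpDl// fock_norm2_ge0.
pose t := e / (2 * (fock_norm2 h + 1)).
have t0 : 0 < t by rewrite divr_gt0// mulr_gt0.
have te0 : 0 < t * e / 2 by rewrite divr_gt0// mulr_gt0.
have [N HN] := fock_norm2_tail_small ka lk te0.
have lp := L2_poly a N.
have -> : fock_dot h k = fock_dot h (fun z => k z - \sum_(j < N) a j * z ^+ j).
  rewrite fock_dotBr// [X in _ - X](_ : _ = 0) ?subr0//.
  rewrite fock_dotC// (@fock_dot_suml (fun j z => a j * z ^+ j))//; last by move=> j _; exact/L2Z/L2_mono.
  rewrite big1 ?conjc0// => j _; rewrite fock_dotZl//; last exact: L2_mono.
  by rewrite fock_dotC ?h0 ?conjc0 ?mulr0//; exact: L2_mono.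
rewrite (le_trans (fock_dot_bound t0 lh (L2B lk lp)))//.
have h1 := HN N (leqnn N).
have h2 : t * fock_norm2 h <= e / 2.
  rewrite /t mulrAC ler_pdivrMr ?mulr_gt0//.
  have -> : e / 2 * (2 * (fock_norm2 h + 1)) = e * (fock_norm2 h + 1) by field.
  by rewrite ler_wpM2l ?(ltW e0)// lerDl.
have h3 : t^-1 * fock_norm2 (fun z => k z - \sum_(j < N) a j * z ^+ j) <= e / 2.
  by rewrite mulrC ler_pdivrMr// (le_trans h1)// le_eqVlt; apply/orP; left; apply/eqP; ring.
by lra.
Qed.

Lemma fockP f : fock f <-> L2 f /\ exists a, expands f a.
Proof.
split.
  move=> [ef ff]; have [a fa] := entire_expands ef.
  split; last by exists a.
  have mf := cmeas_expands fa.
  split => //; apply: integ_EFin => //.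
    by apply: mfunM; [exact: mfun_normc2|exact: mfun_gauss].
  by move=> p; rewrite mulr_ge0 ?exprn_ge0 ?normc_ge0// ltW// gauss_gt0.
move=> [[mf fi] [a fa]]; split; first exact: expands_entire fa.
by rewrite (plane_int_EFin fi) ltry.
Qed.

Lemma fock_norm2_eq0 f : fock f -> fock_norm2 f = 0 -> f = (fun=> 0).
Proof.
move=> /fockP[lf [a fa]] f0.
have a0 k : a k = 0.
  have := bessel_expansion fa lf k.+1; rewrite f0 big_ord_recr/= => H.
  have : nc (a k) ^+ 2 * gauss_moment k <= 0.
    rewrite (le_trans _ H)// lerDr sumr_ge0// => j _.
    by rewrite mulr_ge0 ?exprn_ge0 ?normc_ge0// ltW// gauss_moment_gt0.
  rewrite pmulr_lle0 ?gauss_moment_gt0// => h; apply/eqP; rewrite -normc_eq0 -sqrf_eq0 eq_le h sqr_ge0//.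
apply/funext => z; apply/eqP; rewrite -normc_eq0 eq_le normc_ge0 andbT.
have [D HD] := fa (nc z); apply: (@geo_small _ _ D) => M.
by have := HD z (lexx _) M; rewrite big1 ?subr0// => k _; rewrite a0 mul0r.
Qed.

End FockHilbert.

(** * Limits along an ultrafilter *)

Section UltraLimits.
Context {R : realType}.
Local Notation nc := (@Normc.normc R).

(** The ultrafilter decides every inequality x <= u n, and the limit is the supremum of the [x] for
    which it holds. One ultrafilter serves all sequences at once, so no diagonal extraction is
    needed later. *)
Lemma ultra_real_limit (U : set_system nat) (u : nat -> R) B : UltraFilter U ->
  (forall n, `|u n| <= B) -> exists l, forall e, 0 < e -> U [set n | `|u n - l| <= e].
Proof.
move=> UU uB.
have UF : ProperFilter U by exact: ultra_proper.
pose S := [set x : R | U [set n | x <= u n]].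
have SB : S (- B).
  by apply: filterS filterT => n _ /=; have := uB n; rewrite ler_norml => /andP[].
have Sub x : S x -> x <= B.
  move=> Sx; have [n /= xn] := filter_ex Sx.
  by rewrite (le_trans xn)//; have := uB n; rewrite ler_norml => /andP[].
have hs : has_sup S by split; [exists (- B)|exists B => x; exact: Sub].
exists (sup S) => e e0.
have [x Sx xs] := sup_adherent e0 hs.
have h2 : U [set n | u n < sup S + e].
  have [h|] := in_ultra_setVsetC [set n | sup S + e <= u n] UU.
    have : sup S + e <= sup S by apply: ub_le_sup => //; case: hs.
    by rewrite gerDl leNgt e0.
  by apply: filterS => n /= /negP; rewrite -ltNge.
apply: filterS (filterI Sx h2) => n /= [h3 h4].
by rewrite ler_norml; apply/andP; split; lra.
Qed.

Lemma ultra_complex_limit (U : set_system nat) (u : nat -> R[i]) B : UltraFilter U ->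
  (forall n, nc (u n) <= B) -> exists l, forall e, 0 < e -> U [set n | nc (u n - l) <= e].
Proof.
move=> UU uB; have UF : ProperFilter U by exact: ultra_proper.
have [x xP] := ultra_real_limit UU (fun n => le_trans (normc_Re (u n)) (uB n)).
have [y yP] := ultra_real_limit UU (fun n => le_trans (normc_Im (u n)) (uB n)).
exists (x +i* y) => e e0; have e2 : 0 < e / 2 by rewrite divr_gt0.
apply: filterS (filterI (xP _ e2) (yP _ e2)) => n /= [h1 h2].
rewrite (le_trans (normc_le_ReIm _))// [e]splitr.
by move: h1 h2; case: (u n) => a b /= h1 h2; exact: lerD.
Qed.

End UltraLimits.

(** * Functions of the Fock space on a fixed disc *)

Section FockLocal.
Context {R : realType}.
Local Notation nc := (@Normc.normc R).
Local Notation tc := (@to_complex R).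
Local Notation gw := (@gauss_weight R).
Local Notation CF := (R[i]^o -> R[i]^o).

(** The moments grow like k!, which beats every geometric sequence: bounded norm alone forces
    coefficients to decay at any radius, with a constant depending only on [A]. *)
Lemma coef_decay (A : R) : 0 <= A -> exists2 K, 0 < K & forall (k : nat) (x B : R), 0 <= x ->
  x ^+ 2 * gauss_moment k <= B -> x * A ^+ k <= Num.sqrt B * K / 2 ^+ k.
Proof.
move=> A0.
(* The 2 yields the decay 2^-k, and e^2 pays for the loss e^(-2k) in [gauss_moment_ge]. *)
pose Y := (2 * A) ^+ 2 * expR 2.
have Y0 : 0 <= Y by rewrite mulr_ge0 ?sqr_ge0 ?expR_ge0.
pose K2 := expR 4 * expR Y.
have K20 : 0 < K2 by rewrite mulr_gt0 ?expR_gt0.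
exists (Num.sqrt K2); first by rewrite sqrtr_gt0.
move=> k x B x0 xB.
have g0 := gauss_moment_gt0 (R := R) k.
have B0 : 0 <= B by rewrite (le_trans _ xB)// mulr_ge0 ?sqr_ge0// ltW.
rewrite ler_pdivlMr ?exprn_gt0// -mulrA -exprMn mulrC [A * 2]mulrC.
rewrite -sqrtrM// -(@ler_pXn2r _ 2) ?nnegrE ?sqrtr_ge0 ?mulr_ge0 ?exprn_ge0 ?mulr_ge0//.
rewrite sqr_sqrtr; last by rewrite mulr_ge0// ltW.
rewrite [(2 * A) ^+ k * x]mulrC exprMn exprAC.
have h1 : ((2 * A) ^+ 2) ^+ k <= gauss_moment k * K2.
  have h2 := pow_le_expR k Y0.
  have h3 := @gauss_moment_ge R k.
  have eE : expR (2 : R) ^+ k = expR (2 * k%:R) by rewrite -expRM_natl; congr expR; rewrite mulrC.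
  have E4 : expR (- (2 * k%:R + 4)) * (expR 4 * expR (2 * k%:R)) = 1 :> R.
    by rewrite -expRD -expRD -expR0; congr expR; ring.
  move: h2; rewrite /Y exprMn eE -/Y => h2.
  have e0 := expR_gt0 (2 * k%:R : R).
  rewrite -(ler_pM2r e0) (le_trans h2)// /K2.
  have -> : gauss_moment k * (expR 4 * expR Y) * expR (2 * k%:R) = gauss_moment k * (expR 4 * expR (2 * k%:R)) * expR Y by ring.
  rewrite ler_pM2r ?expR_gt0//.
  have c0 : 0 <= expR 4 * expR (2 * k%:R) :> R by apply: mulr_ge0; exact: expR_ge0.
  by rewrite (le_trans _ (ler_wpM2r c0 h3))// -mulrA E4 mulr1.
rewrite (@le_trans _ _ (x ^+ 2 * (gauss_moment k * K2)))//; first by rewrite ler_wpM2l ?sqr_ge0.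
by rewrite mulrA ler_wpM2r// ltW.
Qed.

(** [K] does not depend on [f]: on the disc, finitely many coefficients determine [f] up to an error
    uniform over the unit ball. This is the compactness behind [max_principle]. *)
Lemma fock_sup (A : R) : 0 <= A -> exists2 K, 0 < K & forall (f : CF) a, expands f a ->
  (forall B, (forall k, nc (a k) ^+ 2 * gauss_moment k <= B) -> forall z, nc z <= A -> forall M,
  nc (f z - \sum_(k < M) a k * z ^+ k) <= K * Num.sqrt B / 2 ^+ M).
Proof.
move=> A0; have [K K0 HK] := coef_decay A0.
exists (2 * K) => [|f a fa B aB z zA M]; first by rewrite mulr_gt0.
have ck k : nc (a k) * A ^+ k <= Num.sqrt B * K / 2 ^+ k.
  by apply: HK; [exact: normc_ge0|exact: aB].
have [D HD] := fa A.
rewrite -subr_le0; apply: (@geo_small _ _ D) => n.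
pose N := maxn M n.
have MN : (M <= N)%N by exact: leq_maxl.
have := le_normcD (f z - \sum_(k < N) a k * z ^+ k) (\sum_(M <= k < N) a k * z ^+ k).
have -> : f z - \sum_(k < N) a k * z ^+ k + \sum_(M <= k < N) a k * z ^+ k = f z - \sum_(k < M) a k * z ^+ k.
  rewrite -!(big_mkord xpredT (fun k => a k * z ^+ k)) (big_cat_nat (n := M) (leq0n M) MN)/=.
  by rewrite opprD addrA subrK.
have h1 : nc (f z - \sum_(k < N) a k * z ^+ k) <= D / 2 ^+ n.
  have D0 : 0 <= D.
    by have := HD z zA 0%N; rewrite expr0 divr1; apply: le_trans; exact: normc_ge0.
  rewrite (le_trans (HD z zA N))// ler_wpM2l// lef_pV2 ?posrE ?exprn_gt0// ler_weXn2l ?ler1n//.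
  exact: leq_maxr.
have h2 : nc (\sum_(M <= k < N) a k * z ^+ k) <= 2 * K * Num.sqrt B / 2 ^+ M.
  rewrite (le_trans (normc_sum _ _ _))//.
  rewrite (@le_trans _ _ (\sum_(M <= k < N) Num.sqrt B * K / 2 ^+ k))//.
    apply: ler_sum => k _; rewrite Normc.normcM normcX (le_trans _ (ck k))//.
    by rewrite ler_wpM2l ?normc_ge0// lerXn2r ?nnegrE ?normc_ge0.
  rewrite -mulr_sumr.
  have S0 m : \sum_(M <= k < m) (2 : R) ^- k <= 2 / 2 ^+ M.
    have [Mm|mM] := leqP M m; last by rewrite big_geq ?(ltnW mM)// divr_ge0// exprn_ge0.
    rewrite [leLHS](_ : _ = 2 / 2 ^+ M - 2 / 2 ^+ m) ?gerBl ?divr_ge0 ?exprn_ge0//.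
    elim: m Mm => [|m ih]; first by rewrite leqn0 => /eqP ->; rewrite big_geq// subrr.
    rewrite leq_eqVlt => /predU1P[->|]; first by rewrite big_geq// subrr.
    rewrite ltnS => Mm; rewrite big_nat_recr//= ih// [in RHS]exprS; field.
    by rewrite !expf_neq0.
  have -> : 2 * K * Num.sqrt B / 2 ^+ M = Num.sqrt B * K * (2 / 2 ^+ M) by ring.
  by rewrite ler_wpM2l// mulr_ge0 ?sqrtr_ge0// ltW.
by lra.
Qed.

Lemma coef_bessel (f : CF) a k : expands f a -> L2 f -> nc (a k) ^+ 2 * gauss_moment k <= fock_norm2 f.
Proof.
move=> fa lf; rewrite (le_trans _ (bessel_expansion fa lf k.+1))// big_ord_recr/= lerDr sumr_ge0// => j _.
by rewrite mulr_ge0 ?exprn_ge0 ?normc_ge0// ltW// gauss_moment_gt0.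
Qed.

Lemma fock_bounded_on_disc (A : R) : 0 <= A -> exists2 K, 0 < K & forall f : CF, fock f ->
  forall z, nc z <= A -> nc (f z) <= K * Num.sqrt (fock_norm2 f).
Proof.
move=> A0; have [K K0 HK] := fock_sup A0; exists K => // f /fockP[lf [a fa]] z zA.
have := HK f a fa (fock_norm2 f) (fun k => coef_bessel k fa lf) z zA 0%N.
by rewrite big_ord0 subr0 expr0 divr1.
Qed.

Lemma fockD (f g : CF) : fock f -> fock g -> fock (fun z => f z + g z).
Proof.
move=> /fockP[lf [a fa]] /fockP[lg [b gb]]; apply/fockP; split; first exact: L2D.
by exists (fun k => a k + b k); exact: expandsD.
Qed.

Lemma fockZ c (f : CF) : fock f -> fock (fun z => c * f z).
Proof.
move=> /fockP[lf [a fa]]; apply/fockP; split; first exact: L2Z.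
by exists (fun k => c * a k); exact: expandsZ.
Qed.

Lemma fockB (f g : CF) : fock f -> fock g -> fock (fun z => f z - g z).
Proof.
move=> ff fg; rewrite (_ : (fun z => _) = (fun z => f z + (-1) * g z)); last first.
  by apply/funext => z; rewrite mulN1r.
by apply: fockD => //; exact: fockZ.
Qed.

Lemma fock_poly (a : nat -> R[i]) M : fock ((fun z => \sum_(k < M) a k * z ^+ k) : CF).
Proof. by apply/fockP; split; [exact: L2_poly|eexists; exact: expands_poly]. Qed.

Lemma fock_0 : fock ((fun=> 0) : CF).
Proof.
rewrite (_ : (fun=> 0) = (fun z => \sum_(k < 0) (fun=> 0) (k : nat) * z ^+ k)).
  exact: (fock_poly (fun=> 0)).
by apply/funext => z; rewrite big_ord0.
Qed.

Lemma fock_sum (F : nat -> CF) M : (forall k, (k < M)%N -> fock (F k)) ->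
  fock ((fun z => \sum_(k < M) F k z) : CF).
Proof.
elim: M => [_|M ih H].
  by under eq_fun do rewrite big_ord0; exact: fock_0.
under eq_fun do rewrite big_ord_recr/=; apply: fockD; last exact: H.
by apply: ih => k kM; apply: H; exact: ltnW.
Qed.

Lemma fock_L2 (f : CF) : fock f -> L2 f.
Proof. by move=> /fockP[]. Qed.

Lemma fock_of_bounded_coefs (a : nat -> R[i]) B :
  (forall M, \sum_(k < M) nc (a k) ^+ 2 * gauss_moment k <= B) ->
  exists f : CF, [/\ fock f, expands f a & fock_norm2 f <= B].
Proof.
move=> aB.
have aB' k : nc (a k) ^+ 2 * gauss_moment k <= B.
  rewrite (le_trans _ (aB k.+1))// big_ord_recr/= lerDr sumr_ge0// => j _.
  by rewrite mulr_ge0 ?exprn_ge0 ?normc_ge0// ltW// gauss_moment_gt0.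
have [|f Hf] := @power_series_sum R a.
  move=> A A0; have [K K0 HK] := coef_decay A0.
  by exists (Num.sqrt B * K) => k; apply: HK => //; exact: normc_ge0.
have fa : expands f a.
  move=> A.
  have A0 : 0 <= `|A| by [].
  have [K K0 HK] := coef_decay A0.
  have HD k : nc (a k) * `|A| ^+ k <= Num.sqrt B * K / 2 ^+ k.
    by apply: HK => //; exact: normc_ge0.
  exists (4 * (Num.sqrt B * K)) => z zA M; apply: Hf A0 HD _ _ _.
  by rewrite (le_trans zA)// ler_norm.
have [lf nf] := fock_of_coefs fa aB.
by exists f; split => //; apply/fockP; split => //; exists a.
Qed.

End FockLocal.

(** * Toeplitz operators and their eigenvalues *)

Section ToeplitzSpectral.
Context {R : realType}.
Local Notation nc := (@Normc.normc R).
Local Notation tc := (@to_complex R).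
Local Notation gw := (@gauss_weight R).
Local Notation CF := (R[i]^o -> R[i]^o).
Variables (V : R[i]^o -> R) (B A : R).
Hypotheses (mV : mfun (fun p => V (tc p))) (VB : forall z, `|V z| <= B)
  (A0 : 0 <= A) (V_supp : forall z, A < nc z -> V z = 0).

Definition symbol_dot (f g : CF) : R[i] := fock_dot (fun z => (V z)%:C * f z) g.
Local Notation qd := symbol_dot.

Let B0 : 0 <= B. Proof. by rewrite (le_trans _ (VB 0)). Qed.

Lemma symbol_L2 f : L2 f -> L2 (fun z => (V z)%:C * f z).
Proof. by move=> lf; exact: L2_mul mV VB lf. Qed.

Lemma symbol_dot_sup f g m m' : L2 f -> L2 g -> 0 <= m -> 0 <= m' ->
  (forall z, nc z <= A -> nc (f z) <= m) -> (forall z, nc z <= A -> nc (g z) <= m') ->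
  nc (qd f g) <= 2 * (B * (m * m') * plane_int (fun p => disc_weight A (tc p))).
Proof.
move=> lf lg m0 m'0 fm gm; rewrite -plane_intZ; last exact: integ_disc.
apply: cintegral_norm; first by apply: dot_cinteg => //; exact: symbol_L2.
  move=> p; rewrite !Normc.normcM !normc_real normc_conj (ger0_norm (ltW (gauss_gt0 _))).
  have [pA|pA] := leP (nc (tc p)) A; last first.
    by rewrite (V_supp pA) normr0 !mul0r mulr_ge0 ?disc_weight_ge0// mulr_ge0// mulr_ge0.
  rewrite disc_weightE pA mulr1 -mulrA -mulrA ler_pM ?mulr_ge0 ?normc_ge0 ?VB//.
    exact/ltW/gauss_gt0.
  rewrite ler_pM ?normc_ge0 ?fm ?mulr_ge0 ?normc_ge0//; first exact/ltW/gauss_gt0.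
  by rewrite -[m']mulr1 ler_pM ?normc_ge0 ?gm ?gauss_le1//; exact/ltW/gauss_gt0.
by apply: integZ; exact: integ_disc.
Qed.

Lemma symbol_dotC f g : L2 f -> L2 g -> qd g f = (qd f g)^*.
Proof.
move=> lf lg; rewrite /symbol_dot -fock_dotC//; last exact: symbol_L2.
rewrite /fock_dot; congr cintegral; apply/funext => z.
move: (V z) (f z) (g z) (gw z) => v [x1 x2] [y1 y2] r.
by apply/eqP; rewrite eq_complex /=; apply/andP; split; apply/eqP; ring.
Qed.

Lemma symbol_dotDl f g k : L2 f -> L2 g -> L2 k -> qd (fun z => f z + g z) k = qd f k + qd g k.
Proof.
move=> lf lg lk; apply: etrans (fock_dotDl (symbol_L2 lf) (symbol_L2 lg) lk).
by apply: (congr1 (fun h : CF => fock_dot h k)); apply/funext => z; rewrite mulrDr.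
Qed.

Lemma symbol_dotZl c f k : L2 f -> L2 k -> qd (fun z => c * f z) k = c * qd f k.
Proof.
move=> lf lk; apply: etrans (fock_dotZl c (symbol_L2 lf) lk).
by apply: (congr1 (fun h : CF => fock_dot h k)); apply/funext => z; rewrite mulrCA.
Qed.

Lemma symbol_dotBl f g k : L2 f -> L2 g -> L2 k -> qd (fun z => f z - g z) k = qd f k - qd g k.
Proof.
move=> lf lg lk; apply: etrans (fock_dotBl (symbol_L2 lf) (symbol_L2 lg) lk).
by apply: (congr1 (fun h : CF => fock_dot h k)); apply/funext => z; rewrite mulrBr.
Qed.

Lemma symbol_dotBr f g k : L2 f -> L2 g -> L2 k -> qd k (fun z => f z - g z) = qd k f - qd k g.
Proof. by move=> lf lg lk; rewrite /symbol_dot fock_dotBr//; exact: symbol_L2. Qed.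

Lemma symbol_quad_real f : L2 f -> qd f f = (complex.Re (qd f f))%:C.
Proof.
move=> lf; have := symbol_dotC lf lf; case: (qd f f) => x y /=.
move=> [] /eqP; rewrite -addr_eq0 -mulr2n mulrn_eq0/= => /eqP ->.
by rewrite complexr0.
Qed.

Lemma symbol_quadD f g : L2 f -> L2 g ->
  complex.Re (qd (fun z => f z + g z) (fun z => f z + g z)) =
  complex.Re (qd f f) + complex.Re (qd g g) + 2 * complex.Re (qd f g).
Proof.
move=> lf lg; rewrite symbol_dotDl//; last exact: L2D.
rewrite [X in X + _]fock_dotDr//; last exact: symbol_L2.
rewrite [X in _ + X]fock_dotDr//; last exact: symbol_L2.
rewrite -!/(qd _ _) (symbol_dotC lf lg).
by case: (qd f f) (qd g g) (qd f g) => ? ? [] ? ? [] ? ? /=; ring.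
Qed.

(** The projection is written down by its coefficients <V f, z^n> / moment. As [V] lives in the disc
    of radius [A], the numerators are O(A^n), so they are square summable against the moments;
    density of polynomials then gives orthogonality. *)
Lemma symbol_projection (f : CF) : fock f -> exists2 g, fock g &
  forall k, fock k -> fock_dot (fun z => (V z)%:C * f z - g z) k = 0.
Proof.
move=> ff; have lf := fock_L2 ff; have lVf := symbol_L2 lf.
pose c n := qd f (fun z => z ^+ n) / (gauss_moment n)%:C.
have [m m0 fm] : exists2 m, 0 < m & forall z, nc z <= A -> nc (f z) <= m.
  have [K K0 HK] := fock_bounded_on_disc A0.
  exists (K * Num.sqrt (fock_norm2 f) + 1) => [|z zA].
    by rewrite ltr_wpDl// mulr_ge0 ?sqrtr_ge0// ltW.
  by rewrite (le_trans (HK f ff z zA))// lerDl.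
pose Q := 2 * (B * m * plane_int (fun p : R * R => disc_weight A (tc p))).
have disc_area0 : 0 <= plane_int (fun p : R * R => disc_weight A (tc p)) by apply: plane_int_ge0 => p; exact: disc_weight_ge0.
have Q0 : 0 <= Q by rewrite mulr_ge0// mulr_ge0// mulr_ge0// ltW.
have qb n : nc (qd f (fun z => z ^+ n)) <= Q * A ^+ n.
  have := @symbol_dot_sup f (fun z => z ^+ n) m (A ^+ n) lf (L2_mono n) (ltW m0) (exprn_ge0 _ A0) fm.
  rewrite (_ : 2 * _ = Q * A ^+ n); last by rewrite /Q; ring.
  by apply => z zA; rewrite normcX lerXn2r ?nnegrE ?normc_ge0.
have nC n : nc (gauss_moment n)%:C = gauss_moment n by rewrite normc_real ger0_norm// ltW// gauss_moment_gt0.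
have [K K0 HK] := coef_decay A0.
have cb n : nc (c n) ^+ 2 * gauss_moment n <= Q ^+ 2 * K ^+ 2 / 2 ^+ n.
  have g0 := gauss_moment_gt0 (R := R) n.
  have -> : nc (c n) ^+ 2 * gauss_moment n = nc (qd f (fun z => z ^+ n)) ^+ 2 / gauss_moment n.
    by rewrite Normc.normcM Normc.normcV nC; field; rewrite gt_eqF.
  pose x : R := (Num.sqrt (gauss_moment n))^-1.
  have x0 : 0 <= x by rewrite invr_ge0 sqrtr_ge0.
  have x2 : x ^+ 2 = (gauss_moment n)^-1 by rewrite exprVn sqr_sqrtr// ltW.
  have := HK n x 1 x0; rewrite x2 mulVf ?gt_eqF// => /(_ (lexx _)); rewrite sqrtr1 mul1r => hx.
  rewrite -x2 -exprMn (@le_trans _ _ ((Q * (K / 2 ^+ n)) ^+ 2))//.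
    rewrite lerXn2r ?nnegrE//.
    - by rewrite mulr_ge0 ?normc_ge0.
    - by rewrite mulr_ge0// divr_ge0 ?exprn_ge0// ltW.
    rewrite (le_trans (ler_wpM2r x0 (qb n)))// -mulrA ler_wpM2l// mulrC//.
  rewrite mulrA expr_div_n exprMn ler_wpM2l ?(mulr_ge0 (sqr_ge0 _) (sqr_ge0 _))//.
  by rewrite lef_pV2 ?posrE ?exprn_gt0// expr2 ler_peMl ?exprn_ge0// exprn_ege1// ler1n.
have [|g [fg gc ng]] := @fock_of_bounded_coefs R c (2 * (Q ^+ 2 * K ^+ 2)).
  move=> M; rewrite (@le_trans _ _ (\sum_(k < M) Q ^+ 2 * K ^+ 2 / 2 ^+ k))//.
    by apply: ler_sum => k _.
  rewrite -mulr_sumr mulrC ler_wpM2r ?(mulr_ge0 (sqr_ge0 _) (sqr_ge0 _))//.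
  suff -> : \sum_(i < M) (2 : R) ^- i = 2 - 2 / 2 ^+ M by rewrite gerBl divr_ge0// exprn_ge0.
  elim: (M) => [|n ih]; first by rewrite big_ord0 expr0 divr1 subrr.
  by rewrite big_ord_recr/= ih exprS; field; rewrite expf_neq0.
exists g => // k /fockP[lk [a ka]].
have lg := fock_L2 fg.
apply: (fock_dot_density (L2B lVf lg) _ ka lk) => n.
rewrite (fock_dotBl lVf lg (L2_mono n)) (fock_dot_coef n gc lg) /c divfK ?subrr//.
by rewrite -normc_eq0 nC gt_eqF// gauss_moment_gt0.
Qed.

Lemma toeplitzP (f : CF) : fock f -> fock (toeplitz V f) /\
  forall k, fock k -> fock_dot (fun z => (V z)%:C * f z - toeplitz V f z) k = 0.
Proof.
move=> ff; have [g fg gP] := symbol_projection ff.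
by apply: (@xgetPex _ (fun=> 0) [set g | fock g /\ forall k, fock k ->
  fock_dot (fun z => (V z)%:C * f z - g z) k = 0]); exists g.
Qed.

Lemma toeplitz_dot (f k : CF) : fock f -> fock k -> fock_dot (toeplitz V f) k = qd f k.
Proof.
move=> ff fk; have [fT /(_ k fk)] := toeplitzP ff.
rewrite (fock_dotBl (symbol_L2 (fock_L2 ff)) (fock_L2 fT) (fock_L2 fk)).
by move/eqP; rewrite subr_eq0 => /eqP <-.
Qed.

Lemma fock_eq_of_dot (f g : CF) : fock f -> fock g -> (forall k, fock k -> fock_dot f k = fock_dot g k) -> f = g.
Proof.
move=> ff fg H; have fd := fockB ff fg.
have lf := fock_L2 ff; have lg := fock_L2 fg; have ld := fock_L2 fd.
have : fock_norm2 (fun z => f z - g z) = 0.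
  by apply: complexI; rewrite -fock_dot_self// (fock_dotBl lf lg ld) H// subrr.
move=> /(fock_norm2_eq0 fd) E; apply/funext => z.
by have /(congr1 (fun h => h z))/eqP := E; rewrite subr_eq0 => /eqP.
Qed.

(** The eigenvalue equation in weak form, from which the projection has disappeared. *)
Lemma toeplitz_eigenP (mu : R) (f : CF) : fock f ->
  (forall z, toeplitz V f z = mu%:C * f z) <-> (forall k, fock k -> qd f k = mu%:C * fock_dot f k).
Proof.
move=> ff; have [fT _] := toeplitzP ff; have lf := fock_L2 ff; split.
  move=> H k fk; rewrite -(toeplitz_dot ff fk) -(fock_dotZl _ lf (fock_L2 fk)).
  by apply: (congr1 (fun h : CF => fock_dot h k)); apply/funext.
move=> H z; suff -> : toeplitz V f = (fun z => mu%:C * f z) by [].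
apply: fock_eq_of_dot => //; first exact: fockZ.
by move=> k fk; rewrite toeplitz_dot// H// (fock_dotZl _ lf (fock_L2 fk)).
Qed.

(* The form depends only on values on the disc of radius [A], where norm-bounded
   functions are controlled by finitely many coefficients: an ultrafilter limit of
   the coefficients of a maximising sequence is a maximiser. *)
Lemma max_principle (n : nat) (e : nat -> CF) (lam : nat -> R) (c : R) (l : CF) :
  (forall j, (j < n)%N -> [/\ fock (e j), lam j != 0 &
     forall k, fock k -> qd (e j) k = (lam j)%:C * fock_dot (e j) k]) ->
  0 < c -> fock l -> 0 < fock_norm2 l -> (forall j, (j < n)%N -> fock_dot l (e j) = 0) ->
  c * fock_norm2 l <= complex.Re (qd l l) ->
  exists f s, [/\ fock f, 0 < fock_norm2 f, c <= s, (forall j, (j < n)%N -> fock_dot f (e j) = 0) &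
    forall k, fock k -> qd f k = s%:C * fock_dot f k].
Proof.
move=> eP c0 fl l0 lperp lq.
pose q (f : CF) := complex.Re (qd f f).
have adj f j : (j < n)%N -> fock f -> qd f (e j) = (lam j)%:C * fock_dot f (e j).
  move=> jn ff; have [fe _ H] := eP _ jn.
  rewrite (symbol_dotC (fock_L2 fe) (fock_L2 ff)) H// (fock_dotC (fock_L2 ff) (fock_L2 fe)).
  by case: (fock_dot f (e j)) => x y; apply/eqP; rewrite eq_complex; apply/andP; split; apply/eqP => /=; ring.
have lamC j : (j < n)%N -> (lam j)%:C != 0.
  by move=> jn; have [_ ? _] := eP _ jn; rewrite -normc_eq0 normc_real normr_eq0.
have adj0 f j : (j < n)%N -> fock f -> qd f (e j) = 0 <-> fock_dot f (e j) = 0.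
  move=> jn ff; rewrite adj//; split => [/eqP|->]; last by rewrite mulr0.
  by rewrite mulf_eq0 (negbTE (lamC _ jn))/= => /eqP.
(* Orthogonality to the [e j] is expressed through [qd], which is continuous for uniform convergence
   on the disc, whereas [fock_dot] is not. The two conditions agree since [lam j] is nonzero. *)
pose W f := fock f /\ forall j, (j < n)%N -> qd f (e j) = 0.
have WZ (t : R[i]) f : W f -> W (fun z => t * f z).
  move=> [ff H]; split; first exact: fockZ.
  move=> j jn; have [fe _ _] := eP _ jn.
  by rewrite (symbol_dotZl _ (fock_L2 ff) (fock_L2 fe)) H// mulr0.
have qZ (t : R) f : fock f -> q (fun z => t%:C * f z) = t ^+ 2 * q f.
  move=> ff; have lf := fock_L2 ff; rewrite /q symbol_dotZl//; last exact: L2Z.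
  rewrite /symbol_dot fock_dotZr//; last exact: symbol_L2.
  by rewrite -/(qd f f) symbol_quad_real//= ; ring.
have nZ (t : R) f : fock f -> fock_norm2 (fun z => t%:C * f z) = t ^+ 2 * fock_norm2 f.
  by move=> ff; rewrite fock_norm2Z ?normc_real ?real_normK ?num_real//; exact: fock_L2.
have [K K0 HK] := fock_bounded_on_disc A0.
pose disc_area := plane_int (fun p : R * R => disc_weight A (tc p)).
have disc_area0 : 0 <= disc_area by apply: plane_int_ge0 => p; exact: disc_weight_ge0.
have qlt f : fock f -> fock_norm2 f <= 1 -> q f <= 2 * (B * (K * K) * disc_area).
  move=> ff f1; have fK z : nc z <= A -> nc (f z) <= K.
    move=> zA; rewrite (le_trans (HK f ff z zA))// ler_piMr ?(ltW K0)//.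
    by rewrite -sqrtr1 ler_sqrt// fock_norm2_ge0.
  have lf := fock_L2 ff.
  have := symbol_dot_sup lf lf (ltW K0) (ltW K0) fK fK.
  by apply: le_trans; rewrite (le_trans (ler_norm _))// normc_Re.
pose S := [set q f | f in [set f | W f /\ fock_norm2 f <= 1]].
have Sl : exists2 x, S x & c <= x.
  have t0 : 0 < Num.sqrt (fock_norm2 l) by rewrite sqrtr_gt0.
  exists (q (fun z => (Num.sqrt (fock_norm2 l))^-1%:C * l z)).
    exists (fun z => (Num.sqrt (fock_norm2 l))^-1%:C * l z) => //; split.
      by apply: WZ; split => // j jn; exact/adj0/lperp.
    by rewrite nZ// exprVn sqr_sqrtr ?(ltW l0)// mulVf// gt_eqF.
  rewrite qZ// exprVn sqr_sqrtr ?(ltW l0)// mulrC ler_pdivlMr//.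
have hs : has_sup S.
  split; first by have [x Sx _] := Sl; exists x.
  by exists (2 * (B * (K * K) * disc_area)) => _ [f [[ff _] f1] <-]; exact: qlt.
pose s := sup S.
have cs : c <= s by have [x Sx cx] := Sl; rewrite (le_trans cx)//; apply: ub_le_sup => //; case: hs.
have s0 : 0 < s by exact: lt_le_trans cs.
have seq (m : nat) : exists f a, [/\ W f, fock_norm2 f <= 1, expands f a & s - m.+1%:R^-1 < q f].
  have [|_ [f [Wf f1] <-] fq] := @sup_adherent _ S m.+1%:R^-1 _ hs; first by rewrite invr_gt0.
  by have [/fockP[_ [a fa]] _] := Wf; exists f, a.
have [F HF] := choice seq; have {HF} [a HF] := choice HF.
have aB m k : nc (a m k) ^+ 2 * gauss_moment k <= 1.
  have [[ff _] f1 fa _] := HF m.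
  by rewrite (le_trans _ f1)//; apply: coef_bessel fa (fock_L2 ff).
have [U [UU Uoo]] := ultraFilterLemma (F := \oo) _.
have UF : ProperFilter U by exact: ultra_proper.
have lim k : exists b, forall e, 0 < e -> U [set m | nc (a m k - b) <= e].
  apply: (@ultra_complex_limit R U (a^~ k) (Num.sqrt (gauss_moment k)^-1)) => m.
  rewrite -(@ler_pXn2r _ 2) ?nnegrE ?normc_ge0 ?sqrtr_ge0// sqr_sqrtr ?invr_ge0 ?(ltW (gauss_moment_gt0 _))//.
  by rewrite -[leRHS]mul1r ler_pdivlMr ?gauss_moment_gt0.
have [b bP] := choice lim.
have bS M : \sum_(k < M) nc (b k) ^+ 2 * gauss_moment k <= 1.
  apply/ler_addgt0Pr => d d0.
  pose G : R := \sum_(k < M) (2 * Num.sqrt (gauss_moment k)^-1 + 1) * gauss_moment k.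
  have nb k : nc (b k) <= Num.sqrt (gauss_moment k)^-1.
    apply/ler_addgt0Pr => x x0; have [m /= mx] := filter_ex (bP k _ x0).
    rewrite -[b k](subrK (a m k)) addrC (le_trans (le_normcD _ _))// lerD//; last by rewrite normcB.
    rewrite -(@ler_pXn2r _ 2) ?nnegrE ?normc_ge0 ?sqrtr_ge0// sqr_sqrtr ?invr_ge0 ?(ltW (gauss_moment_gt0 _))//.
    by rewrite -[leRHS]mul1r ler_pdivlMr ?gauss_moment_gt0.
  have G0 : 0 <= G.
    apply: sumr_ge0 => k _; apply: mulr_ge0; last exact/ltW/gauss_moment_gt0.
    by rewrite addr_ge0// mulr_ge0 ?sqrtr_ge0.
  pose x := Num.min 1 (d / (G + 1)).
  have x0 : 0 < x by rewrite lt_min ltr01 divr_gt0// ltr_wpDl.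
  have x1 : x <= 1 by rewrite ge_min lexx.
  have xd : x * G <= d.
    have : x <= d / (G + 1) by rewrite ge_min lexx orbT.
    rewrite ler_pdivlMr ?ltr_wpDl// => h; rewrite (le_trans _ h)// ler_wpM2l ?(ltW x0)// lerDl//.
  have UM : U [set m | forall k, (k < M)%N -> nc (a m k - b k) <= x].
    elim: (M) => [|j ih]; first by apply: filterS filterT.
    apply: filterS (filterI ih (bP j _ x0)) => m /= [h1 h2] k.
    by rewrite ltnS leq_eqVlt => /predU1P[->//|]; exact: h1.
  have [m /= mP] := filter_ex UM.
  have [[ff _] f1 fa _] := HF m.
  have h1 := bessel_expansion fa (fock_L2 ff) M.
  apply: le_trans (_ : \sum_(k < M) (nc (a m k) ^+ 2 * gauss_moment k + x * ((2 * Num.sqrt (gauss_moment k)^-1 + 1) * gauss_moment k)) <= _).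
    apply: ler_sum => k _; have g0 := gauss_moment_gt0 (R := R) k.
    rewrite mulrA -mulrDl ler_pM2r//.
    have h2 := mP k (ltn_ord k); have h3 := nb k; have h4 := normc_ge0 (a m k).
    have h5 : nc (b k) <= nc (a m k) + x.
      by rewrite -[b k](subrK (a m k)) addrC (le_trans (le_normcD _ _))// lerD// normcB.
    have h6 := normc_ge0 (b k).
    have h7 : nc (a m k) <= Num.sqrt (gauss_moment k)^-1.
      rewrite -(@ler_pXn2r _ 2) ?nnegrE ?normc_ge0 ?sqrtr_ge0// sqr_sqrtr ?invr_ge0 ?(ltW g0)//.
      by rewrite -[leRHS]mul1r ler_pdivlMr.
    have h8 : nc (b k) ^+ 2 <= (nc (a m k) + x) ^+ 2.
      by rewrite lerXn2r ?nnegrE ?addr_ge0// ltW.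
    rewrite (le_trans h8)//.
    move: h7 h4 x0 x1; move: (nc _) (Num.sqrt _) => u v h7 h4 x0 x1.
    have : x * u <= x * v by rewrite ler_wpM2l// ltW.
    have : x * x <= x * 1 by rewrite ler_wpM2l// ltW.
    by nra.
  by rewrite big_split/= -mulr_sumr lerD// (le_trans h1).
have [f0 [ff0 f0b nf0]] := fock_of_bounded_coefs bS.
have lf0 := fock_L2 ff0.
have [K' K'0 HK'] := fock_sup (R := R) A0.
have b1 k : nc (b k) ^+ 2 * gauss_moment k <= 1.
  rewrite (le_trans _ (bS k.+1))// big_ord_recr/= lerDr sumr_ge0// => j _.
  by rewrite mulr_ge0 ?exprn_ge0 ?normc_ge0// ltW// gauss_moment_gt0.
have close d : 0 < d -> U [set m | forall z, nc z <= A -> nc (F m z - f0 z) <= d].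
  move=> d0.
  have d4 : 0 < d / 4 by rewrite divr_gt0.
  have [M HM] : exists M : nat, K' / 2 ^+ M <= d / 4.
    apply: contrapT => /forallNP H.
    have : d / 4 <= 0 by apply: (@geo_small _ _ K') => M; rewrite leNgt; apply/negP => h; apply: (H M); exact: ltW.
    by rewrite leNgt d4.
  pose G : R := \sum_(k < M) A ^+ k.
  have G0 : 0 <= G by apply: sumr_ge0 => k _; exact: exprn_ge0.
  pose x := (d / 2) / (G + 1).
  have x0 : 0 < x by rewrite divr_gt0 ?divr_gt0// ltr_wpDl.
  have xd : x * G <= d / 2.
    have : x * (G + 1) = d / 2 by rewrite divfK// gt_eqF// ltr_wpDl.
    by have := x0; nra.
  have UM : U [set m | forall k, (k < M)%N -> nc (a m k - b k) <= x].
    elim: (M) => [|j ih]; first by apply: filterS filterT.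
    apply: filterS (filterI ih (bP j _ x0)) => m /= [h1 h2] k.
    by rewrite ltnS leq_eqVlt => /predU1P[->//|]; exact: h1.
  apply: filterS UM => m /= mP z zA.
  have [_ _ fa _] := HF m.
  have h1 := HK' _ _ fa 1 (aB m) z zA M.
  have h2 := HK' _ _ f0b 1 b1 z zA M.
  rewrite sqrtr1 mulr1 in h1 h2.
  have -> : F m z - f0 z = (F m z - \sum_(k < M) a m k * z ^+ k) - (f0 z - \sum_(k < M) b k * z ^+ k)
     + \sum_(k < M) (a m k - b k) * z ^+ k.
    have -> : \sum_(k < M) (a m k - b k) * z ^+ k = \sum_(k < M) a m k * z ^+ k - \sum_(k < M) b k * z ^+ k.
      by rewrite -sumrB; apply: eq_bigr => k _; rewrite mulrBl.
    by ring.
  have h3 : nc (\sum_(k < M) (a m k - b k) * z ^+ k) <= d / 2.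
    rewrite (le_trans (normc_sum _ _ _))// (le_trans _ xd)// mulr_sumr ler_sum// => k _.
    rewrite Normc.normcM normcX ler_pM ?normc_ge0 ?exprn_ge0 ?normc_ge0//; first exact: mP.
    by rewrite lerXn2r ?nnegrE ?normc_ge0.
  have h4 := le_normcD (F m z - \sum_(k < M) a m k * z ^+ k) (- (f0 z - \sum_(k < M) b k * z ^+ k)).
  rewrite normcN in h4.
  rewrite (le_trans (le_normcD _ _))//.
  by move: h1 h2 h3 h4 HM; lra.
have fK f : fock f -> fock_norm2 f <= 1 -> forall z, nc z <= A -> nc (f z) <= K.
  move=> ff f1 z zA; rewrite (le_trans (HK f ff z zA))// ler_piMr ?(ltW K0)//.
  by rewrite -sqrtr1 ler_sqrt// fock_norm2_ge0.
have Wf0 : W f0.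
  split => // j jn; have [fe _ _] := eP _ jn.
  have small (x : R[i]) : (forall d, 0 < d -> nc x <= d) -> x = 0.
    move=> H; apply/eqP; rewrite -normc_eq0 eq_le normc_ge0 andbT.
    by apply/ler_addgt0Pr => d d0; rewrite add0r H.
  apply: small => d d0.
  pose Ke := K * Num.sqrt (fock_norm2 (e j)).
  have Ke0 : 0 <= Ke by rewrite mulr_ge0 ?sqrtr_ge0// ltW.
  pose C := 2 * (B * Ke * disc_area).
  have C0 : 0 <= C by rewrite mulr_ge0// mulr_ge0// mulr_ge0.
  have x0 : 0 < d / (C + 1) by rewrite divr_gt0// ltr_wpDl.
  have [m mP] : exists m, forall z, nc z <= A -> nc (F m z - f0 z) <= d / (C + 1) := filter_ex (close _ x0).
  have [[ff Wf] f1 _ _] := HF m; have lF := fock_L2 ff.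
  have -> : qd f0 (e j) = - qd (fun z => F m z - f0 z) (e j).
    by rewrite (symbol_dotBl lF lf0 (fock_L2 fe)) Wf// sub0r opprK.
  rewrite normcN.
  have := symbol_dot_sup (L2B lF lf0) (fock_L2 fe) (ltW x0) Ke0 mP (HK _ fe).
  move=> /le_trans; apply.
  have -> : 2 * (B * (d / (C + 1) * Ke) * plane_int (fun p => disc_weight A (tc p))) = d * (C / (C + 1)).
    by rewrite /C /disc_area; field; rewrite gt_eqF// ltr_wpDl.
  by rewrite ler_piMr ?(ltW d0)// ler_pdivrMr ?ltr_wpDl// mul1r lerDl.
have qf0 : s <= q f0.
  apply/ler_addgt0Pr => d d0.
  pose C := 4 * (B * K * disc_area).
  have C0 : 0 <= C by rewrite mulr_ge0// mulr_ge0// mulr_ge0// ltW.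
  pose x := (d / 2) / (C + 1).
  have x0 : 0 < x by rewrite divr_gt0 ?divr_gt0// ltr_wpDl.
  have xC : x * C <= d / 2.
    have : x * (C + 1) = d / 2 by rewrite divfK// gt_eqF// ltr_wpDl.
    by have := x0; nra.
  have Ut : U [set m | (Num.truncn (2 / d) <= m)%N] by apply: Uoo; exact: nbhs_infty_ge.
  have [m /= [mP mt]] := filter_ex (filterI (close _ x0) Ut).
  have [[ff Wf] f1 _ sq] := HF m; have lF := fock_L2 ff.
  have ld := L2B lF lf0.
  have h1 := symbol_dot_sup ld lF (ltW x0) (ltW K0) mP (fK _ ff f1).
  have h2 := symbol_dot_sup lf0 ld (ltW K0) (ltW x0) (fK _ ff0 nf0) mP.
  have E : q (F m) - q f0 = complex.Re (qd (fun z => F m z - f0 z) (F m)) + complex.Re (qd f0 (fun z => F m z - f0 z)).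
    rewrite (symbol_dotBl lF lf0 lF) (symbol_dotBr lF lf0 lf0) /q.
    by case: (qd (F m) (F m)) (qd f0 f0) (qd f0 (F m)) => ? ? [] ? ? [] ? ? /=; ring.
  have h3 := le_trans (ler_norm _) (le_trans (normc_Re _) h1).
  have h4 := le_trans (ler_norm _) (le_trans (normc_Re _) h2).
  have h5 : m.+1%:R^-1 <= d / 2.
    rewrite -[d / 2]invrK lef_pV2 ?posrE ?invr_gt0 ?divr_gt0//.
    by rewrite invf_div (le_trans (ltW (truncnS_gt _)))// ler_nat.
  have h6 : 2 * (B * (x * K) * disc_area) + 2 * (B * (K * x) * disc_area) = x * C by rewrite /C; ring.
  have := lerD h3 h4; rewrite -E -/disc_area h6; move: sq h5 xC; clear.
  by move: (q (F m)) (q f0) (m.+1%:R^-1) (x * C) => *; lra.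
have qs f : W f -> q f <= s * fock_norm2 f.
  move=> [ff Wf]; have [f00|fn0] := eqVneq (fock_norm2 f) 0.
    rewrite f00 mulr0 (fock_norm2_eq0 ff f00) /q /symbol_dot.
    by under eq_fun do rewrite mulr0; rewrite fock_dot0l.
  have fp : 0 < fock_norm2 f by rewrite lt_def fn0 fock_norm2_ge0.
  rewrite -ler_pdivrMr// mulrC.
  have -> : (fock_norm2 f)^-1 * q f = q (fun z => (Num.sqrt (fock_norm2 f))^-1%:C * f z).
    by rewrite qZ// exprVn sqr_sqrtr// ltW.
  apply: ub_le_sup; first by case: hs.
  exists (fun z => (Num.sqrt (fock_norm2 f))^-1%:C * f z) => //; split; first exact: WZ.
  by rewrite nZ// exprVn sqr_sqrtr ?(ltW fp)// mulVf.
have [g fg gP] := symbol_projection ff0.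
have lg := fock_L2 fg.
have gdot k : fock k -> fock_dot g k = qd f0 k.
  move=> fk; have := gP k fk.
  rewrite (fock_dotBl (symbol_L2 lf0) lg (fock_L2 fk)).
  by move/eqP; rewrite subr_eq0 => /eqP <-.
(* Here [g] is the projection of V f0, so [k] is the defect in the eigenvalue equation; it lies in
   [W] because [f0] does. *)
pose k z := g z - s%:C * f0 z.
have fsf := fockZ s%:C ff0.
have fk : fock k by exact: fockB.
have lk := fock_L2 fk.
have kdot h : fock h -> fock_dot k h = qd f0 h - s%:C * fock_dot f0 h.
  by move=> fh; rewrite (fock_dotBl lg (fock_L2 fsf) (fock_L2 fh)) gdot// (fock_dotZl _ lf0 (fock_L2 fh)).
have perp0 j : (j < n)%N -> fock_dot f0 (e j) = 0 by move=> jn; exact: (proj1 (adj0 f0 j jn ff0) (Wf0.2 j jn)).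
have Wk : W k.
  split => // j jn; apply/adj0 => //; have [fe _ _] := eP _ jn.
  by rewrite kdot// perp0// (Wf0.2 j jn) mulr0 subr0.
have k0 : fock_norm2 k = 0.
  have quad (x y : R) : (forall t, 2 * t * x + t ^+ 2 * y <= 0) -> x = 0.
    move=> H; apply/eqP; rewrite -sqrf_eq0 eq_le sqr_ge0 andbT.
    have y1 : 0 < `|y| + 1 by rewrite ltr_wpDl.
    have := H (x / (`|y| + 1)).
    have -> : 2 * (x / (`|y| + 1)) * x + (x / (`|y| + 1)) ^+ 2 * y = x ^+ 2 * ((2 * (`|y| + 1) + y) / (`|y| + 1) ^+ 2).
      by field; rewrite gt_eqF.
    rewrite pmulr_lle0// divr_gt0 ?exprn_gt0//.
    by have := lerNnormlW (lexx `|y|); have := normr_ge0 y; lra.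
  apply: (@quad _ (q k - s * fock_norm2 k)) => t.
  (* First variation of q - s ||.||^2 in the direction [k]: this quantity is nonpositive on [W] and
     nonnegative at [f0], so its linear coefficient, which is 2 ||k||^2, vanishes. *)
  pose h z := f0 z + t%:C * k z.
  have ftk := fockZ t%:C fk; have ltk := fock_L2 ftk.
  have Wh : W h.
    split; first exact: fockD.
    move=> j jn; have [fe _ _] := eP _ jn; have le := fock_L2 fe.
    by rewrite (symbol_dotDl lf0 ltk le) Wf0.2// (symbol_dotZl _ lk le) Wk.2// mulr0 addr0.
  have := qs h Wh.
  rewrite /q (symbol_quadD lf0 ltk) -!/(q _) (fock_norm2D lf0 ltk) qZ// nZ//.
  rewrite [qd f0 _]fock_dotZr//; last exact: symbol_L2.
  rewrite -/(qd f0 k) fock_dotZr//.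
  have -> : fock_norm2 k = complex.Re (fock_dot k k) by rewrite fock_dot_self.
  rewrite kdot//.
  have le0 := qs f0 Wf0; have le1 : s * fock_norm2 f0 <= s by rewrite ler_piMr// ltW.
  have R1 (u : R[i]) : complex.Re (t%:C^* * u) = t * complex.Re u.
    by case: u => u1 u2 /=; ring.
  have R2 (u v : R[i]) : complex.Re (u - s%:C * v) = complex.Re u - s * complex.Re v.
    by case: u v => u1 u2 [v1 v2] /=; ring.
  rewrite !R1 !R2; move: le0 le1 qf0; clear.
  by move: (q f0) (q k) (fock_norm2 f0) (complex.Re _) (complex.Re _) => *; lra.
have gE : g = (fun z => s%:C * f0 z).
  by apply/funext => z; have /(congr1 (fun h => h z))/eqP := fock_norm2_eq0 fk k0; rewrite subr_eq0 => /eqP.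
exists f0, s; split => //.
- rewrite lt_def fock_norm2_ge0 andbT; apply/eqP => f00.
  have := qs f0 Wf0; rewrite f00 mulr0; have := qf0; move: s0; lra.
- by move=> h fh; rewrite -gdot// gE (fock_dotZl _ lf0 (fock_L2 fh)).
Qed.

End ToeplitzSpectral.

(** * Eigenfunctions indexed by the enumeration *)

Section EigenFamily.
Context {R : realType}.
Local Notation CF := (R[i]^o -> R[i]^o).

(** Places the zero function in the eigenspaces, where uniqueness of its coordinates gives linear
    independence. *)
Lemma fock_proj0 : fock_proj (fun=> 0 : R[i]^o) = (fun=> 0).
Proof.
have L0 : L2 (fun=> 0 : R[i]^o) := L2_0.
have [] := @xgetPex _ (fun=> 0) [set g : CF | fock g /\ forall k, fock k -> fock_dot (fun z => 0 - g z) k = 0].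
  exists (fun=> 0); split; first exact: fock_0.
  by move=> k fk; under eq_fun do rewrite subr0; rewrite fock_dot0l.
rewrite -/(fock_proj (fun=> 0)); set g := fock_proj _ => fg gP.
have lg := fock_L2 fg; apply: fock_norm2_eq0 => //; apply: complexI; rewrite -fock_dot_self//.
by have := gP g fg; rewrite (fock_dotBl L0 lg lg) fock_dot0l sub0r => /eqP; rewrite oppr_eq0 => /eqP.
Qed.

(* [e n] is an eigenfunction for [lam n]; for each [mu] the [e n] with [lam n = mu]
   form a basis of the eigenspace. *)
Lemma eigen_family (V : R[i]^o -> R) (lam : nat -> R) : positive_eigenvalues V lam ->
  exists e : nat -> CF,
    [/\ forall n, (0 < n)%N -> 0 < lam n -> toeplitz_eigenspace V (lam n) (e n),
      forall mu f, 0 < mu -> toeplitz_eigenspace V mu f -> exists k (idx : 'I_k -> nat) (c : 'I_k -> R[i]),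
        (forall i, (0 < idx i)%N /\ lam (idx i) = mu) /\
        forall z, f z = \sum_(i < k) c i * e (idx i) z &
      forall mu N (d : nat -> R[i]), 0 < mu ->
        (forall n, d n != 0 -> (0 < n)%N /\ lam n = mu) ->
        (forall z, \sum_(n < N) d n * e n z = 0) -> forall n, (n < N)%N -> d n = 0].
Proof.
move=> [_ _ H].
pose A mu := [set n | (0 < n)%N /\ lam n = mu].
have {}H mu : exists b : nat -> CF, 0 < mu ->
  [/\ forall n, A mu n -> toeplitz_eigenspace V mu (b n),
    forall f, toeplitz_eigenspace V mu f -> exists k (idx : 'I_k -> nat) (c : 'I_k -> R[i]),
        (forall i, A mu (idx i)) /\ forall z, f z = \sum_(i < k) c i * b (idx i) z &
    forall N (d : nat -> R[i]), (forall n, d n != 0 -> A mu n) ->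
        (forall z, \sum_(n < N) d n * b n z = 0) -> forall n, (n < N)%N -> d n = 0].
  have [mu0|] := ltP 0 mu; last by move=> mu0; exists (fun _ _ => 0).
  have [k [b [bE bU]] /card_set_bijP[g [gI ginj gsurj]]] := H mu mu0.
  (* Only indices with [lam n = mu] matter; elsewhere the value of [g n], and hence [eb n], is
     arbitrary. *)
  pose eb n : CF := if insub (g n) is Some i then b i else fun=> 0.
  have ebE n (i : 'I_k) : g n = i -> eb n = b i by move=> gi; rewrite /eb gi valK.
  have ord n : A mu n -> exists i : 'I_k, g n = i.
    by move=> An; have /= gk := gI n An; exists (Ordinal gk).
  exists eb => _; split.
  - by move=> n /ord[i /ebE ->].
  - move=> f /bU[c [fc _]].
    have sel (i : 'I_k) : exists n, A mu n /\ g n = i.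
      by have [n An gn] := gsurj i (ltn_ord i); exists n.
    have [idx idxP] := choice sel.
    exists k, idx, (c 0); split; first by move=> i; have [] := idxP i.
    by move=> z; rewrite fc; apply: eq_bigr => i _; rewrite (ebE _ i)//; have [] := idxP i.
  move=> N d dA d0 n nN.
  apply/eqP; apply: contraT => dn.
  have An := dA n dn; have [i gi] := ord n An.
  have k0 : (0 < k)%N by exact: leq_ltn_trans (ltn_ord i).
  pose gk m : 'I_k := insubd i (g m).
  have gkE m : A mu m -> gk m = g m :> nat.
    by move=> Am; rewrite val_insubd; have /= -> := gI m Am.
  pose C : 'rV[R[i]]_k := \row_j \sum_(m < N | (d m != 0) && (gk m == j)) d m.
  have E0 : toeplitz_eigenspace V mu (fun=> 0).
    have [cf _] := bE i; have [fb] := bE i.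
    rewrite (_ : (fun=> 0) = (fun z => 0 * b i z)); last by apply/funext => z; rewrite mul0r.
    move=> H'; split; first exact: fockZ.
    move=> z; rewrite /toeplitz mul0r mulr0.
    have -> : (fun z => (V z)%:C * (0 * b i z)) = (fun=> 0).
      by apply/funext => y; rewrite mul0r mulr0.
    by rewrite fock_proj0.
  (* Grouping a relation by basis vectors gives coordinates [C] of the zero function. They vanish by
     uniqueness, and injectivity of [g] leaves the single term [d n] in one of them. *)
  have [c0 [c0P c0u]] := bU _ E0.
  have Cc : c0 = C.
    apply: c0u => z; apply: etrans (esym (d0 z)) _.
    rewrite (bigID (fun m : 'I_N => d m != 0))/= [X in _ + X]big1 ?addr0; last first.
      by move=> m /negbNE/eqP ->; rewrite mul0r.
    rewrite (partition_big (fun m : 'I_N => gk m) xpredT)//=.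
    apply: eq_bigr => j _; rewrite mxE big_distrl/=; apply: eq_bigr => m /andP[dm /eqP mj].
    by rewrite (ebE _ j)// -mj gkE//; exact: dA.
  have c00 : c0 = 0 by apply: c0u => z; rewrite big1// => j _; rewrite mxE mul0r.
  have : C 0 (gk n) = 0 by rewrite -Cc c00 mxE.
  rewrite mxE (bigD1 (Ordinal nN)) ?dn ?eqxx//= big1 ?addr0 => [/eqP|m].
    by rewrite (negbTE dn).
  move=> /andP[/andP[dm /eqP gmn] mn].
  have : (m : nat) = n.
    apply: ginj; rewrite ?inE; [exact: dA|exact: An|].
    by rewrite -gkE ?gmn ?gkE//; exact: dA.
  by move=> mE; case/negP: mn; apply/eqP/val_inj.
have [b bP] := choice H.
exists (fun n => b (lam n) n); split.
- by move=> n n0 l0; have [h _ _] := bP _ l0; exact: h.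
- move=> mu f mu0 /((let: And3 _ h _ := bP mu mu0 in h) f)[k [idx [c [iA fE]]]].
  exists k, idx, c; split => // z; rewrite fE; apply: eq_bigr => i _.
  by have [_ ->] := iA i.
- move=> mu N d mu0 dA d0 n nN; have [_ _ h] := bP mu mu0.
  apply: (h N d dA) nN => z; apply: etrans (d0 z); apply: eq_bigr => m _.
  by have [->|/dA[_ ->]//] := eqVneq (d m) 0; rewrite !mul0r.
Qed.

End EigenFamily.

(** * Variational bounds for the eigenvalues *)

Section SpectralBounds.
Context {R : realType}.
Local Notation nc := (@Normc.normc R).
Local Notation tc := (@to_complex R).
Local Notation CF := (R[i]^o -> R[i]^o).

Lemma left_kernel (F : fieldType) (m n : nat) (M : 'M[F]_(m, n)) : (n < m)%N ->
  exists2 x : 'rV_m, x != 0 & x *m M = 0.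
Proof.
move=> nm; have : kermx M != 0.
  by rewrite -mxrank_eq0 mxrank_ker subn_eq0 -ltnNge (leq_ltn_trans (rank_leq_col M)).
by move/rowV0Pn => [x /sub_kermxP xM x0]; exists x.
Qed.

Lemma fock_dot_sum2 (F G : nat -> CF) (a b : nat -> R[i]) M N :
  (forall j, (j < M)%N -> L2 (F j)) -> (forall j, (j < N)%N -> L2 (G j)) ->
  fock_dot (fun z => \sum_(i < M) a i * F i z) (fun z => \sum_(j < N) b j * G j z) =
  \sum_(i < M) \sum_(j < N) a i * (b j)^* * fock_dot (F i) (G j).
Proof.
move=> LF LG.
have LFa j : (j < M)%N -> L2 (fun z => a j * F j z) by move=> jM; exact/L2Z/LF.
have LGb j : (j < N)%N -> L2 (fun z => b j * G j z) by move=> jN; exact/L2Z/LG.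
have LS := L2_sum LGb.
rewrite (fock_dot_suml LFa LS); apply: eq_bigr => i _.
have Li := LF i (ltn_ord i).
rewrite (fock_dotZl _ Li LS) (fock_dotC LS Li) (fock_dot_suml LGb Li) rmorph_sum mulr_sumr.
apply: eq_bigr => j _; have Lj := LG j (ltn_ord j).
by rewrite [in RHS](fock_dotC Lj Li) (fock_dotZl _ Lj Li) rmorphM mulrA.
Qed.

Variables (V : R[i]^o -> R) (B A : R).
Hypotheses (mV : mfun (fun p => V (tc p))) (VB : forall z, `|V z| <= B)
  (A0 : 0 <= A) (V_supp : forall z, A < nc z -> V z = 0).
Local Notation qd := (symbol_dot V).

Lemma eigen_orthogonal (f g : CF) (s t : R) : fock f -> fock g ->
  (forall k, fock k -> qd f k = s%:C * fock_dot f k) ->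
  (forall k, fock k -> qd g k = t%:C * fock_dot g k) -> s != t -> fock_dot f g = 0.
Proof.
move=> ff fg Hf Hg st; have lf := fock_L2 ff; have lg := fock_L2 fg.
have := symbol_dotC mV VB lf lg; rewrite Hf// Hg// (fock_dotC lf lg).
move: (fock_dot f g) => [x y] [h1 h2].
apply/eqP; rewrite eq_complex/=.
have d0 : s - t != 0 by rewrite subr_eq0.
by apply/andP; split; rewrite -(mulrI_eq0 _ (mulfI d0)); apply/eqP; move: h1 h2; lra.
Qed.

Lemma symbol_dot_eigen_sum (e : nat -> CF) (lam : nat -> R) (d : nat -> R[i]) (k : CF) M : fock k ->
  (forall i, (i < M)%N -> fock (e i) /\ forall h, fock h -> qd (e i) h = (lam i)%:C * fock_dot (e i) h) ->
  qd (fun z => \sum_(i < M) d i * e i z) k = fock_dot (fun z => \sum_(i < M) ((lam i)%:C * d i) * e i z) k.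
Proof.
move=> fk; have lk := fock_L2 fk; elim: M => [_|M ih H].
  rewrite /symbol_dot; under eq_fun do rewrite big_ord0 mulr0.
  by rewrite fock_dot0l; under eq_fun do rewrite big_ord0; rewrite fock_dot0l.
have H' i : (i < M)%N -> fock (e i) /\ forall h, fock h -> qd (e i) h = (lam i)%:C * fock_dot (e i) h.
  by move=> iM; apply: H; exact: ltnW.
have [/fock_L2 lM eM] := H M (ltnSn M).
have LS (c : nat -> R[i]) : L2 (fun z => \sum_(i < M) c i * e i z).
  by apply: (@L2_sum R (fun i z => c i * e i z)) => i iM; apply: L2Z; have [/fock_L2] := H' i iM.
have -> : (fun z => \sum_(i < M.+1) d i * e i z) = (fun z => \sum_(i < M) d i * e i z + d M * e M z).
  by apply/funext => z; rewrite big_ord_recr.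
rewrite (symbol_dotDl mV VB (LS d) (L2Z _ lM) lk) (symbol_dotZl mV VB _ lM lk) ih// eM//.
have -> : (fun z => \sum_(i < M.+1) (lam i)%:C * d i * e i z) =
    (fun z => \sum_(i < M) (lam i)%:C * d i * e i z + (lam M)%:C * d M * e M z).
  by apply/funext => z; rewrite big_ord_recr.
rewrite (fock_dotDl (LS (fun i => (lam i)%:C * d i)) (L2Z _ lM) lk) (fock_dotZl _ lM lk).
by rewrite [d M * _]mulrCA mulrA.
Qed.

Section Enumerated.
Variables (e : nat -> CF) (lam : nat -> R) (n : nat).
Hypotheses (n0 : (0 < n)%N) (lamn : 0 < lam n)
  (lam_mono : forall i j, (0 < i)%N -> (i <= j)%N -> lam j <= lam i)
  (eE : forall i, (0 < i)%N -> 0 < lam i -> toeplitz_eigenspace V (lam i) (e i))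
  (eU : forall mu N (d : nat -> R[i]), 0 < mu ->
        (forall n, d n != 0 -> (0 < n)%N /\ lam n = mu) ->
        (forall z, \sum_(n < N) d n * e n z = 0) -> forall n, (n < N)%N -> d n = 0).

Let eS j : (j < n)%N -> fock (e j.+1) /\
  forall h, fock h -> qd (e j.+1) h = (lam j.+1)%:C * fock_dot (e j.+1) h.
Proof.
move=> jn; have [fe H] : toeplitz_eigenspace V (lam j.+1) (e j.+1).
  by apply: eE => //; exact: lt_le_trans lamn (lam_mono _ jn).
by split => //; exact/(toeplitz_eigenP mV VB A0 V_supp _ fe).
Qed.

Let eL j : (j < n)%N -> L2 (e j.+1). Proof. by move=> /eS[/fock_L2]. Qed.

Let eO i j : (i < n)%N -> (j < n)%N -> lam i.+1 != lam j.+1 -> fock_dot (e i.+1) (e j.+1) = 0.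
Proof. by move=> /eS[fi ei] /eS[fj ej] /(eigen_orthogonal fi fj ei ej). Qed.

(** Within one eigenspace the [e j] need not be orthogonal, so the form is not diagonal in them.
    Still q(f) - lam_n ||f||^2 = ||g||^2, where the coefficients of [g] carry the factors sqrt(lam_j
    - lam_n): cross terms survive only between equal eigenvalues, whose factors agree. *)
Lemma eigen_span_lower (d : nat -> R[i]) (f : CF) : (forall z, f z = \sum_(i < n) d i * e i.+1 z) ->
  lam n * fock_norm2 f <= complex.Re (qd f f).
Proof.
move=> /funext ->; set f0 := (fun z => _).
pose a j : R := Num.sqrt (lam j.+1 - lam n).
have L (c : nat -> R[i]) : L2 (fun z => \sum_(i < n) c i * e i.+1 z).
  by apply: (@L2_sum R (fun i z => c i * e i.+1 z)) => i /eL; exact: L2Z.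
have ff : fock f0 by apply: (@fock_sum R (fun i z => d i * e i.+1 z)) => i /eS[fe _]; exact: fockZ.
have lf := L d.
pose g : CF := fun z => \sum_(i < n) ((a i)%:C * d i) * e i.+1 z.
have CM (x y : R) : (x * y)%:C = x%:C * y%:C by rewrite rmorphM.
have CB (x y : R) : (x - y)%:C = x%:C - y%:C by rewrite rmorphB.
have key (p q r s : R) (x y w : R[i]) : p%:C * q%:C = r%:C - s%:C ->
    r%:C * x * y^* * w = p%:C * x * (q%:C * y)^* * w + s%:C * (x * y^* * w).
  rewrite -CM -CB => /complexI h; have -> : r = p * q + s by rewrite h subrK.
  by case: x y w => ? ? [? ?] [? ?]; apply/eqP; rewrite eq_complex; apply/andP; split; apply/eqP => /=; ring.
have E : qd f0 f0 = (fock_norm2 g)%:C + (lam n * fock_norm2 f0)%:C.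
  rewrite (symbol_dot_eigen_sum (e := fun i => e i.+1) (lam := fun i => lam i.+1) d ff eS) (CM (lam n)).
  rewrite -fock_dot_self; last exact: (L (fun i => (a i)%:C * d i)).
  rewrite -fock_dot_self// (fock_dot_sum2 (fun i => (lam i.+1)%:C * d i) d eL eL).
  rewrite (fock_dot_sum2 (fun i => (a i)%:C * d i) (fun i => (a i)%:C * d i) eL eL).
  rewrite (fock_dot_sum2 d d eL eL) mulr_sumr -big_split; apply: eq_bigr => i _ /=.
  rewrite mulr_sumr -big_split; apply: eq_bigr => j _ /=.
  have [ij|/(eO (ltn_ord i) (ltn_ord j)) ->] := eqVneq (lam i.+1) (lam j.+1); last by rewrite !mulr0 addr0.
  have aa : (a i)%:C * (a j)%:C = (lam i.+1)%:C - (lam n)%:C.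
    rewrite -CM -CB; congr (_%:C).
    by rewrite /a ij -expr2 sqr_sqrtr// subr_ge0; exact: lam_mono.
  exact: key aa.
rewrite E /= lerDr; exact: fock_norm2_ge0.
Qed.

(** Isolate the part [f] of the combination belonging to the eigenvalue [mu]. The rest is orthogonal
    to it, so ||f||^2 is the inner product of the whole combination with [f], which is 0;
    independence in one eigenspace concludes. *)
Lemma eigen_span_free (d : nat -> R[i]) : (forall z, \sum_(i < n) d i * e i.+1 z = 0) ->
  forall i, (i < n)%N -> d i = 0.
Proof.
move=> d0 j jn; pose mu := lam j.+1.
have mu0 : 0 < mu by exact: lt_le_trans lamn (lam_mono _ jn).
pose dm i : R[i] := if lam i.+1 == mu then d i else 0.
pose f : CF := fun z => \sum_(i < n) dm i * e i.+1 z.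
have ff : fock f by apply: (@fock_sum R (fun i z => dm i * e i.+1 z)) => i /eS[fe _]; exact: fockZ.
have f0 : fock_norm2 f = 0.
  apply: complexI; rewrite -fock_dot_self; last exact: fock_L2.
  transitivity (fock_dot (fun z => \sum_(i < n) d i * e i.+1 z) f); last first.
    by under eq_fun do rewrite d0; rewrite fock_dot0l.
  rewrite (fock_dot_sum2 dm dm eL eL) (fock_dot_sum2 d dm eL eL).
  apply: eq_bigr => i _; apply: eq_bigr => k _.
  have [ij|/(eO (ltn_ord i) (ltn_ord k)) ->] := eqVneq (lam i.+1) (lam k.+1); last by rewrite !mulr0.
  rewrite /dm ij; case: ifP => // _.
  by case: (fock_dot _ _) (d i) => ? ? [? ?]; apply/eqP; rewrite eq_complex; apply/andP; split; apply/eqP => /=; ring.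
(* Eigenvalues are numbered from 1, sums from 0: a zero coefficient is inserted at index 0. *)
pose d' i : R[i] := if (0 < i)%N then dm i.-1 else 0.
have := @eU mu n.+1 d' mu0 _ _ j.+1; rewrite /d' /dm/= eqxx; apply => //.
  move=> m; case: m => [|m]/=; first by rewrite eqxx.
  by case: (eqVneq (lam m.+1) mu) => // _ /eqP.
move=> z; rewrite big_ord_recl/= mul0r add0r.
have := fock_norm2_eq0 ff f0 => /(congr1 (fun h => h z)); rewrite /f => fz.
by apply: etrans fz; apply: eq_bigr.
Qed.

End Enumerated.

(** If lam_n < c, let [k] be the first index with lam_k < c. Some combination of the n functions
    [L i] is orthogonal to e_1, ..., e_(k-1), and [max_principle] yields an eigenfunction orthogonal
    to them with eigenvalue s >= c. The enumeration places its eigenspace in their span, so it is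
    orthogonal to itself. *)
Lemma eigenvalue_lower_bound (lam : nat -> R) (n : nat) (c : R) (L : nat -> CF) :
  positive_eigenvalues V lam -> (0 < n)%N -> 0 < c -> (forall i, (i < n)%N -> fock (L i)) ->
  (forall x : nat -> R[i], (exists2 i, (i < n)%N & x i != 0) ->
    let l z := \sum_(i < n) x i * L i z in 0 < fock_norm2 l /\ c * fock_norm2 l <= complex.Re (qd l l)) ->
  c <= lam n.
Proof.
move=> HE n0 c0 fL HL; rewrite leNgt; apply/negP => lc.
have exk : exists k, (0 < k)%N && (lam k < c) by exists n; rewrite n0.
case: (ex_minnP exk) => k /andP[k0 lk] kmin.
have kn : (k <= n)%N by apply: kmin; rewrite n0.
have lbig j : (j < k.-1)%N -> c <= lam j.+1.
  move=> jk; rewrite leNgt; apply/negP => h.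
  by have := kmin j.+1 h; lia.
have [lam0 lam_mono _] := HE.
have [e [eE eB eU]] := eigen_family HE.
have eS j : (j < k.-1)%N -> [/\ fock (e j.+1), lam j.+1 != 0 &
  forall h, fock h -> qd (e j.+1) h = (lam j.+1)%:C * fock_dot (e j.+1) h].
  move=> jk; have lp : 0 < lam j.+1 by exact: lt_le_trans (lbig j jk).
  have [fe H] := eE j.+1 isT lp.
  split => //; first by rewrite gt_eqF.
  exact/(toeplitz_eigenP mV VB A0 V_supp _ fe).
have [|x x0 xM] := @left_kernel _ n k.-1 (\matrix_(i, j) fock_dot (L i) (e j.+1)); first by lia.
pose y (i : nat) : R[i] := if insub i is Some i' then x 0 i' else 0.
have yE (i : 'I_n) : y i = x 0 i by rewrite /y valK.
pose l : CF := fun z => \sum_(i < n) y i * L i z.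
have [|l0 lq] := HL y.
  have [i xi] : exists i, x 0 i != 0 by apply/rV0Pn.
  by exists i => //; rewrite yE.
have fl : fock l by apply: (@fock_sum R (fun i z => y i * L i z)) => i /fL; exact: fockZ.
have lperp j : (j < k.-1)%N -> fock_dot l (e j.+1) = 0.
  move=> jk; have [fe _ _] := eS j jk; have le := fock_L2 fe.
  have LL i : (i < n)%N -> L2 (fun z => y i * L i z) by move=> /fL/fock_L2; exact: L2Z.
  rewrite /l (fock_dot_suml LL le).
  have /(congr1 (fun M : 'rV_k.-1 => M 0 (Ordinal jk))) := xM.
  rewrite !mxE => h; apply: etrans h; apply: eq_bigr => i _; rewrite mxE/=.
  by rewrite (fock_dotZl _ (fock_L2 (fL i (ltn_ord i))) le) yE.
have [f [s [ff f0 cs fperp fS]]] :=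
  max_principle mV VB A0 V_supp (lam := fun j => lam j.+1) eS c0 fl l0 lperp lq.
have [|m [idx [a [iP fE]]]] := eB s f (lt_le_trans c0 cs).
  by split => //; exact/(toeplitz_eigenP mV VB A0 V_supp _ ff).
have lf := fock_L2 ff.
(* An index with eigenvalue s >= c > lam_k precedes [k] by monotonicity. *)
have idxk i : exists2 j, (j < k.-1)%N & idx i = j.+1.
  have [i0 li] := iP i.
  have : (idx i < k)%N.
    rewrite ltnNge; apply/negP => ki; have := lam_mono k (idx i) k0 ki.
    by rewrite li => /(le_trans cs) h; move: lk; rewrite ltNge h.
  by move=> ik; exists (idx i).-1; rewrite ?prednK// -ltnS !prednK.
have : fock_norm2 f = 0; last by move/eqP; rewrite gt_eqF.
apply: complexI; rewrite -fock_dot_self// (fock_dotC lf lf).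
suff -> : fock_dot f f = 0 by apply/eqP; rewrite eq_complex /= oppr0 !eqxx.
pose i2 j := if insub j is Some i then idx i else 1%N.
pose a2 j := if insub j is Some i then a i else 0.
have i2E (i : 'I_m) : i2 i = idx i by rewrite /i2 valK.
have a2E (i : 'I_m) : a2 i = a i by rewrite /a2 valK.
have LI j : (j < m)%N -> L2 (fun z => a2 j * e (i2 j) z).
  move=> jm; apply: L2Z; have -> : j = Ordinal jm by [].
  by rewrite i2E; have [j' jk ->] := idxk (Ordinal jm); have [/fock_L2] := eS j' jk.
have fE' : f = (fun z => \sum_(j < m) a2 j * e (i2 j) z).
  by apply/funext => z; rewrite fE; apply: eq_bigr => i _; rewrite i2E a2E.
rewrite {1}fE' (fock_dot_suml LI lf) big1// => i _.
rewrite i2E a2E; have [j jk ->] := idxk i; have [fe _ _] := eS j jk.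
have le := fock_L2 fe.
rewrite (fock_dotZl _ le lf) (fock_dotC lf le) fperp//.
by apply/eqP; rewrite mulf_eq0 eq_complex /= oppr0 !eqxx orbT.
Qed.

End SpectralBounds.

(** * Separation of convex hulls *)

Section PlanarGeometry.
Context {R : realType}.
Local Notation nc := (@Normc.normc R).
Local Notation tc := (@to_complex R).
Local Notation mR := (measurableTypeR R).

Lemma nbhs_normcP (x : R[i]^o) (P : set R[i]^o) :
  nbhs x P <-> exists2 e, 0 < e & forall z, nc (z - x) < e -> P z.
Proof.
split=> [/nbhs_normP[/= e e0 H]|[e e0 H]].
  have eE : e = (complex.Re e)%:C by rewrite RRe_real// gtr0_real.
  exists (complex.Re e); first by move: e0; rewrite {1}eE ltcR.
  by move=> z zx; apply: H; rewrite /= normC_normc normcB eE ltcR.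
apply: (proj1 (nbhs_normP x P)); exists e%:C; first by rewrite /= ltcR.
by move=> z; rewrite /= normC_normc normcB ltcR => /H.
Qed.

Lemma closed_normc (K : set R[i]^o) (x : R[i]^o) : closed K ->
  (forall e, 0 < e -> exists2 z, K z & nc (z - x) < e) -> K x.
Proof.
move=> cK H; apply: cK => B /nbhs_normcP[e e0 eB].
by have [z Kz zx] := H e e0; exists z; split => //; exact: eB.
Qed.

(** An open set is the countable union of the small squares with rational centres that it
    contains. *)
Lemma measurable_open (U : set R[i]^o) : open U -> measurable [set p : mR * mR | U (tc p)].
Proof.
move=> oU.
pose Q (i : (rat * rat) * nat) : set (mR * mR) :=
  `]ratr i.1.1 - i.2.+1%:R^-1, ratr i.1.1 + i.2.+1%:R^-1[%classic `*`
  `]ratr i.1.2 - i.2.+1%:R^-1, ratr i.1.2 + i.2.+1%:R^-1[%classic.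
pose Q' i := if `[< forall p, Q i p -> U (tc p) >] then Q i else set0.
have -> : [set p : mR * mR | U (tc p)] = \bigcup_i Q' i.
  apply/seteqP; split => [p /= Up|p [i _]]; last first.
    by rewrite /Q'; case: ifP => // /asboolP; apply.
  have /nbhs_normcP[e e0 H] : nbhs (tc p) U by move: oU; rewrite openE => /(_ _ Up).
  have [n n4] : exists n : nat, n.+1%:R^-1 * 4 <= e.
    exists (Num.truncn (4 / e)); rewrite mulrC ler_pdivrMr ?ltr0n// mulrC -ler_pdivrMr//.
    by rewrite ltW// truncnS_gt.
  have r0 : 0 < n.+1%:R^-1 :> R by rewrite invr_gt0.
  have rat_near (x : R) : exists q : rat, x - n.+1%:R^-1 < ratr q < x + n.+1%:R^-1.
    have [|q] := @rat_in_itvoo R (x - n.+1%:R^-1) (x + n.+1%:R^-1); last by rewrite in_itv; exists q.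
    by rewrite ltrBlDr -addrA ltrDl addr_gt0.
  have [q1 h1] := rat_near p.1; have [q2 h2] := rat_near p.2.
  exists (q1, q2, n) => //; rewrite /Q' asboolT.
    have sym (x q r : R) : x - r < q < x + r -> q - r < x < q + r by lra.
    by split; rewrite /= in_itv/=; exact: sym.
  move=> p' [/=]; rewrite !in_itv/= => h3 h4; apply: H.
  rewrite (le_lt_trans (normc_le_ReIm _))//= (lt_le_trans _ n4)//.
  have dist (x y q r : R) : x - r < q < x + r -> q - r < y < q + r -> `|y - x| < r * 2.
    by move=> k1 k2; rewrite ltr_norml; apply/andP; split; lra.
  have := ltrD (dist _ _ _ _ h1 h3) (dist _ _ _ _ h2 h4).
  by rewrite -mulrDr -natrD.
apply: countable_bigcupT_measurable => // i.
rewrite /Q'; case: ifP => // _.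
by apply: measurableX; exact: measurable_itv.
Qed.

Lemma measurable_closed (K : set R[i]^o) : closed K -> measurable [set p : mR * mR | K (tc p)].
Proof.
move=> cK; rewrite (_ : [set p | _] = ~` [set p : mR * mR | (~` K) (tc p)]).
  by apply: measurableC; apply: measurable_open; exact: closed_openC.
by apply/seteqP; split => p /=; [move=> ? /(_ _)|move/contrapT].
Qed.

Lemma compact_normc (K : set R[i]^o) : compact K -> exists2 A, 0 <= A & forall z, K z -> nc z <= A.
Proof.
rewrite compact_cover => /(_ nat setT (fun n => [set z | nc z < n%:R])).
case=> [n _|z Kz|D _ KD].
- rewrite openE => z /= zn; apply/nbhs_normcP; exists (n%:R - nc z); first by rewrite subr_gt0.
  move=> y yz /=; rewrite -(subrK z y) (le_lt_trans (le_normcD _ _))//.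
  by rewrite -ltrBrDr.
- exists (Num.truncn (nc z)).+1 => //=; exact: truncnS_gt.
exists (\sum_(n <- finmap.enum_fset D) n%:R) => [|z /KD[n /= nD zn]]; first by rewrite sumr_ge0.
rewrite (le_trans (ltW zn))// (big_rem n)//= lerDl sumr_ge0//.
Qed.

Definition real_convex (K : set R[i]^o) := forall x y (t : R), 0 <= t -> t <= 1 -> K x -> K y ->
  K (x + t%:C * (y - x)).

(** A weight in [{i01 R[i]}] is comparable with 0, hence real. It multiplies the first point, while
    the parameter of [real_convex] multiplies the second. *)
Lemma real_convexP (K : set R[i]^o) :
  convex_set (K : set (convex_lmodType R[i]^o)) <-> real_convex K.
Proof.
split=> [cK x y t t0 t1 Kx Ky|cK x y p /set_mem Kx /set_mem Ky].
  have t0' : 0 <= t%:C by rewrite -[0]/(0%:C) lecR.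
  have t1' : t%:C <= 1 by rewrite -[1]/(1%:C) lecR.
  have : K (t%:C * y + (1 - t%:C) * x) := set_mem (cK y x (Itv01 t0' t1') (mem_set Ky) (mem_set Kx)).
  by congr K; ring.
apply/mem_set.
have p0 : 0 <= p%:num by [].
have p1 : p%:num <= 1 by exact: le1.
have pE : p%:num = (complex.Re p%:num)%:C by rewrite RRe_real// ger0_real.
have r0 : 0 <= complex.Re p%:num by rewrite -lecR -pE.
have r1 : complex.Re p%:num <= 1 by rewrite -lecR -pE.
have := cK y x _ r0 r1 Ky Kx; rewrite -pE => H.
suff : K (p%:num * x + (1 - p%:num) * y) by [].
by move: H; congr K; ring.
Qed.

Lemma closed_normc_le (A : R) : closed [set z : R[i]^o | nc z <= A].
Proof.
move=> z zA; apply/ler_addgt0Pr => e e0.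
have [|y [/= yA yz]] := zA [set y | nc (y - z) < e].
  by apply/nbhs_normcP; exists e.
rewrite -[z](subrK y) addrC (le_trans (le_normcD _ _))// lerD// normcB; exact: ltW.
Qed.

Lemma real_convex_normc_le (A : R) : real_convex [set z | nc z <= A].
Proof.
move=> x y t t0 t1 /= xA yA.
have -> : x + t%:C * (y - x) = (1 - t)%:C * x + t%:C * y.
  by rewrite rmorphB rmorph1; ring.
rewrite (le_trans (le_normcD _ _))// !Normc.normcM !normc_real !ger0_norm ?subr_ge0//.
have := ler_wpM2l t0 yA; have : (1 - t) * nc x <= (1 - t) * A by rewrite ler_wpM2l// subr_ge0.
by lra.
Qed.

Definition plane_dot (z u : R[i]) : R := complex.Re z * complex.Re u + complex.Im z * complex.Im u.

Lemma plane_dotDl x y u : plane_dot (x + y) u = plane_dot x u + plane_dot y u.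
Proof. by case: x y u => ? ? [? ?] [? ?]; rewrite /plane_dot/=; ring. Qed.

Lemma normc_sqr_line (u v : R[i]) (t : R) :
  nc (u + t%:C * v) ^+ 2 = nc u ^+ 2 + 2 * t * plane_dot v u + t ^+ 2 * nc v ^+ 2.
Proof. by rewrite !normc_sqr; case: u v => ? ? [? ?]; rewrite /plane_dot/=; ring. Qed.

(** A minimising pair of sequences has ultrafilter limits [x] and [y], which realise the distance.
    The direction u = x - y separates, since moving either point inside its convex set does not
    shorten the distance. *)
Lemma strict_separation (K1 K2 : set R[i]^o) (A : R) : closed K1 -> closed K2 ->
  real_convex K1 -> real_convex K2 -> K1 !=set0 -> K2 !=set0 -> K1 `&` K2 = set0 ->
  (forall z, K1 z \/ K2 z -> nc z <= A) ->
  exists u a1 a2, [/\ a2 < a1, forall z, K1 z -> a1 <= plane_dot z u & forall z, K2 z -> plane_dot z u <= a2].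
Proof.
move=> c1 c2 v1 v2 [k1 K1k] [k2 K2k] disj KA.
pose S := [set nc (p.1 - p.2) | p in [set p : R[i] * R[i] | K1 p.1 /\ K2 p.2]].
have Sinf : has_inf S.
  split; first by exists (nc (k1 - k2)); exists (k1, k2).
  by exists 0 => _ [p _ <-]; exact: normc_ge0.
pose d := inf S.
have dle x y : K1 x -> K2 y -> d <= nc (x - y).
  by move=> Kx Ky; apply: ge_inf; [case: Sinf|exists (x, y)].
have XE n : exists p : R[i] * R[i], [/\ K1 p.1, K2 p.2 & nc (p.1 - p.2) < d + n.+1%:R^-1].
  have [|_ [p [p1 p2] <-] pd] := @inf_adherent _ S n.+1%:R^-1 _ Sinf; first by rewrite invr_gt0.
  by exists p.
have [X XP] := choice XE.
have [U [UU Uoo]] := ultraFilterLemma (F := \oo) _.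
have UF : ProperFilter U by exact: ultra_proper.
have [x xP] := @ultra_complex_limit R U (fun n => (X n).1) A UU (fun n => let: And3 h _ _ := XP n in KA _ (or_introl h)).
have [y yP] := @ultra_complex_limit R U (fun n => (X n).2) A UU (fun n => let: And3 _ h _ := XP n in KA _ (or_intror h)).
have K1x : K1 x.
  apply: closed_normc => // e e0; have [n] := filter_ex (xP _ (divr_gt0 e0 (ltr0n _ 2))).
  move=> /= xn; exists (X n).1; first by have [] := XP n.
  by rewrite (le_lt_trans xn)// ltr_pdivrMr// mulr_natr mulr2n ltrDl.
have K2y : K2 y.
  apply: closed_normc => // e e0; have [n] := filter_ex (yP _ (divr_gt0 e0 (ltr0n _ 2))).
  move=> /= yn; exists (X n).2; first by have [] := XP n.
  by rewrite (le_lt_trans yn)// ltr_pdivrMr// mulr_natr mulr2n ltrDl.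
have xyd : nc (x - y) <= d.
  apply/ler_addgt0Pr => e e0; have e3 : 0 < e / 3 by rewrite divr_gt0.
  have Ut : U [set m | (Num.truncn (3 / e) <= m)%N] by apply: Uoo; exact: nbhs_infty_ge.
  have [n [/= [h1 h2] h3]] := filter_ex (filterI (filterI (xP _ e3) (yP _ e3)) Ut).
  have [_ _ h4] := XP n.
  have h5 : n.+1%:R^-1 <= e / 3.
    rewrite -[e / 3]invrK lef_pV2 ?posrE ?invr_gt0//.
    by rewrite invf_div (le_trans (ltW (truncnS_gt _)))// ler_nat.
  have -> : x - y = ((X n).1 - (X n).2) + (- ((X n).1 - x) + ((X n).2 - y)) by ring.
  have h6 := le_normcD ((X n).1 - (X n).2) (- ((X n).1 - x) + ((X n).2 - y)).
  have h7 := le_normcD (- ((X n).1 - x)) ((X n).2 - y).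
  rewrite normcN in h7.
  apply: le_trans h6 (le_trans (lerD (ltW h4) h7) _).
  move: h1 h2 h5; move: (nc _) (nc _) (n.+1%:R^-1) => a b c h1 h2 h5; lra.
have u0 : 0 < nc (x - y).
  rewrite normc_gt0 subr_eq0; apply/eqP => xy.
  have : (K1 `&` K2) x by split; [|rewrite xy].
  by rewrite disj.
(* If p were negative, the value at t = -p / (q - p), which lies in [0, 1], would be negative. *)
have quad (p q : R) : 0 <= q -> (forall t, 0 <= t -> t <= 1 -> 0 <= 2 * t * p + t ^+ 2 * q) -> 0 <= p.
  move=> q0 H; rewrite leNgt; apply/negP => p0.
  have qp : 0 < q - p by lra.
  have t0 : 0 < - p / (q - p) by rewrite divr_gt0// oppr_gt0.
  have t1 : - p / (q - p) <= 1 by rewrite ler_pdivrMr//; lra.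
  have := H _ (ltW t0) t1.
  have -> : 2 * (- p / (q - p)) * p + (- p / (q - p)) ^+ 2 * q =
      (- p / (q - p)) * (p + (p - p * q / (q - p))) by field; rewrite gt_eqF.
  rewrite pmulr_rge0// => h.
  have : p - p * q / (q - p) <= 0.
    rewrite -mulrA -[X in X - _]mulr1 -mulrBr nmulr_rle0// subr_ge0 ler_pdivrMr//; lra.
  lra.
pose u := x - y.
have uu : plane_dot u u = nc u ^+ 2 by rewrite normc_sqr /plane_dot -!expr2.
exists u, (plane_dot x u), (plane_dot y u); split.
- by have := plane_dotDl y u u; rewrite addrC subrK => ->; rewrite ltrDl uu exprn_gt0.
- move=> z K1z.
  have -> : z = x + (z - x) by rewrite addrC subrK.
  rewrite plane_dotDl lerDl; apply: (quad _ (nc (z - x) ^+ 2)); first exact: sqr_ge0.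
  move=> t t0 t1.
  have := dle _ _ (v1 x z t t0 t1 K1x K1z) K2y.
  have -> : x + t%:C * (z - x) - y = u + t%:C * (z - x) by rewrite /u; ring.
  move=> /(le_trans xyd); rewrite -(@ler_pXn2r _ 2) ?nnegrE ?normc_ge0//.
  by rewrite normc_sqr_line -/u; lra.
move=> z K2z.
have -> : z = y + (z - y) by rewrite addrC subrK.
rewrite plane_dotDl gerDl -oppr_ge0; apply: (quad _ (nc (z - y) ^+ 2)); first exact: sqr_ge0.
move=> t t0 t1.
have := dle _ _ K1x (v2 y z t t0 t1 K2y K2z).
have -> : x - (y + t%:C * (z - y)) = u + (- t)%:C * (z - y) by rewrite /u rmorphN; ring.
move=> /(le_trans xyd); rewrite -(@ler_pXn2r _ 2) ?nnegrE ?normc_ge0//.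
by rewrite normc_sqr_line -/u sqrrN; lra.
Qed.

Lemma hull_closed (S : set R[i]^o) : closed (closed_convex_hull S).
Proof. by apply: closed_bigI => K [[]]. Qed.

Lemma hull_convex (S : set R[i]^o) : real_convex (closed_convex_hull S).
Proof.
move=> x y t t0 t1 Kx Ky K KP; have [[_ /real_convexP cK] _] := KP.
by apply: cK => //; [exact: Kx|exact: Ky].
Qed.

Lemma hull_normc_le (S : set R[i]^o) A : (forall z, S z -> nc z <= A) ->
  forall z, closed_convex_hull S z -> nc z <= A.
Proof.
move=> SA z; apply: (smallest_sub (X := [set z | nc z <= A])) => //.
by split; [exact: closed_normc_le|apply/real_convexP; exact: real_convex_normc_le].
Qed.

(** A separating line is turned into a separating circle with a remote centre: |z + t u|^2 = |z|^2 +
    2 t <z, u> + const, and for large [t] the gap in <z, u> outweighs the variation of |z|^2, which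
    is at most A^2. The polynomial X + c with c = t u then has the required moduli. *)
Lemma separating_linear (S1 S2 : set R[i]^o) (A : R) : S1 !=set0 -> S2 !=set0 ->
  closed_convex_hull S1 `&` closed_convex_hull S2 = set0 ->
  (forall z, S1 z \/ S2 z -> nc z <= A) ->
  exists c k1 k2, [/\ 0 <= k1, k1 < k2, forall z, S1 z -> k2 <= nc (z + c) ^+ 2 &
    forall z, S2 z -> nc (z + c) ^+ 2 <= k1].
Proof.
move=> [s1 S1s] [s2 S2s] disj SA.
have sub (S : set R[i]^o) : S `<=` closed_convex_hull S by exact: sub_gen_smallest.
have [u [a1 [a2 [a12 H1 H2]]]] : exists u a1 a2, [/\ a2 < a1,
    forall z, closed_convex_hull S1 z -> a1 <= plane_dot z u &
    forall z, closed_convex_hull S2 z -> plane_dot z u <= a2].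
  apply: (@strict_separation _ _ A) => //; try exact: hull_closed; try exact: hull_convex.
  - by exists s1; exact: sub.
  - by exists s2; exact: sub.
  by move=> z [|]; apply: hull_normc_le => y Sy; apply: SA; [left|right].
pose t := A ^+ 2 / (a1 - a2) + 1.
have d0 : 0 < a1 - a2 by rewrite subr_gt0.
have t0 : 0 < t by rewrite ltr_wpDl// divr_ge0 ?sqr_ge0// ltW.
have tA : A ^+ 2 < 2 * t * (a1 - a2).
  have -> : 2 * t * (a1 - a2) = 2 * A ^+ 2 + 2 * (a1 - a2) by rewrite /t; field; rewrite gt_eqF.
  by have := sqr_ge0 A; lra.
have E z : nc (z + t%:C * u) ^+ 2 = nc z ^+ 2 + 2 * t * plane_dot z u + t ^+ 2 * nc u ^+ 2.
  by rewrite normc_sqr_line; congr (_ + _ * _ + _); rewrite /plane_dot; ring.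
have t20 : 0 < 2 * t by rewrite mulr_gt0.
have U2 z : S2 z -> nc (z + t%:C * u) ^+ 2 <= A ^+ 2 + 2 * t * a2 + t ^+ 2 * nc u ^+ 2.
  move=> S2z; have hA : nc z ^+ 2 <= A ^+ 2.
    have zA := SA z (or_intror S2z).
    by rewrite lerXn2r ?nnegrE ?normc_ge0// (le_trans _ zA)// normc_ge0.
  by rewrite E lerD2r lerD// ler_pM2l// H2//; exact: sub.
exists (t%:C * u), (A ^+ 2 + 2 * t * a2 + t ^+ 2 * nc u ^+ 2), (2 * t * a1 + t ^+ 2 * nc u ^+ 2); split => //.
- by rewrite (le_trans _ (U2 _ S2s))// sqr_ge0.
- by rewrite ltrD2r; move: tA; rewrite mulrBr; lra.
move=> z S1z; rewrite E lerD2r.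
have : a1 <= plane_dot z u by apply: H1; exact: sub.
by rewrite -(ler_pM2l t20) => h; have := sqr_ge0 (nc z); lra.
Qed.

End PlanarGeometry.

(** * Spaces of polynomials on which the form has a sign *)

Section HermitianForms.
Context {R : realType}.
Local Notation nc := (@Normc.normc R).

Definition herm_form N (M : 'M[R[i]]_N) (a : 'rV[R[i]]_N) : R :=
  complex.Re (\sum_j \sum_k a 0 j * (a 0 k)^* * M j k).

Lemma spectral_form N (M : 'M[R[i]]_N) : (forall j k, M k j = (M j k)^*) ->
  exists (P : 'M[R[i]]_N) (d : 'I_N -> R), P \in unitmx /\
    forall y, herm_form M (y *m P) = \sum_i d i * nc (y 0 i) ^+ 2.
Proof.
move=> Mherm.
have Mh : M \is hermsymmx.
  apply/is_hermitianmxP; rewrite expr0 scale1r.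
  by apply/matrixP => j k; rewrite !mxE Mherm.
have /orthomx_spectralP := hermitian_normalmx Mh.
set P := spectralmx M; set D := spectral_diag M => ME.
have Pu : P \is unitarymx by exact: spectral_unitarymx.
have dr i : D 0 i = (complex.Re (D 0 i))%:C.
  rewrite RRe_real//; exact: (mxOverP (hermitian_spectral_diag_real Mh)).
exists P, (fun i => complex.Re (D 0 i)); split; first exact: unitarymx_unit.
move=> y.
have -> : herm_form M (y *m P) = complex.Re ((y *m P *m M *m ((y *m P) ^t* )%sesqui) 0 0).
  rewrite /herm_form; congr complex.Re; rewrite !mxE exchange_big/=.
  apply: eq_bigr => k _; rewrite !mxE big_distrl/=; apply: eq_bigr => j _.
  by rewrite !mxE mulrAC.
have PP : P *m invmx P = 1%:M by rewrite mulmxV// unitarymx_unit.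
have -> : ((y *m P) ^t* )%sesqui = invmx P *m (y ^t* )%sesqui.
  by rewrite trmx_mul map_mxM/= invmx_unitary.
rewrite ME -!mulmxA (mulmxA P (invmx P)) PP mul1mx (mulmxA P (invmx P)) PP mul1mx.
rewrite mxE raddf_sum; apply: eq_bigr => i _ /=.
rewrite mul_diag_mx !mxE dr.
rewrite normc_sqr; case: (y 0 i) => u v /=; ring.
Qed.

(** After unitary diagonalisation the diagonal has at least 2n real entries, so [n] of them are
    nonnegative or [n] are negative; the corresponding rows of [P] span the subspace. *)
Lemma semidefinite_rows n N (M : 'M[R[i]]_N) : (n.*2 <= N)%N -> (forall j k, M k j = (M j k)^*) ->
  exists B : 'M[R[i]]_(n, N), (forall y : 'rV_n, y != 0 -> y *m B != 0) /\
    ((forall y : 'rV_n, 0 <= herm_form M (y *m B)) \/ (forall y : 'rV_n, herm_form M (y *m B) <= 0)).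
Proof.
move=> nN /spectral_form[P [d [Pu PE]]].
have sel (D : {set 'I_N}) : (n <= #|D|)%N -> exists B : 'M[R[i]]_(n, N), (forall y : 'rV_n, y != 0 -> y *m B != 0) /\
    forall y : 'rV_n, exists2 y' : 'rV_N, y *m B = y' *m P & forall j, j \notin D -> y' 0 j = 0.
  move=> nD; pose f (i : 'I_n) : 'I_N := enum_val (widen_ord nD i).
  have finj : injective f.
    by move=> i j /enum_val_inj/(congr1 val) /= ij; exact: val_inj.
  exists (rowsub f P).
  have E (y : 'rV_n) : y *m rowsub f P = (y *m rowsub f 1%:M) *m P.
    by rewrite -mulmxA mul_rowsub_mx mul1mx.
  split.
    move=> y; apply: contra_neq; rewrite E => /(congr1 (mulmx^~ (invmx P))).
    rewrite mulmxK// mul0mx => y0; apply/rowP => i.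
    have /rowP/(_ (f i)) := y0; rewrite !mxE (bigD1 i)//= !mxE eqxx mulr1 big1 ?addr0//.
    by move=> j ji; rewrite !mxE (inj_eq finj) (negbTE ji) mulr0.
  move=> y; exists (y *m rowsub f 1%:M); first exact: E.
  move=> j jD; rewrite mxE big1// => i _; rewrite !mxE.
  have [ij|_] := eqVneq (f i) j; last by rewrite mulr0.
  by move: jD; rewrite -ij /f enum_valP.
pose Dp : {set 'I_N} := finset (fun i => 0 <= d i).
have [/(sel Dp)[B [Bf BE]]|] := leqP n #|Dp|.
  exists B; split => //; left => y; have [y' -> y'0] := BE y; rewrite PE.
  apply: sumr_ge0 => i _; have [|/y'0 ->] := boolP (i \in Dp).
    by rewrite inE => di; rewrite mulr_ge0// sqr_ge0.
  by rewrite Normc.normc0 expr0n mulr0.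
move=> Dn; have /(sel (~: Dp))[B [Bf BE]] : (n <= #|~: Dp|)%N.
  by have := cardsC Dp; rewrite card_ord => DN; lia.
exists B; split => //; right => y; have [y' -> y'0] := BE y; rewrite PE.
rewrite -oppr_ge0 -sumrN; apply: sumr_ge0 => i _; have [|/y'0 ->] := boolP (i \in ~: Dp).
  rewrite !inE -ltNge => di; rewrite -mulNr mulr_ge0 ?sqr_ge0// oppr_ge0; exact: ltW.
by rewrite Normc.normc0 expr0n mulr0 oppr0.
Qed.

End HermitianForms.

(** * Masses of polynomials on two sets *)

Section MassForms.
Context {R : realType}.
Local Notation nc := (@Normc.normc R).
Local Notation tc := (@to_complex R).
Local Notation gw := (@gauss_weight R).
Local Notation mR := (measurableTypeR R).
Local Notation CF := (R[i]^o -> R[i]^o).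

Lemma symbol_quad_int (V : R[i]^o -> R) (B : R) f : mfun (fun p => V (tc p)) -> (forall z, `|V z| <= B) -> L2 f ->
  integ (fun p => V (tc p) * (nc (f (tc p)) ^+ 2 * gw (tc p))) /\
  complex.Re (symbol_dot V f f) = plane_int (fun p => V (tc p) * (nc (f (tc p)) ^+ 2 * gw (tc p))).
Proof.
move=> mV VB lf; have [i1 _] := dot_cinteg (symbol_L2 mV VB lf) lf.
have E p : complex.Re ((V (tc p))%:C * f (tc p) * (f (tc p))^* * (gw (tc p))%:C) =
    V (tc p) * (nc (f (tc p)) ^+ 2 * gw (tc p)).
  by rewrite normc_sqr; case: (f (tc p)) => u v /=; ring.
split; first by move: i1; under eq_fun do rewrite E.
by rewrite /symbol_dot /fock_dot /cintegral /= -/(plane_int _); congr plane_int; apply/funext => p; exact: E.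
Qed.

(** No Gaussian weight is included, so that plane isometries transport masses. *)
Definition mass (S : set R[i]^o) (f : CF) : R := plane_int (fun p => nc (f (tc p)) ^+ 2 * \1_S (tc p)).

Lemma indic_norm (S : set R[i]^o) z : 0 <= (\1_S z : R) <= 1.
Proof. by rewrite indicE; case: (_ \in _); rewrite !lexx ler01. Qed.

Lemma mfun_indic_tc (S : set R[i]^o) : measurable [set p : mR * mR | S (tc p)] ->
  mfun (fun p => \1_S (tc p)).
Proof.
move=> mS; rewrite (_ : (fun p => _) = \1_[set p : mR * mR | S (tc p)]); first exact: mfun_indic.
by apply/funext => p; rewrite !indicE; congr (nat_of_bool _)%:R; apply/idP/idP => /set_mem/mem_set.
Qed.

Lemma indic_gauss (S : set R[i]^o) (A : R) z : (forall z, S z -> nc z <= A) ->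
  (\1_S z : R) <= expR (A ^+ 2) * gw z.
Proof.
move=> SA; have [zS|/negbTE zS] := boolP (z \in S); rewrite indicE ?zS; last first.
  by rewrite mulr_ge0 ?expR_ge0.
rewrite /gauss_weight -expRD -expR0 ler_expR subr_ge0 lerXn2r ?nnegrE ?normc_ge0//.
  by rewrite (le_trans (normc_ge0 z))// SA//; exact: set_mem.
by apply: SA; exact: set_mem.
Qed.

Lemma integ_mass (S : set R[i]^o) (A : R) f : measurable [set p : mR * mR | S (tc p)] ->
  (forall z, S z -> nc z <= A) -> L2 f -> integ (fun p => nc (f (tc p)) ^+ 2 * \1_S (tc p)).
Proof.
move=> mS SA [mf If]; apply: integ_le (integZ (expR (A ^+ 2)) If).
  by apply: mfunM; [exact: mfun_normc2|exact: mfun_indic_tc].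
move=> p; have /andP[i0 _] := indic_norm S (tc p).
rewrite ger0_norm; last by rewrite mulr_ge0// sqr_ge0.
by rewrite mulrCA ler_wpM2l ?sqr_ge0//; exact: indic_gauss.
Qed.

Lemma mass_ge0 S f : 0 <= mass S f.
Proof. by apply: plane_int_ge0 => p; rewrite mulr_ge0 ?sqr_ge0//; have /andP[] := indic_norm S (tc p). Qed.

Lemma symbol_dot_sum2 (V : R[i]^o -> R) (B : R) (F G : nat -> CF) (a b : nat -> R[i]) M N :
  mfun (fun p => V (tc p)) -> (forall z, `|V z| <= B) ->
  (forall j, (j < M)%N -> L2 (F j)) -> (forall j, (j < N)%N -> L2 (G j)) ->
  symbol_dot V (fun z => \sum_(i < M) a i * F i z) (fun z => \sum_(j < N) b j * G j z) =
  \sum_(i < M) \sum_(j < N) a i * (b j)^* * symbol_dot V (F i) (G j).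
Proof.
move=> mV VB LF LG; rewrite /symbol_dot.
have -> : (fun z => (V z)%:C * \sum_(i < M) a i * F i z) =
    (fun z => \sum_(i < M) a i * (fun i z => (V z)%:C * F i z) i z).
  by apply/funext => z; rewrite mulr_sumr; apply: eq_bigr => i _; rewrite mulrCA.
apply: (@fock_dot_sum2 R (fun i z => (V z)%:C * F i z) G a b) LG => j /LF.
exact: symbol_L2.
Qed.

Lemma L2_horner (p : {poly R[i]}) : L2 (horner p).
Proof.
have -> : horner p = (fun z => \sum_(k < size p) p`_k * z ^+ k) by apply/funext => z; rewrite horner_coef.
exact: (L2_poly (fun k => p`_k)).
Qed.

Lemma fock_horner (p : {poly R[i]}) : fock (horner p : CF).
Proof.
have -> : horner p = (fun z => \sum_(k < size p) p`_k * z ^+ k) by apply/funext => z; rewrite horner_coef.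
exact: (fock_poly (fun k => p`_k)).
Qed.

Section Pair.
Variables (S1 S2 : set R[i]^o) (A : R).
Hypotheses (mS1 : measurable [set p : mR * mR | S1 (tc p)])
  (mS2 : measurable [set p : mR * mR | S2 (tc p)])
  (S1A : forall z, S1 z -> nc z <= A) (S2A : forall z, S2 z -> nc z <= A).

Lemma mass_family_pm n : exists b : 'I_n -> {poly R[i]},
  [/\ forall i, (size (b i) <= n.*2)%N,
    forall x : 'I_n -> R[i], (exists i, x i != 0) -> \sum_i x i *: b i != 0 &
    (forall x : 'I_n -> R[i], let p := \sum_i x i *: b i in mass S2 (horner p) <= mass S1 (horner p)) \/
    (forall x : 'I_n -> R[i], let p := \sum_i x i *: b i in mass S1 (horner p) <= mass S2 (horner p))].
Proof.
(* The factor e^(|z|^2) cancels the Gaussian weight, making the form of [V] the difference of the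
   bare masses. [V] stays bounded because both sets are. *)
pose V (z : R[i]^o) : R := (\1_S1 z - \1_S2 z) * expR (nc z ^+ 2).
have i1 z := indic_norm S1 z; have i2 z := indic_norm S2 z.
have Vgw z : V z * gw z = \1_S1 z - \1_S2 z.
  by rewrite /V /gauss_weight -mulrA -expRD subrr expR0 mulr1.
have mV : mfun (fun p => V (tc p)).
  apply: mfunM; first by apply: mfunB; exact: mfun_indic_tc.
  by apply: mfun_expR; apply: mfunX; exact: mfun_normc.
have VB z : `|V z| <= expR (A ^+ 2).
  have g1 : \1_S1 z * expR (nc z ^+ 2) <= expR (A ^+ 2).
    rewrite -ler_pdivlMr ?expR_gt0// -expRN; exact: indic_gauss.
  have g2 : \1_S2 z * expR (nc z ^+ 2) <= expR (A ^+ 2).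
    rewrite -ler_pdivlMr ?expR_gt0// -expRN; exact: indic_gauss.
  have p1 : 0 <= \1_S1 z * expR (nc z ^+ 2) by rewrite mulr_ge0 ?expR_ge0//; have /andP[] := i1 z.
  have p2 : 0 <= \1_S2 z * expR (nc z ^+ 2) by rewrite mulr_ge0 ?expR_ge0//; have /andP[] := i2 z.
  by rewrite /V mulrBl ler_norml; apply/andP; split; lra.
have massE f : L2 f -> complex.Re (symbol_dot V f f) = mass S1 f - mass S2 f.
  move=> lf; have [_ ->] := symbol_quad_int mV VB lf.
  rewrite /mass -plane_intB; [|exact: integ_mass S1A lf|exact: integ_mass S2A lf].
  by congr plane_int; apply/funext => p; rewrite mulrCA Vgw mulrBr.
pose N := n.*2.
pose M : 'M[R[i]]_N := \matrix_(j, k) symbol_dot V (fun z => z ^+ j) (fun z => z ^+ k).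
have [B [Bf BE]] := @semidefinite_rows R n N M (leqnn _) (fun j k => etrans (mxE _ _ _ _)
  (etrans (symbol_dotC mV VB (L2_mono j) (L2_mono k)) (congr1 (fun z => z^*) (esym (mxE _ _ _ _))))).
have formE (a : 'rV_N) : mass S1 (horner (rVpoly a)) - mass S2 (horner (rVpoly a)) = herm_form M a.
  rewrite -massE; last exact: L2_horner.
  have -> : horner (rVpoly a) = (fun z => \sum_(k < N) (rVpoly a)`_k * z ^+ k).
    by apply/funext => z; apply: horner_coef_wide; exact: size_poly.
  have := @symbol_dot_sum2 V _ (fun j z => z ^+ j) (fun j z => z ^+ j) (fun k => (rVpoly a)`_k)
    (fun k => (rVpoly a)`_k) N N mV VB (fun j _ => L2_mono j) (fun j _ => L2_mono j).
  move=> ->; congr complex.Re; apply: eq_bigr => j _; apply: eq_bigr => k _.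
  by rewrite !coef_rVpoly_ord mxE.
have sumE (x : 'I_n -> R[i]) : \sum_i x i *: rVpoly (row i B) = rVpoly ((\row_i x i) *m B).
  rewrite mulmx_sum_row linear_sum; apply: eq_bigr => i _.
  by rewrite linearZ/= mxE.
exists (fun i => rVpoly (row i B)); split.
- by move=> i; exact: size_poly.
- move=> x [i xi]; rewrite sumE; apply/negP => /eqP/(congr1 (poly_rV (d := N))).
  rewrite rVpolyK linear0 => /eqP; apply/negP; apply: Bf.
  by apply/rV0Pn; exists i; rewrite mxE.
case: BE => BE; [left|right] => x /=; rewrite sumE -subr_ge0.
  by rewrite formE.
by rewrite -opprB oppr_ge0 formE.
Qed.

End Pair.
End MassForms.

(** * Action of the symmetry on polynomials *)

Section SymmetricFamilies.
Context {R : realType}.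
Local Notation nc := (@Normc.normc R).
Local Notation tc := (@to_complex R).
Local Notation mR := (measurableTypeR R).
Local Notation CF := (R[i]^o -> R[i]^o).

Lemma mass_preserving (phi : mR * mR -> mR * mR) (f g : CF) (S1 S2 : set R[i]^o) : preserving phi ->
  measurable [set p : mR * mR | S2 (tc p)] -> L2 f ->
  (forall p, nc (g (tc p)) = nc (f (tc (phi p)))) -> (forall p, S1 (tc p) <-> S2 (tc (phi p))) ->
  mass S1 g = mass S2 f.
Proof.
move=> pphi mS [mf _] gf S12.
have mF : mfun (fun p => nc (f (tc p)) ^+ 2 * \1_S2 (tc p)).
  by apply: mfunM; [exact: mfun_normc2|exact: mfun_indic_tc].
rewrite /mass /plane_int -(Rintegral_preserving pphi mF); congr Rintegral; apply/funext => p.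
rewrite gf !indicE; congr (_ * (nat_of_bool _)%:R).
by apply/idP/idP => /set_mem/S12/mem_set.
Qed.

Lemma preserving_motion (t : R) (c : R[i]) (b : bool) : exists2 phi : mR * mR -> mR * mR,
  preserving phi & forall p, tc (phi p) = expi t * (if b then (tc p)^* else tc p) + c.
Proof.
have h1 := preserving_expi t; have h2 := preserving_shift (complex.Re c) (complex.Im c).
have h3 := preserving_comp h2 h1.
case: b; last first.
  eexists; first exact: h3.
  by move=> p; apply/eqP; rewrite eq_complex; case: c {h2 h3} => u v /=; apply/andP; split; apply/eqP; ring.
eexists; first exact: (preserving_comp h3 preserving_conj).
by move=> p; apply/eqP; rewrite eq_complex; case: c {h2 h3} => u v /=; apply/andP; split; apply/eqP; ring.
Qed.

Variables (S1 S2 : set R[i]^o) (A : R).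
Hypotheses (mS1 : measurable [set p : mR * mR | S1 (tc p)])
  (mS2 : measurable [set p : mR * mR | S2 (tc p)])
  (S1A : forall z, S1 z -> nc z <= A) (S2A : forall z, S2 z -> nc z <= A)
  (symmetric : exists (theta : R) (c : R[i]^o) (phi : R[i]^o -> R[i]^o),
    [/\ (forall z, phi z = expi theta * z + c) \/
        (forall z, phi z = expi theta * z^* + c),
        phi @` S1 = S2 & phi @` S2 = S1]).

(* Composition with the symmetry, followed in the antiholomorphic case by complex
   conjugation, exchanges the two masses. *)
Lemma mass_swap : exists (T : {poly R[i]} -> {poly R[i]}) (s : R[i] -> R[i]),
  [/\ forall n (x : 'I_n -> R[i]) b, \sum_i x i *: T (b i) = T (\sum_i s (x i) *: b i),
    forall c, c != 0 -> s c != 0, forall p, p != 0 -> T p != 0,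
    forall p, (size (T p) <= size p)%N &
    forall p, mass S1 (horner (T p)) = mass S2 (horner p) /\ mass S2 (horner (T p)) = mass S1 (horner p)].
Proof.
have [t [c [phi [phiE phi12 phi21]]]] := symmetric.
have e0 : expi t != 0 :> R[i] := expi_neq0 t.
have [b {}phiE] : exists b : bool, forall z, phi z = expi t * (if b then z^* else z) + c.
  by case: phiE => E; [exists false|exists true].
have phi_inj : injective phi.
  move=> x y; rewrite !phiE => /addIr/(mulfI e0); case: (b) => // h.
  by rewrite -[x]conjcK h conjcK.
have [psi psiP psiE] := preserving_motion t c b.
have psi12 p : S1 (tc p) <-> S2 (tc (psi p)).
  rewrite psiE -phiE; split => [S1p|]; first by rewrite -phi12; exists (tc p).
  by rewrite -phi12 => -[y S1y /phi_inj <-].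
have psi21 p : S2 (tc p) <-> S1 (tc (psi p)).
  rewrite psiE -phiE; split => [S2p|]; first by rewrite -phi21; exists (tc p).
  by rewrite -phi21 => -[y S2y /phi_inj <-].
have swap T : (forall p z, nc (horner (T p) z) = nc (p.[phi z])) ->
    forall p : {poly R[i]}, mass S1 (horner (T p)) = mass S2 (horner p) /\
      mass S2 (horner (T p)) = mass S1 (horner p).
  move=> TE p; have lp := L2_horner p.
  by split; apply: (mass_preserving psiP) => // q; rewrite TE psiE phiE.
have size_lin (u v : R[i]) : u != 0 -> size (u *: 'X + v%:P) = 2.
  move=> u0; rewrite -mul_polyC size_MXaddC polyC_eq0 (negbTE u0)/=.
  by rewrite size_polyC u0.
have horner_lin (u v z : R[i]) : (u *: 'X + v%:P).[z] = u * z + v by rewrite !hornerE.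
case: b phiE {psiE} => phiE; last first.
  exists (fun p => p \Po (expi t *: 'X + c%:P)), id; split => //.
  - move=> n x b; rewrite linear_sum; apply: eq_bigr => i _; by rewrite linearZ.
  - by move=> p; rewrite comp_poly2_eq0// size_lin.
  - by move=> p; rewrite size_comp_poly2// size_lin.
  - by apply: swap => p z; rewrite horner_comp horner_lin phiE.
have ce0 : (expi t)^* != 0 :> R[i] by rewrite -normc_eq0 normc_conj normc_eq0.
(* The conjugate of p(phi(z)) is a polynomial in [z]: the one with conjugated coefficients,
   evaluated at conj(e^(i theta)) z + conj(c). *)
exists (fun p => map_poly (@conjc R) p \Po ((expi t)^* *: 'X + (c^*)%:P)), (@conjc R); split => //.
- move=> n x b; rewrite raddf_sum linear_sum; apply: eq_bigr => i _ /=.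
  by rewrite map_polyZ linearZ/= conjcK.
- by move=> u; rewrite -!normc_eq0 normc_conj.
- move=> p; rewrite comp_poly2_eq0 ?size_lin//.
  by rewrite map_poly_eq0.
- by move=> p; rewrite size_comp_poly2 ?size_lin// size_map_poly.
apply: swap => p z; rewrite horner_comp horner_lin phiE.
rewrite -[RHS]normc_conj -horner_map; congr (nc _.[_]).
move: (expi t) (c : R[i]) (z : R[i]) => [? ?] [? ?] [? ?].
by apply/eqP; rewrite eq_complex; apply/andP; split; apply/eqP => /=; ring.
Qed.

(** Linear algebra gives a family with one of the two signs, without saying which; the symmetry
    turns an unwanted sign into the right one. *)
Lemma mass_family n : exists b : 'I_n -> {poly R[i]},
  [/\ forall i, (size (b i) <= n.*2)%N,
    forall x : 'I_n -> R[i], (exists i, x i != 0) -> \sum_i x i *: b i != 0 &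
    forall x : 'I_n -> R[i], mass S2 (horner (\sum_i x i *: b i)) <= mass S1 (horner (\sum_i x i *: b i))].
Proof.
have [b [sb bf [H|H]]] := mass_family_pm mS1 mS2 S1A S2A n; first by exists b.
have [T [s [Ts s0 T0 sT Tm]]] := mass_swap.
exists (fun i => T (b i)); split.
- by move=> i; exact: leq_trans (sT _) (sb i).
- by move=> x [i xi]; rewrite Ts; apply: T0; apply: bf; exists i; exact: s0.
- by move=> x; rewrite Ts; have [-> ->] := Tm (\sum_i s (x i) *: b i); exact: H.
Qed.

End SymmetricFamilies.

(** * Almost everywhere equal symbols *)

Section BorelVersions.
Context {R : realType}.
Local Notation nc := (@Normc.normc R).
Local Notation tc := (@to_complex R).
Local Notation gw := (@gauss_weight R).
Local Notation mR := (measurableTypeR R).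
Local Notation mu := (planar_lebesgue R).
Local Notation CF := (R[i]^o -> R[i]^o).

Lemma ge0_integral_mono (F G : mR * mR -> \bar R) : (forall p, 0 <= F p)%E -> (forall p, F p <= G p)%E ->
  (\int[mu]_p F p <= \int[mu]_p G p)%E.
Proof.
move=> F0 FG; have G0 p : (0 <= G p)%E by exact: le_trans (F0 p) (FG p).
rewrite !ge0_integralTE//; apply: ereal_sup_le => _ [h hF <-]; exists h => //= p.
exact: le_trans (hF p) (FG p).
Qed.

(* [planar_lebesgue] is not complete: a function equal almost everywhere to a
   measurable one need not be measurable, hence the detour by the upper bound
   [G + oo * \1_N]. *)
Lemma ge0_integral_ae (F G : mR * mR -> \bar R) (N : set (mR * mR)) : measurable_fun setT G ->
  (forall p, 0 <= F p)%E -> (forall p, 0 <= G p)%E -> measurable N -> mu N = 0 ->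
  (forall p, ~ N p -> F p = G p) -> (\int[mu]_p F p = \int[mu]_p G p)%E.
Proof.
move=> mG F0 G0 mN N0 FG.
pose lo p : \bar R := (G p * (\1_(~` N) p)%:E)%E.
pose hi p : \bar R := (G p + +oo * (\1_N p)%:E)%E.
have mlo : measurable_fun setT lo.
  apply: emeasurable_funM => //; apply/measurable_EFinP; apply: measurable_indic; exact: measurableC.
have mhi : measurable_fun setT hi.
  apply: emeasurable_funD => //; apply: emeasurable_funM; first exact: measurable_cst.
  by apply/measurable_EFinP; exact: measurable_indic.
have lo0 p : (0 <= lo p)%E by rewrite mule_ge0// lee_fin indicE ler0n.
have hi0 p : (0 <= hi p)%E by rewrite adde_ge0// mule_ge0// lee_fin indicE ler0n.
have loG : (\int[mu]_p lo p = \int[mu]_p G p)%E.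
  apply: ge0_ae_eq_integral => //; exists N; split => // p /= h.
  apply: contrapT => Np; apply: h => _; rewrite /lo indicE mem_set ?mule1//.
have hiG : (\int[mu]_p hi p = \int[mu]_p G p)%E.
  apply: ge0_ae_eq_integral => //; exists N; split => // p /= h.
  by apply: contrapT => Np; apply: h => _; rewrite /hi indicE memNset// mule0 adde0.
apply/eqP; rewrite eq_le; apply/andP; split.
  rewrite -hiG; apply: ge0_integral_mono => // p; rewrite /hi indicE; have [Np|/negP Np] := boolP (p \in N).
    by rewrite mule1 addey ?leey// gt_eqF// (lt_le_trans _ (G0 p)).
  by rewrite mule0 adde0 FG// => /mem_set.
rewrite -loG; apply: ge0_integral_mono => // p; rewrite /lo indicE.
have [/set_mem Np|] := boolP (p \in ~` N); first by rewrite mule1 FG.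
by rewrite mule0.
Qed.

Lemma ae_mono (P Q : mR * mR -> Prop) : (forall p, P p -> Q p) ->
  {ae mu, forall p, P p} -> {ae mu, forall p, Q p}.
Proof.
move=> PQ [N [mN N0 PN]]; exists N; split => // p /= nQ.
by apply: PN => /PQ.
Qed.

Lemma ae_and (P Q : mR * mR -> Prop) : {ae mu, forall p, P p} -> {ae mu, forall p, Q p} ->
  {ae mu, forall p, P p /\ Q p}.
Proof.
move=> hP hQ; apply: negligibleS (negligibleU hP hQ) => p /=.
by move/not_andP.
Qed.

Lemma plane_int_ae (F G : R * R -> R) : mfun G -> {ae mu, forall p, F p = G p} -> plane_int F = plane_int G.
Proof.
move=> mG [N [mN N0 FG]].
have {}FG p : ~ N p -> F p = G p.
  by move=> Np; apply: contrapT => h; apply: Np; apply: FG.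
have mG' : measurable_fun setT (EFin \o (G : mR * mR -> mR)) by exact/measurable_EFinP.
rewrite /plane_int /Rintegral; congr fine; rewrite integralE [in RHS]integralE; congr (_ - _)%E.
  apply: (@ge0_integral_ae _ _ N) => //.
  - exact: measurable_funepos.
  - by move=> p /FG h; rewrite !funeposE h.
apply: (@ge0_integral_ae _ _ N) => //.
- exact: measurable_funeneg.
- by move=> p /FG h; rewrite !funenegE h.
Qed.

(** A Borel function equal to [v] almost everywhere may violate the bounds on a null set. Clamping
    it between eps 1_S and M restores them at every point and changes nothing where it equals
    [v]. *)
Lemma borel_version (v : R[i]^o -> R) (M eps : R) (S : set R[i]^o) :
  measurable [set p : mR * mR | S (tc p)] -> lebesgue_measurable_fun v ->
  (forall z, 0 <= v z <= M) -> 0 <= eps -> (forall z, S z -> eps <= v z) ->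
  exists b : R[i]^o -> R, [/\ mfun (fun p => b (tc p)), forall z, 0 <= b z <= M,
    forall z, S z -> eps <= b z & {ae mu, forall p, v (tc p) = b (tc p)}].
Proof.
move=> mS [g mg vg] vM eps0 vS.
have epsM z : eps * \1_S z <= M.
  have /andP[v0 vM'] := vM z; rewrite indicE; have [/set_mem/vS h|_] := boolP (z \in S).
    by rewrite mulr1 (le_trans h).
  by rewrite mulr0 (le_trans v0).
pose b (z : R[i]^o) : R := Num.max (eps * \1_S z) (Num.min M (g (complex.Re z, complex.Im z))).
exists b; split.
- rewrite (_ : (fun p => _) = (fun p => Num.max (eps * \1_S (tc p)) (Num.min M (g p)))); last first.
    by apply/funext => -[].
  apply: measurable_maxr; last exact: measurable_minr (mfun_cst M) mg.
  by apply: mfunM; [exact: mfun_cst|exact: mfun_indic_tc].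
- move=> z; rewrite /b ge_max epsM ge_min lexx/= andbT le_max mulr_ge0// indicE//; exact: ler0n.
- by move=> z Sz; rewrite /b le_max indicE mem_set// mulr1 lexx.
apply: ae_mono vg => p vgp.
have -> : b (tc p) = Num.max (eps * \1_S (tc p)) (Num.min M (g p)) by rewrite /b; case: (p).
rewrite -vgp; have /andP[_ vM'] := vM (tc p); rewrite min_r// max_r//.
rewrite indicE; have [/set_mem/vS h|_] := boolP (tc p \in S); first by rewrite mulr1.
by rewrite mulr0; have /andP[] := vM (tc p).
Qed.

(** The projection is defined by integrals only, so both symbols satisfy the same defining
    condition. *)
Lemma toeplitz_ae (V W : R[i]^o -> R) (B : R) f : mfun (fun p => W (tc p)) -> (forall z, `|W z| <= B) ->
  {ae mu, forall p, V (tc p) = W (tc p)} -> fock f -> toeplitz V f = toeplitz W f.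
Proof.
move=> mW WB VW ff; rewrite /toeplitz /fock_proj; congr xget.
suff E g k : fock g -> fock k -> fock_dot (fun z => (V z)%:C * f z - g z) k =
    fock_dot (fun z => (W z)%:C * f z - g z) k.
  by apply/seteqP; split => g [fg H]; split => // k fk; rewrite -(H k fk) E.
move=> fg fk; have [m1 _] := L2B (symbol_L2 mW WB (fock_L2 ff)) (fock_L2 fg).
have [m2 _] := fock_L2 fk; have [m3 m4] := dot_cmeas m1 m2.
rewrite /fock_dot /cintegral -!/(plane_int _).
by congr (_ +i* _); apply: plane_int_ae => //; apply: ae_mono VW => p ->.
Qed.

Lemma positive_eigenvalues_ae (V W : R[i]^o -> R) (B : R) lam : mfun (fun p => W (tc p)) ->
  (forall z, `|W z| <= B) -> {ae mu, forall p, V (tc p) = W (tc p)} ->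
  positive_eigenvalues V lam -> positive_eigenvalues W lam.
Proof.
move=> mW WB VW [h1 h2 h3]; split; [exact: h1|exact: h2|move=> m m0].
suff <- : toeplitz_eigenspace V m = toeplitz_eigenspace W m by exact: h3.
apply/seteqP; split => f [ff H]; have E := toeplitz_ae mW WB VW ff.
  by split; [exact: ff|rewrite -E; exact: H].
by split; [exact: ff|rewrite E; exact: H].
Qed.
End BorelVersions.

(** * Eigenvalue estimates *)

Section CoreEstimates.
Context {R : realType}.
Local Notation nc := (@Normc.normc R).
Local Notation tc := (@to_complex R).
Local Notation gw := (@gauss_weight R).
Local Notation mR := (measurableTypeR R).
Local Notation CF := (R[i]^o -> R[i]^o).

Lemma discriminant_le (x y s : R) : 0 <= x -> 0 <= y -> 0 <= s ->
  (forall t, 0 < t -> 2 * t * s <= t ^+ 2 * x + y) -> s ^+ 2 <= x * y.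
Proof.
move=> x0 y0 s0 H; move: s0; rewrite le_eqVlt => /predU1P[<-|s0].
  by rewrite expr0n mulr_ge0.
move: x0; rewrite le_eqVlt => /predU1P[x0|x0]; last first.
  have := H (s / x) (divr_gt0 s0 x0).
  have -> : 2 * (s / x) * s = 2 * (s ^+ 2 / x) by rewrite expr2; ring.
  have -> : (s / x) ^+ 2 * x = s ^+ 2 / x by field; rewrite gt_eqF.
  by rewrite (mulrC x) -ler_pdivrMr// => h; lra.
have := H ((y + 1) / s) (divr_gt0 (ltr_wpDl y0 ltr01) s0).
have -> : 2 * ((y + 1) / s) * s = 2 * (y + 1) by field; rewrite gt_eqF.
by rewrite -x0; lra.
Qed.

Lemma cauchy_schwarz (u v : nat -> R) (m n : nat) : (forall k, 0 <= u k) -> (forall k, 0 <= v k) ->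
  (\sum_(m <= k < n) u k * v k) ^+ 2 <= (\sum_(m <= k < n) u k ^+ 2) * (\sum_(m <= k < n) v k ^+ 2).
Proof.
move=> u0 v0; apply: discriminant_le.
- by apply: sumr_ge0 => k _; exact: sqr_ge0.
- by apply: sumr_ge0 => k _; exact: sqr_ge0.
- by apply: sumr_ge0 => k _; exact: mulr_ge0.
move=> t _; rewrite !mulr_sumr -big_split; apply: ler_sum => k _ /=.
by have := sqr_ge0 (t * u k - v k); rewrite sqrrB exprMn; lra.
Qed.

Lemma exp_partial_sum (x : R) N : 0 <= x -> \sum_(k < N) x ^+ k / k`!%:R <= 2 * expR (2 * x).
Proof.
move=> x0; apply: (@le_trans _ _ (\sum_(k < N) expR (2 * x) / 2 ^+ k)).
  apply: ler_sum => k _; have x20 : 0 <= 2 * x by rewrite mulr_ge0.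
  have := @pow_le_expR R (2 * x) k x20; rewrite exprMn => h.
  by rewrite ler_pdivrMr ?ltr0n ?fact_gt0// mulrAC ler_pdivlMr ?exprn_gt0// mulrC (mulrC (expR _)).
rewrite -mulr_sumr mulrC ler_wpM2r ?expR_ge0//.
suff -> : \sum_(i < N) (2 : R) ^- i = 2 - 2 / 2 ^+ N by rewrite gerBl divr_ge0// exprn_ge0.
elim: N => [|n ih]; first by rewrite big_ord0 expr0 divr1 subrr.
by rewrite big_ord_recr/= ih exprS; field; rewrite expf_neq0.
Qed.

(** Since (N + j)! >= N! j!, the factor N! comes out of every moment from [N] on, and what remains
    in [j] sums to an exponential series. *)
Lemma gauss_moment_add_ge (N j : nat) : N`!%:R * j`!%:R * expR (- (2 * (N + j)%:R + 4)) <= gauss_moment (R := R) (N + j).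
Proof.
apply: le_trans (gauss_moment_ge (R := R) (N + j)); rewrite ler_wpM2r ?expR_ge0// -natrM ler_nat.
have := bin_fact (leq_addr j N); rewrite addKn => <-.
by rewrite leq_pmull// bin_gt0 leq_addr.
Qed.

(** Source of the factorial in the upper bound. Cauchy-Schwarz splits the tail into the coefficients
    weighted by the moments, bounded by Bessel, and the sum of A^(2k) / moment, bounded through
    [gauss_moment_add_ge]. *)
Lemma fock_tail (A : R) : 0 <= A -> exists2 B, 1 <= B & forall (f : CF) a, expands f a -> L2 f ->
  forall N z, nc z <= A -> nc (f z - \sum_(k < N) a k * z ^+ k) ^+ 2 <= fock_norm2 f * (B ^+ N.+1 / N`!%:R).
Proof.
(* The factor e^2 pays for e^(-2(N+j)) in the lower bound of the moments, and the e^4 in [K] for the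
   remaining constant. *)
move=> A0; pose x := A ^+ 2 * expR 2.
have x0 : 0 <= x by rewrite mulr_ge0 ?sqr_ge0// expR_ge0.
pose K := expR 4 * (2 * expR (2 * x)).
have K0 : 0 <= K by rewrite mulr_ge0 ?expR_ge0// mulr_ge0 ?expR_ge0.
exists (1 + x + K) => [|f a fa lf N z zA]; first by lra.
have F0 := fock_norm2_ge0 f.
have key J : nc (\sum_(N <= k < N + J) a k * z ^+ k) ^+ 2 <= fock_norm2 f * (x ^+ N / N`!%:R * K).
  pose g k : R := Num.sqrt (gauss_moment k).
  have g0 k : 0 < g k by rewrite sqrtr_gt0 gauss_moment_gt0.
  have g2 k : g k ^+ 2 = gauss_moment k by rewrite sqr_sqrtr// ltW// gauss_moment_gt0.
  have h1 : nc (\sum_(N <= k < N + J) a k * z ^+ k) <= \sum_(N <= k < N + J) (nc (a k) * g k) * (A ^+ k / g k).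
    apply: le_trans (normc_sum _ _ _) _; apply: ler_sum => k _.
    rewrite Normc.normcM normcX.
    have -> : nc (a k) * g k * (A ^+ k / g k) = nc (a k) * A ^+ k by field; rewrite gt_eqF.
    by rewrite ler_wpM2l ?normc_ge0// lerXn2r ?nnegrE ?normc_ge0.
  have h2 : nc (\sum_(N <= k < N + J) a k * z ^+ k) ^+ 2 <=
      (\sum_(N <= k < N + J) nc (a k) * g k * (A ^+ k / g k)) ^+ 2.
    by rewrite lerXn2r ?nnegrE ?normc_ge0// (le_trans _ h1)// normc_ge0.
  apply: le_trans h2 _.
  apply: le_trans (cauchy_schwarz (u := fun k => nc (a k) * g k) (v := fun k => A ^+ k / g k) _ _ _ _) _.
  - by move=> k; rewrite mulr_ge0 ?normc_ge0// ltW.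
  - by move=> k; rewrite divr_ge0 ?exprn_ge0// ltW.
  have S0 : 0 <= \sum_(N <= k < N + J) (A ^+ k / g k) ^+ 2 by apply: sumr_ge0 => k _; exact: sqr_ge0.
  apply: ler_pM => //; first by apply: sumr_ge0 => k _; exact: sqr_ge0.
    apply: le_trans (bessel_expansion fa lf (N + J)).
    rewrite -(big_mkord xpredT (fun k => nc (a k) ^+ 2 * gauss_moment k)).
    rewrite [leRHS](big_cat_nat (n := N)) ?leq_addr//=.
    under eq_bigr do rewrite exprMn g2.
    rewrite lerDr sumr_ge0// => k _; rewrite mulr_ge0 ?sqr_ge0//; exact/ltW/gauss_moment_gt0.
  rewrite -{1}[N]add0n big_addn addKn big_mkord.
  apply: le_trans (_ : \sum_(j < J) x ^+ N / N`!%:R * expR 4 * (x ^+ j / j`!%:R) <= _).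
    apply: ler_sum => j _; rewrite expr_div_n g2 ler_pdivrMr ?gauss_moment_gt0//.
    rewrite addnC; apply: le_trans (ler_wpM2l _ (gauss_moment_add_ge N j)); last first.
      rewrite mulr_ge0 ?mulr_ge0 ?expR_ge0 ?divr_ge0 ?exprn_ge0//.
    have -> : expR (- (2 * (N + j)%:R + 4)) = (expR 2 ^+ N * expR 2 ^+ j * expR 4)^-1 :> R.
      by rewrite expRN expRD -exprD expRM_natr.
    have -> : (A ^+ (N + j)) ^+ 2 = (A ^+ 2) ^+ N * (A ^+ 2) ^+ j by rewrite -exprM mulnC exprM exprD.
    rewrite /x !exprMn.
    move: (expR 2) (expR 4) (expR_gt0 (2 : R)) (expR_gt0 (4 : R)) => c d c0 d0.
    have n1 : N`!%:R != 0 :> R by rewrite pnatr_eq0 -lt0n fact_gt0.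
    have n2 : j`!%:R != 0 :> R by rewrite pnatr_eq0 -lt0n fact_gt0.
    have n3 : c ^+ N != 0 by rewrite expf_neq0// gt_eqF.
    have n4 : c ^+ j != 0 by rewrite expf_neq0// gt_eqF.
    have n5 : d != 0 by rewrite gt_eqF.
    by rewrite le_eqVlt; apply/orP; left; apply/eqP; move: (A ^+ 2 ^+ N) (A ^+ 2 ^+ j) => u v; field; rewrite n1 n2 n3 n4 n5.
  rewrite -mulr_sumr /K [leRHS]mulrA ler_wpM2l ?exp_partial_sum//.
  by rewrite mulr_ge0 ?expR_ge0// divr_ge0// exprn_ge0.
pose X := Num.sqrt (fock_norm2 f * (x ^+ N / N`!%:R * K)).
have Y0 : 0 <= fock_norm2 f * (x ^+ N / N`!%:R * K).
  by rewrite mulr_ge0// mulr_ge0// divr_ge0// exprn_ge0.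
have keyX J : nc (\sum_(N <= k < N + J) a k * z ^+ k) <= X.
  rewrite -(@ler_pXn2r _ 2) ?nnegrE ?normc_ge0 ?sqrtr_ge0// sqr_sqrtr//; exact: key.
have [D HD] := fa A; have {}HD := HD z zA.
have fX : nc (f z - \sum_(k < N) a k * z ^+ k) <= X.
  rewrite -subr_le0; apply: (@geo_small _ _ D) => M.
  have := HD (N + M)%N.
  rewrite -(big_mkord xpredT (fun k => a k * z ^+ k)) (big_cat_nat (n := N)) ?leq_addr//= big_mkord.
  move=> h; have h' := keyX M.
  have -> : f z - \sum_(k < N) a k * z ^+ k = (f z - (\sum_(i < N) a i * z ^+ i + \sum_(N <= i < N + M) a i * z ^+ i)) +
    \sum_(N <= i < N + M) a i * z ^+ i by ring.
  rewrite lerBlDr (le_trans (le_normcD _ _))// lerD// (le_trans h)//.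
  have D0 : 0 <= D by have := HD 0; rewrite expr0 divr1; apply: le_trans; exact: normc_ge0.
  by rewrite ler_wpM2l// lef_pV2 ?posrE ?exprn_gt0// ler_weXn2l ?ler1n// leq_addl.
apply: (@le_trans _ _ (X ^+ 2)); first by rewrite lerXn2r ?nnegrE ?normc_ge0// sqrtr_ge0.
rewrite sqr_sqrtr// ler_wpM2l// mulrAC ler_wpM2r// exprSr ler_pM ?exprn_ge0//; last by lra.
by rewrite lerXn2r ?nnegrE//; lra.
Qed.

End CoreEstimates.

(** * Comparison of the Fock norm of a polynomial with its mass *)

Section MassEstimates.
Context {R : realType}.
Local Notation nc := (@Normc.normc R).
Local Notation tc := (@to_complex R).
Local Notation gw := (@gauss_weight R).
Local Notation mR := (measurableTypeR R).
Local Notation CF := (R[i]^o -> R[i]^o).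

Lemma normc_sum_sqr (u : nat -> R[i]) N : nc (\sum_(k < N) u k) ^+ 2 <= N%:R * \sum_(k < N) nc (u k) ^+ 2.
Proof.
have := cauchy_schwarz (u := fun=> 1 : R) (v := fun k => nc (u k)) 0 N (fun=> ler01) (fun k => normc_ge0 (u k)).
rewrite !big_mkord; under eq_bigr do rewrite mul1r.
rewrite (_ : \sum_(i < N) 1 ^+ 2 = N%:R); last by rewrite expr1n sumr_const card_ord.
apply: le_trans.
by rewrite lerXn2r ?nnegrE ?normc_ge0 ?normc_sum// sumr_ge0// => k _; exact: normc_ge0.
Qed.

Lemma normc_pow_shift (z a : R[i]) k : nc (z - a) ^+ (2 * k) <= 4 ^+ k * (nc z ^+ (2 * k) + nc a ^+ (2 * k)).
Proof.
have h : nc (z - a) <= 2 * Num.max (nc z) (nc a).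
  rewrite (le_trans (le_normcD _ _))// normcN mulr_natl mulr2n lerD// le_max lexx ?orbT//.
have m0 : 0 <= Num.max (nc z) (nc a) by rewrite le_max normc_ge0.
apply: (@le_trans _ _ ((2 * Num.max (nc z) (nc a)) ^+ (2 * k))).
  by rewrite lerXn2r ?nnegrE ?normc_ge0// mulr_ge0.
have -> : (2 * Num.max (nc z) (nc a)) ^+ (2 * k) = 4 ^+ k * Num.max (nc z) (nc a) ^+ (2 * k).
  by rewrite exprMn [X in X * _]exprM; congr (_ ^+ _ * _); ring.
apply: ler_wpM2l; first exact: exprn_ge0.
by rewrite maxEle; case: ifP => _; [rewrite lerDr|rewrite lerDl]; rewrite exprn_ge0// normc_ge0.
Qed.

(** Powers of z - a are not orthogonal for the Gaussian unless a = 0. Bounding the square of a sum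
    by N times the sum of squares loses only a factor [N]. *)
Lemma fock_norm2_shifted (b : nat -> R[i]) (a : R[i]) N :
  fock_norm2 (fun z => \sum_(k < N) b k * (z - a) ^+ k) <=
  \sum_(k < N) N%:R * nc (b k) ^+ 2 * (4 ^+ k * (gauss_moment k + nc a ^+ (2 * k) * gauss_moment 0)).
Proof.
pose c k : R := N%:R * nc (b k) ^+ 2 * 4 ^+ k.
pose h k (p : R * R) : R := c k * (nc (tc p) ^+ (2 * k) * gw (tc p) + nc a ^+ (2 * k) * (nc (tc p) ^+ (2 * 0) * gw (tc p))).
have ih k : integ (h k).
  apply: integZ; apply: integD; first exact: integ_gauss_moment.
  by apply: integZ; exact: integ_gauss_moment.
have [iS IS] := integ_sum (F := h) (M := N) (fun k _ => ih k).
have -> : \sum_(k < N) N%:R * nc (b k) ^+ 2 * (4 ^+ k * (gauss_moment k + nc a ^+ (2 * k) * gauss_moment 0)) =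
    plane_int (fun p => \sum_(k < N) h k p).
  rewrite IS; apply: eq_bigr => k _; rewrite /h plane_intZ; last first.
    by apply: integD; [exact: integ_gauss_moment|apply: integZ; exact: integ_gauss_moment].
  rewrite plane_intD; [|exact: integ_gauss_moment|by apply: integZ; exact: integ_gauss_moment].
  by rewrite plane_intZ; [rewrite /c -!mulrA|exact: integ_gauss_moment].
have pw p : nc (\sum_(k < N) b k * (tc p - a) ^+ k) ^+ 2 * gw (tc p) <= \sum_(k < N) h k p.
  rewrite (le_trans (ler_wpM2r _ (normc_sum_sqr (fun k => b k * (tc p - a) ^+ k) N)))//; first exact/ltW/gauss_gt0.
  rewrite mulr_sumr mulr_suml; apply: ler_sum => k _.
  rewrite Normc.normcM normcX exprMn -exprM (mulnC k) /h /c muln0 expr0 mul1r -mulrDl.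
  have -> (n x y u v : R) : n * x * y * (u * v) = n * (x * (y * u)) * v by ring.
  apply: ler_wpM2r; first exact/ltW/gauss_gt0.
  by apply: ler_wpM2l => //; apply: ler_wpM2l (normc_pow_shift _ _ _); exact: sqr_ge0.
apply: plane_int_le => //; apply: integ_le iS.
  apply: mfunM; last exact: mfun_gauss.
  apply: (mfun_normc2 (f := fun z => \sum_(k < N) b k * (z - a) ^+ k)).
  apply: (@cmeas_sum R (fun k z => b k * (z - a) ^+ k)) => k.
  apply: cmeasM; first exact: cmeas_cst.
  by apply: cmeasX; apply: cmeasB; [exact: cmeas_id|exact: cmeas_cst].
by move=> p; rewrite ger0_norm// mulr_ge0 ?sqr_ge0//; exact/ltW/gauss_gt0.
Qed.

(** Keep only the disc about [a] contained in [S] and translate it to the origin, where Parseval for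
    a radial weight applies. *)
Lemma mass_shifted (S : set R[i]^o) (A : R) (b : nat -> R[i]) (a : R[i]) (r : R) N :
  measurable [set p : mR * mR | S (tc p)] -> (forall z, S z -> nc z <= A) -> 0 < r ->
  (forall z, nc (z - a) <= r -> S z) -> L2 (fun z => \sum_(k < N) b k * (z - a) ^+ k) ->
  \sum_(k < N) nc (b k) ^+ 2 * ((r ^+ 2 / 8) ^+ k * (r ^+ 2 / 16)) <=
  mass S (fun z => \sum_(k < N) b k * (z - a) ^+ k).
Proof.
move=> mS SA r0 Sr lf.
have mom k : integ (fun p => nc (tc p) ^+ k * disc_weight r (tc p)).
  apply: integ_le (integZ (expR (r ^+ 2)) (integ_gauss_moment k)).
    by apply: mfunM; [apply: mfunX; exact: mfun_normc|exact: mfun_disc].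
  move=> p; rewrite ger0_norm ?mulr_ge0 ?exprn_ge0 ?normc_ge0 ?disc_weight_ge0//.
  by rewrite mulrCA ler_wpM2l ?exprn_ge0 ?normc_ge0// disc_le_gauss.
have [iF IF] := @radial_parseval R (disc_weight r) (mfun_disc r) (disc_weight_ge0 r)
  (disc_weight_rot r) mom b N.
have sh := preserving_shift (- complex.Re a) (- complex.Im a).
have tcE p : tc (p.1 + - complex.Re a, p.2 + - complex.Im a) = tc p - a.
  by apply/eqP; rewrite eq_complex; case: (a) => ? ? /=; rewrite !eqxx.
have iF' := integrable_preserving sh iF.
have IF' := Rintegral_preserving sh (integ_mfun iF).
apply: (@le_trans _ _ (\sum_(k < N) nc (b k) ^+ 2 * plane_int (fun p => nc (tc p) ^+ (2 * k) * disc_weight r (tc p)))).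
  by apply: ler_sum => k _; rewrite ler_wpM2l ?sqr_ge0//; exact: disc_moment_ge.
rewrite -IF /plane_int -IF'; apply: plane_int_le; [exact: iF'|exact: integ_mass mS SA lf|].
move=> p /=; rewrite tcE ler_wpM2l ?sqr_ge0// disc_weightE indicE.
by case: (boolP (nc (tc p - a) <= r)) => [/Sr/mem_set ->//|_]; rewrite ler0n.
Qed.

(** Source of the factorial in the lower bound. With [p] written in powers of z - a, the two
    preceding estimates are compared coefficient by coefficient: a term of the norm is of order k!
    against a geometric term of the mass. *)
Lemma fock_norm2_le_mass (S : set R[i]^o) (A : R) (a : R[i]) (r : R) :
  measurable [set p : mR * mR | S (tc p)] -> (forall z, S z -> nc z <= A) -> 0 < r ->
  (forall z, nc (z - a) <= r -> S z) -> exists2 C, 1 <= C & forall N (p : {poly R[i]}), (size p <= N)%N ->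
  fock_norm2 (horner p) <= C ^+ N.+1 * N`!%:R * mass S (horner p).
Proof.
move=> mS SA r0 Sr.
pose G : R := plane_int (fun p : R * R => expR (- (nc (tc p) ^+ 2 / 2))).
have G0 : 0 <= G by apply: plane_int_ge0 => p; exact: expR_ge0.
have r20 : 0 < r ^+ 2 by exact: exprn_gt0.
(* [D] dominates both 4 * 2, from the shift and the moment, and 4 |a|^2. [E] makes D^k at most E^N
   times the disc moment (r^2 / 8)^k, and [C] adds the constant factors, used once in the extra
   power of C^(N+1). *)
pose D := 8 * (1 + nc a ^+ 2).
have a2 := sqr_ge0 (nc a).
have D0 : 0 <= D by rewrite mulr_ge0// addr_ge0.
pose E := D * 8 / r ^+ 2 + 1.
have E1 : 1 <= E.
  by rewrite lerDr; apply: divr_ge0; [exact: mulr_ge0|exact: ltW].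
have E0 : 0 <= E by exact: le_trans E1.
have DE : D <= E * (r ^+ 2 / 8).
  have -> : E * (r ^+ 2 / 8) = D + r ^+ 2 / 8 by rewrite /E; field; rewrite gt_eqF.
  by rewrite lerDl divr_ge0// ltW.
pose C := E + 32 * G / r ^+ 2.
have Q0 : 0 <= 32 * G / r ^+ 2 by apply: divr_ge0; [exact: mulr_ge0|exact: ltW].
have EC : E <= C by rewrite lerDl.
exists C; first exact: le_trans EC.
move=> N p pN.
pose b k := (p \Po ('X + a%:P))`_k.
have pE : horner p = (fun z => \sum_(k < N) b k * (z - a) ^+ k).
  apply/funext => z; have -> : p.[z] = (p \Po ('X + a%:P)).[z - a].
    by rewrite horner_comp !hornerE subrK.
  by apply: horner_coef_wide; rewrite size_comp_poly2 ?size_XaddC.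
have lp := L2_horner p; rewrite pE in lp *.
apply: le_trans (fock_norm2_shifted b a N) _.
have CN0 : 0 <= C ^+ N.+1 * N`!%:R by rewrite mulr_ge0// exprn_ge0// (le_trans E0).
apply: le_trans (ler_wpM2l CN0 (mass_shifted mS SA r0 Sr lp)).
rewrite mulr_sumr; apply: ler_sum => k _.
rewrite [leRHS]mulrCA -[leLHS]mulrA [leLHS]mulrCA ler_wpM2l ?sqr_ge0//.
have k0 : 1 <= k`!%:R :> R by rewrite ler1n fact_gt0.
have m1 : 4 ^+ k * (gauss_moment k + nc a ^+ (2 * k) * gauss_moment 0) <= 2 * G * (D ^+ k * k`!%:R).
  have g0 := gauss_moment_le (R := R) 0; rewrite expr0 fact0 mulr1 mul1r -/G in g0.
  have gk := gauss_moment_le (R := R) k; rewrite -/G in gk.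
  have D1 : 4 ^+ k * (2 ^+ k) <= D ^+ k.
    rewrite -exprMn lerXn2r ?nnegrE// /D; lra.
  have D2 : 4 ^+ k * nc a ^+ (2 * k) <= D ^+ k.
    have h0 : 0 <= 4 * nc a ^+ 2 by exact: mulr_ge0.
    rewrite exprM -exprMn; apply: lerXn2r; rewrite ?nnegrE// /D; move: a2; clear; lra.
  have h1 : 4 ^+ k * gauss_moment k <= D ^+ k * k`!%:R * G.
    rewrite (le_trans (ler_wpM2l _ gk)) ?exprn_ge0// !mulrA ler_wpM2r// ler_wpM2r//.
  have h2 : 4 ^+ k * nc a ^+ (2 * k) * gauss_moment 0 <= D ^+ k * k`!%:R * G.
    rewrite ler_pM ?mulr_ge0 ?exprn_ge0 ?normc_ge0//; first exact/ltW/gauss_moment_gt0.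
    by rewrite (le_trans D2)// ler_peMr// exprn_ge0.
  by rewrite mulrDr mulrA; lra.
apply: le_trans (ler_wpM2l (ler0n _ N) m1) _.
(* Since k < N, the factor [N] lost in [fock_norm2_shifted] fits into N!. *)
have Nk : (N * k`! <= N`!)%N.
  have fact_lt (i n : nat) : (i < n)%N -> (n * i`! <= n`!)%N.
    by case: n => // n; rewrite ltnS factS => /leq_fact; rewrite leq_mul2l => ->; rewrite orbT.
  exact/fact_lt/ltn_ord.
have s1 : D ^+ k <= E ^+ N * (r ^+ 2 / 8) ^+ k.
  apply: (@le_trans _ _ ((E * (r ^+ 2 / 8)) ^+ k)).
    by rewrite lerXn2r ?nnegrE// mulr_ge0// divr_ge0// ltW.
  rewrite exprMn ler_wpM2r ?exprn_ge0 ?divr_ge0 ?(ltW r20)// ler_weXn2l// ltnW//.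
have -> : N%:R * (2 * G * (D ^+ k * k`!%:R)) = (N * k`!)%:R * (D ^+ k * (2 * G)) by rewrite natrM; ring.
rewrite [C ^+ _ * _]mulrC -[leRHS]mulrA ler_pM ?ler_nat// ?mulr_ge0 ?exprn_ge0//.
have -> : 2 * G = 32 * G / r ^+ 2 * (r ^+ 2 / 16) by field; rewrite gt_eqF.
have -> : D ^+ k * (32 * G / r ^+ 2 * (r ^+ 2 / 16)) = (D ^+ k * (32 * G / r ^+ 2)) * (r ^+ 2 / 16) by ring.
have -> : C ^+ N.+1 * ((r ^+ 2 / 8) ^+ k * (r ^+ 2 / 16)) = C ^+ N.+1 * (r ^+ 2 / 8) ^+ k * (r ^+ 2 / 16) by ring.
rewrite ler_wpM2r ?divr_ge0 ?(ltW r20)//.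
rewrite (le_trans (ler_wpM2r Q0 s1))// [C ^+ _]exprSr.
have -> : E ^+ N * (r ^+ 2 / 8) ^+ k * (32 * G / r ^+ 2) = E ^+ N * (32 * G / r ^+ 2) * (r ^+ 2 / 8) ^+ k by ring.
apply: ler_wpM2r; first by rewrite exprn_ge0// divr_ge0// ltW.
apply: ler_pM => //; [exact: exprn_ge0| |by rewrite lerDr].
by apply: lerXn2r; rewrite ?nnegrE// (le_trans E0).
Qed.

End MassEstimates.

(** * Symbols with two-sided bounds on separated sets *)

Section TwoSidedBounds.
Context {R : realType}.
Local Notation nc := (@Normc.normc R).
Local Notation tc := (@to_complex R).
Local Notation gw := (@gauss_weight R).
Local Notation mR := (measurableTypeR R).
Local Notation CF := (R[i]^o -> R[i]^o).

(** Everything is stated for both indices, so that exchanging them replaces the symbol by its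
    opposite and only positive eigenvalues need be treated. The separating discs occur in both
    directions because the lower bound makes S1 dominate and the upper bound S2. *)
Record symbol_data (b1 b2 : R[i]^o -> R) (S1 S2 : set R[i]^o) (A M eps : R) : Prop := SymbolData {
  sd_A : 0 <= A;
  sd_eps : 0 < eps;
  sd_m1 : measurable [set p : mR * mR | S1 (tc p)];
  sd_m2 : measurable [set p : mR * mR | S2 (tc p)];
  sd_S1 : forall z, S1 z -> nc z <= A;
  sd_S2 : forall z, S2 z -> nc z <= A;
  sd_mb1 : mfun (fun p => b1 (tc p));
  sd_mb2 : mfun (fun p => b2 (tc p));
  sd_b1 : forall z, 0 <= b1 z <= M;
  sd_b2 : forall z, 0 <= b2 z <= M;
  sd_l1 : forall z, S1 z -> eps <= b1 z;
  sd_l2 : forall z, S2 z -> eps <= b2 z;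
  sd_d1 : exists a r, 0 < r /\ forall z, nc (z - a) <= r -> S1 z;
  sd_d2 : exists a r, 0 < r /\ forall z, nc (z - a) <= r -> S2 z;
  sd_sep1 : exists c k1 k2, [/\ 0 <= k1, k1 < k2, forall z, S1 z -> k2 <= nc (z + c) ^+ 2 &
    forall z, S2 z -> nc (z + c) ^+ 2 <= k1];
  sd_sep2 : exists c k1 k2, [/\ 0 <= k1, k1 < k2, forall z, S2 z -> k2 <= nc (z + c) ^+ 2 &
    forall z, S1 z -> nc (z + c) ^+ 2 <= k1];
  sd_sym : exists (theta : R) (c : R[i]^o) (phi : R[i]^o -> R[i]^o),
    [/\ (forall z, phi z = expi theta * z + c) \/
        (forall z, phi z = expi theta * z^* + c),
        phi @` S1 = S2 & phi @` S2 = S1] }.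

Lemma symbol_data_swap b1 b2 S1 S2 A M eps :
  symbol_data b1 b2 S1 S2 A M eps -> symbol_data b2 b1 S2 S1 A M eps.
Proof.
move=> [h1 h2 h3 h4 h5 h6 h7 h8 h9 h10 h11 h12 h13 h14 h15 h16 [t [c [phi [h17 h18 h19]]]]].
by split => //; exists t, c, phi.
Qed.

Lemma signed_symbolN (b1 b2 : R[i]^o -> R) S1 S2 z :
  signed_symbol b2 b1 S2 S1 z = - signed_symbol b1 b2 S1 S2 z.
Proof. by rewrite /signed_symbol opprB. Qed.

Section Data.
Variables (b1 b2 : R[i]^o -> R) (S1 S2 : set R[i]^o) (A M eps : R).
Hypothesis H : symbol_data b1 b2 S1 S2 A M eps.
Local Notation V := (signed_symbol b1 b2 S1 S2).

Lemma symbol_mfun : mfun (fun p => V (tc p)).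
Proof.
case: H => *; apply: mfunB; apply: mfunM => //; exact: mfun_indic_tc.
Qed.

Lemma symbol_bound z : `|V z| <= M.
Proof.
have [/andP[h1 h2] /andP[h3 h4]] := (sd_b1 H z, sd_b2 H z).
rewrite /signed_symbol !indicE; case: (_ \in _); case: (_ \in _);
  rewrite ?mulr1 ?mulr0 ?subr0 ?sub0r ler_norml; apply/andP; split; lra.
Qed.

Lemma symbol_support z : A < nc z -> V z = 0.
Proof.
move=> Az; rewrite /signed_symbol !indicE !memNset ?mulr0 ?subr0//.
  by move=> /(sd_S2 H); rewrite leNgt Az.
by move=> /(sd_S1 H); rewrite leNgt Az.
Qed.

Lemma bound_ge0 : 0 <= M.
Proof. by have /andP[] := sd_b1 H 0; exact: le_trans. Qed.

Lemma symbol_quad_ge f : L2 f ->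
  eps * expR (- A ^+ 2) * mass S1 f - M * mass S2 f <= complex.Re (symbol_dot V f f).
Proof.
move=> lf; have [iV ->] := symbol_quad_int symbol_mfun symbol_bound lf.
have i1 := integ_mass (sd_m1 H) (sd_S1 H) lf; have i2 := integ_mass (sd_m2 H) (sd_S2 H) lf.
rewrite -!plane_intZ// -plane_intB; [|exact: integZ|exact: integZ].
apply: plane_int_le => //; first by apply: integB; exact: integZ.
move=> p; set z := tc p; set F := nc (f z) ^+ 2.
have F0 : 0 <= F by exact: sqr_ge0.
rewrite mulrCA (mulrCA M) -mulrBr mulrCA ler_wpM2l// /signed_symbol mulrBl.
have g1 : gw z <= 1 by exact: gauss_le1.
have g0 : 0 <= gw z by exact/ltW/gauss_gt0.
apply: lerB.
  rewrite indicE; have [/set_mem zS|_] := boolP (z \in S1); last by rewrite !mulr0 mul0r.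
  rewrite !mulr1 ler_pM ?expR_ge0 ?(ltW (sd_eps H)) ?(sd_l1 H)//.
  rewrite /gauss_weight ler_expR lerN2 lerXn2r ?nnegrE ?normc_ge0 ?(sd_A H)//; exact: (sd_S1 H).
have /andP[h3 h4] := sd_b2 H z.
rewrite indicE; have [_|_] := boolP (z \in S2); last by rewrite !mulr0 mul0r.
by rewrite !mulr1 -[leRHS]mulr1 ler_pM.
Qed.

(* [w = ('X + c)^m] is larger on [S1] than on [S2], by a factor as large as desired. *)
Lemma absorb (eta L : R) : 0 < eta -> exists (w : {poly R[i]}) (m : nat),
  [/\ w != 0, size w = m.+1 & forall p : {poly R[i]}, mass S2 (horner p) <= mass S1 (horner p) ->
    L * mass S2 (horner (w * p)) <= eta * mass S1 (horner (w * p))].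
Proof.
move=> eta0; have [c [k1 [k2 [k10 k12 h1 h2]]]] := sd_sep1 H.
have k20 : 0 < k2 by exact: le_lt_trans k12.
pose q := k1 / k2.
have q0 : 0 <= q by rewrite divr_ge0// ltW.
have q1 : q < 1 by rewrite ltr_pdivrMr// mul1r.
have L1 : 0 < `|L| + 1 by rewrite ltr_wpDl.
have [m qm] : exists m : nat, q ^+ m <= eta / (`|L| + 1).
  have : q ^+ n @[n --> \oo] --> (0 : R^o) by apply: cvg_expr; rewrite ger0_norm.
  move=> /cvgrPdist_le/(_ (eta / (`|L| + 1)) (divr_gt0 eta0 L1))[m _ /(_ m (leqnn m))] /=.
  by rewrite sub0r normrN ger0_norm ?exprn_ge0// => h; exists m.
exists (('X + c%:P) ^+ m), m; split.
- by rewrite expf_neq0// -size_poly_eq0 size_XaddC.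
- by rewrite -[c]opprK polyCN size_exp_XsubC.
move=> p Hp.
have wE z : nc (('X + c%:P) ^+ m * p).[z] ^+ 2 = (nc (z + c) ^+ 2) ^+ m * nc p.[z] ^+ 2.
  by rewrite hornerM horner_exp hornerD hornerX hornerC Normc.normcM normcX exprMn exprAC.
have lp := L2_horner p; have lw := L2_horner (('X + c%:P) ^+ m * p).
have i1 := integ_mass (sd_m1 H) (sd_S1 H) lp; have i2 := integ_mass (sd_m2 H) (sd_S2 H) lp.
have j1 := integ_mass (sd_m1 H) (sd_S1 H) lw; have j2 := integ_mass (sd_m2 H) (sd_S2 H) lw.
have m2 : mass S2 (horner (('X + c%:P) ^+ m * p)) <= k1 ^+ m * mass S2 (horner p).
  rewrite -plane_intZ//; apply: plane_int_le => //; first exact: integZ.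
  move=> x; rewrite wE -[X in X <= _]mulrA indicE; have [/set_mem zS|_] := boolP (tc x \in S2); last by rewrite !mulr0.
  by apply: ler_wpM2r; [rewrite mulr_ge0 ?sqr_ge0|rewrite lerXn2r ?nnegrE ?sqr_ge0// h2].
have m1 : k2 ^+ m * mass S1 (horner p) <= mass S1 (horner (('X + c%:P) ^+ m * p)).
  rewrite -plane_intZ//; apply: plane_int_le => //; first exact: integZ.
  move=> x; rewrite wE -[X in _ <= X]mulrA indicE; have [/set_mem zS|_] := boolP (tc x \in S1); last by rewrite !mulr0.
  by apply: ler_wpM2r; [rewrite mulr_ge0 ?sqr_ge0|rewrite lerXn2r ?nnegrE ?sqr_ge0 ?(ltW k20)// h1].
have M0 := mass_ge0 S2 (horner (('X + c%:P) ^+ m * p)).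
have P1 := mass_ge0 S1 (horner p).
(* This is where [m] was chosen: multiplication by [w] shrinks the ratio of the masses by (k1 /
   k2)^m. *)
have kk : (`|L| + 1) * k1 ^+ m <= eta * k2 ^+ m.
  rewrite mulrC -ler_pdivlMr// mulrAC -ler_pdivrMr ?exprn_gt0//.
  by rewrite -expr_div_n.
apply: (@le_trans _ _ ((`|L| + 1) * (k1 ^+ m * mass S1 (horner p)))).
  apply: (@le_trans _ _ ((`|L| + 1) * mass S2 (horner (('X + c%:P) ^+ m * p)))).
    by rewrite ler_wpM2r//; have := ler_norm L; lra.
  rewrite ler_wpM2l ?(ltW L1)// (le_trans m2)// ler_wpM2l// exprn_ge0//.
rewrite mulrA (le_trans (ler_wpM2r P1 kk))// -mulrA ler_wpM2l// ltW//.
Qed.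

End Data.

Lemma symbol_quad_le b1 b2 S1 S2 A M eps f : symbol_data b1 b2 S1 S2 A M eps -> L2 f ->
  complex.Re (symbol_dot (signed_symbol b1 b2 S1 S2) f f) <=
  M * mass S1 f - eps * expR (- A ^+ 2) * mass S2 f.
Proof.
move=> H lf; have H' := symbol_data_swap H.
have [iV E1] := symbol_quad_int (symbol_mfun H) (symbol_bound H) lf.
have [_ E2] := symbol_quad_int (symbol_mfun H') (symbol_bound H') lf.
have := symbol_quad_ge H' lf.
have -> : complex.Re (symbol_dot (signed_symbol b2 b1 S2 S1) f f) =
    - complex.Re (symbol_dot (signed_symbol b1 b2 S1 S2) f f).
  rewrite E1 E2 -plane_intN//; congr plane_int; apply/funext => p.
  by rewrite signed_symbolN mulNr.
by lra.
Qed.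

End TwoSidedBounds.

(** * Lower bound for the eigenvalues *)

Section EigenvalueBounds.
Context {R : realType}.
Local Notation nc := (@Normc.normc R).
Local Notation tc := (@to_complex R).
Local Notation gw := (@gauss_weight R).
Local Notation mR := (measurableTypeR R).
Local Notation CF := (R[i]^o -> R[i]^o).

Definition row_ext (n : nat) (x : 'rV[R[i]]_n) (i : nat) : R[i] := if insub i is Some j then x 0 j else 0.

Lemma row_extE n (x : 'rV[R[i]]_n) (i : 'I_n) : row_ext x i = x 0 i.
Proof. by rewrite /row_ext valK. Qed.

Lemma expands_sum (F : nat -> CF) (a : nat -> nat -> R[i]) (d : nat -> R[i]) n :
  (forall j, (j < n)%N -> expands (F j) (a j)) ->
  expands (fun z => \sum_(j < n) d j * F j z) (fun k => \sum_(j < n) d j * a j k).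
Proof.
elim: n => [_ A|n ih H].
  exists 0 => z _ M; rewrite big_ord0 sub0r normcN big1 ?Normc.normc0 ?mul0r// => k _.
  by rewrite big_ord0 mul0r.
have h1 := ih (fun j jn => H j (ltnW jn)); have h2 := expandsZ (d n) (H n (ltnSn n)).
have := expandsD h1 h2.
have -> : (fun z => \sum_(j < n) d j * F j z + d n * F n z) = (fun z => \sum_(j < n.+1) d j * F j z).
  by apply/funext => z; rewrite big_ord_recr.
have -> // : (fun k => \sum_(j < n) d j * a j k + d n * a n k) = (fun k => \sum_(j < n.+1) d j * a j k).
by apply/funext => k; rewrite big_ord_recr.
Qed.

Lemma fock_norm2_horner_gt0 (p : {poly R[i]}) : p != 0 -> 0 < fock_norm2 (horner p).
Proof.
move=> p0; have -> : horner p = (fun z => \sum_(k < size p) p`_k * z ^+ k).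
  by apply/funext => z; rewrite horner_coef.
rewrite (fock_norm2_poly (fun k => p`_k)).
have sp : (0 < size p)%N by rewrite lt0n size_poly_eq0.
have lt : ((size p).-1 < size p)%N by rewrite prednK.
rewrite (bigD1 (Ordinal lt))//= ltr_wpDr//.
  by apply: sumr_ge0 => k _; rewrite mulr_ge0 ?sqr_ge0//; exact/ltW/gauss_moment_gt0.
by rewrite mulr_gt0 ?gauss_moment_gt0// exprn_gt0// normc_gt0 -[_`_ _]/(lead_coef p) lead_coef_eq0.
Qed.

Lemma horner_combination (w : {poly R[i]}) (b : nat -> {poly R[i]}) (x : nat -> R[i]) n z :
  (w * \sum_(i < n) x i *: b i).[z] = \sum_(i < n) x i * (w * b i).[z].
Proof.
rewrite hornerM horner_sum mulr_sumr; apply: eq_bigr => i _.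
by rewrite hornerZ hornerM mulrCA.
Qed.

Lemma size_combination (w : {poly R[i]}) (b : nat -> {poly R[i]}) (x : nat -> R[i]) m n N :
  size w = m.+1 -> (forall i, (size (b i) <= N)%N) -> (size (w * \sum_(i < n) x i *: b i)%R <= N + m)%N.
Proof.
move=> sw sb; rewrite (leq_trans (size_polyMleq _ _))// sw addSn/= addnC leq_add2r.
apply: leq_trans (size_sum _ _ _) _; apply/bigmax_leqP => i _.
exact: leq_trans (size_scale_leq _ _) (sb i).
Qed.

Lemma mass_add (S : set R[i]^o) A f g : measurable [set p : mR * mR | S (tc p)] ->
  (forall z, S z -> nc z <= A) -> L2 f -> L2 g ->
  mass S (fun z => f z + g z) <= 2 * mass S f + 2 * mass S g.
Proof.
move=> mS SA lf lg.
have i1 := integ_mass mS SA lf; have i2 := integ_mass mS SA lg; have i3 := integ_mass mS SA (L2D lf lg).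
rewrite -!plane_intZ// -plane_intD; [|exact: integZ|exact: integZ].
apply: plane_int_le => //; first by apply: integD; exact: integZ.
move=> p; have -> (x y c : R) : 2 * (x * c) + 2 * (y * c) = (2 * x + 2 * y) * c by ring.
by apply: ler_wpM2r (normc_sqr_le _ _); have /andP[] := indic_norm (R := R) S (tc p).
Qed.

Lemma mass_sup (S : set R[i]^o) A D f : measurable [set p : mR * mR | S (tc p)] ->
  (forall z, S z -> nc z <= A) -> L2 f -> 0 <= D -> (forall z, nc z <= A -> nc (f z) ^+ 2 <= D) ->
  mass S f <= D * plane_int (fun p => disc_weight A (tc p)).
Proof.
move=> mS SA lf D0 fD; have id := integ_disc (R := R) A; rewrite -plane_intZ//.
apply: plane_int_le; [exact: integ_mass mS SA lf|exact: integZ|move=> p].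
rewrite indicE; have [/set_mem/SA h|_] := boolP (tc p \in S); last first.
  by rewrite mulr0 mulr_ge0// disc_weight_ge0.
by rewrite disc_weightE h !mulr1; exact: fD.
Qed.

Lemma mass_family_nat b1 b2 S1 S2 A M eps n : symbol_data b1 b2 S1 S2 A M eps ->
  exists b : nat -> {poly R[i]},
  [/\ forall i, (size (b i) <= n.*2)%N,
    forall x : nat -> R[i], (exists2 i, (i < n)%N & x i != 0) -> \sum_(i < n) x i *: b i != 0 &
    forall x : nat -> R[i], mass S2 (horner (\sum_(i < n) x i *: b i)) <= mass S1 (horner (\sum_(i < n) x i *: b i))].
Proof.
move=> H; have [b [sb bf bm]] := mass_family (sd_m1 H) (sd_m2 H) (sd_S1 H) (sd_S2 H) (sd_sym H) n.
pose b' i : {poly R[i]} := if insub i is Some j then b j else 0.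
have E (x : nat -> R[i]) : \sum_(i < n) x i *: b' i = \sum_(i < n) x i *: b i.
  by apply: eq_bigr => i _; rewrite /b' valK.
exists b'; split.
- by move=> i; rewrite /b'; case: insubP => [j _ _|_]; [exact: sb|rewrite size_poly0].
- by move=> x [i iN xi]; rewrite E; apply: (bf (fun i => x i)); exists (Ordinal iN).
- by move=> x; rewrite E; exact: (bm (fun i => x i)).
Qed.

Lemma eigenvalue_ge b1 b2 S1 S2 A M eps : symbol_data b1 b2 S1 S2 A M eps ->
  exists (C : R) (m : nat), 1 <= C /\ forall lam n, (0 < n)%N ->
    positive_eigenvalues (signed_symbol b1 b2 S1 S2) lam -> 1 <= lam n * (C ^+ n * (n.*2 + m)`!%:R).
Proof.
move=> H; pose eta := eps * expR (- A ^+ 2) / 2.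
have eta0 : 0 < eta by rewrite divr_gt0// mulr_gt0 ?expR_gt0// (sd_eps H).
(* As [eta] is half the coefficient of the mass on S1 in [symbol_quad_ge], absorbing the negative
   part leaves q >= eta mass(S1) on the family. *)
have [w [m [w0 sw wP]]] := absorb H M eta0.
have [a [r [r0 Sr]]] := sd_d1 H.
have [C1 C11 CP] := fock_norm2_le_mass (sd_m1 H) (sd_S1 H) r0 Sr.
have C10 : 0 < C1 by exact: lt_le_trans C11.
(* For n >= 1, N + 1 = 2n + m + 1 is at most (m + 3) n; the factor 1 + 1/eta is raised to the power
   [n] only to fit the form C^n. *)
exists (C1 ^+ m.+3 * (1 + eta^-1)), m; split.
  rewrite -[1]mulr1 ler_pM//; first exact: exprn_ege1.
  by rewrite mulr1 lerDl invr_ge0 ltW.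
move=> lam n n0 HE; pose N := (n.*2 + m)%N.
have [b [sb bf bm]] := mass_family_nat n H.
have K0 : 0 < C1 ^+ N.+1 * N`!%:R by rewrite mulr_gt0 ?exprn_gt0// ltr0n fact_gt0.
have c0 : 0 < eta / (C1 ^+ N.+1 * N`!%:R) by exact: divr_gt0.
have := eigenvalue_lower_bound (symbol_mfun H) (symbol_bound H) (sd_A H) (symbol_support H)
  (L := fun i => horner (w * b i)) HE n0 c0 (fun i _ => fock_horner _).
have fam (x : nat -> R[i]) : (exists2 i, (i < n)%N & x i != 0) ->
    let l z := \sum_(i < n) x i * (w * b i).[z] in
    0 < fock_norm2 l /\ eta / (C1 ^+ N.+1 * N`!%:R) * fock_norm2 l <=
      complex.Re (symbol_dot (signed_symbol b1 b2 S1 S2) l l).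
  move=> xP l; pose p := \sum_(i < n) x i *: b i.
  have -> : l = horner (w * p) by apply/funext => z; rewrite horner_combination.
  have p0 : p != 0 by exact: bf.
  have wp0 : w * p != 0 by rewrite mulf_neq0.
  have swp : (size (w * p)%R <= N)%N by exact: size_combination sw sb.
  split; first exact: fock_norm2_horner_gt0.
  have lw := L2_horner (w * p).
  apply: le_trans (symbol_quad_ge H lw).
  have h1 := CP _ _ swp; have h2 := wP p (bm x).
  rewrite mulrAC ler_pdivrMr//.
  have -> : eps * expR (- A ^+ 2) = 2 * eta by rewrite /eta; field.
  apply: (@le_trans _ _ (eta * (C1 ^+ N.+1 * N`!%:R * mass S1 (horner (w * p))))).
    by rewrite ler_wpM2l// ltW.
  rewrite [leLHS]mulrCA [leRHS]mulrC ler_wpM2l ?(ltW K0)//; lra.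
move=> /(_ fam) lamn.
have lam0 : 0 <= lam n by rewrite (le_trans _ lamn)// ltW.
rewrite mulrA; apply: (@le_trans _ _ (lam n * (C1 ^+ N.+1 / eta) * N`!%:R)).
  move: lamn; rewrite ler_pdivrMr// => h.
  have -> : lam n * (C1 ^+ N.+1 / eta) * N`!%:R = lam n * (C1 ^+ N.+1 * N`!%:R) / eta by ring.
  by rewrite ler_pdivlMr// mul1r.
rewrite ler_wpM2r// ler_wpM2l// exprMn ler_pM ?exprn_ge0 ?invr_ge0 ?(ltW eta0) ?(ltW C10)//.
  by rewrite -exprM ler_weXn2l// /N -muln2; nia.
have e1 : 1 <= 1 + eta^-1 by rewrite lerDl invr_ge0 ltW.
rewrite (@le_trans _ _ (1 + eta^-1))//; first by rewrite lerDr.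
by case: (n) n0 => // n' _; rewrite exprS ler_peMr ?exprn_ege1// (le_trans _ e1).
Qed.

End EigenvalueBounds.

(** * Upper bound for the eigenvalues *)

Section EigenvalueUpperBound.
Context {R : realType}.
Local Notation nc := (@Normc.normc R).
Local Notation tc := (@to_complex R).
Local Notation CF := (R[i]^o -> R[i]^o).

(* There are more unknowns [d], [y] than Taylor coefficients to cancel. *)
Lemma matching_combination (b : nat -> {poly R[i]}) (w : {poly R[i]}) (m n k N : nat)
    (e : nat -> CF) (a : nat -> nat -> R[i]) :
  size w = m.+1 -> (forall i, (size (b i) <= k.*2)%N) -> N = (k.*2 + m)%N -> (N < n + k)%N ->
  (forall x : nat -> R[i], (exists2 i, (i < k)%N & x i != 0) -> \sum_(i < k) x i *: b i != 0) ->
  (forall j, (j < n)%N -> expands (e j) (a j)) ->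
  exists (d y : nat -> R[i]), (exists2 j, (j < n)%N & d j != 0) /\
    expands (fun z => \sum_(j < n) d j * e j z) (fun l => \sum_(j < n) d j * a j l) /\
    forall z, \sum_(l < N) (\sum_(j < n) d j * a j l) * z ^+ l = - (w * \sum_(i < k) y i *: b i).[z].
Proof.
move=> sw sb NE Nnk bf ea.
pose M1 : 'M[R[i]]_(n, N) := \matrix_(j, l) a j l.
pose M2 : 'M[R[i]]_(k, N) := \matrix_(i, l) (w * b i)`_l.
have [v v0 vM] := @left_kernel _ (n + k) N (col_mx M1 M2) Nnk.
pose x := lsubmx v; pose y := rsubmx v.
have xy : x *m M1 + y *m M2 = 0 by rewrite -mul_row_col hsubmxK.
pose d := row_ext x; pose u := row_ext y.
pose G := w * \sum_(i < k) u i *: b i.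
have sG : (size G <= N)%N by rewrite NE; exact: size_combination sw sb.
have coefG (l : 'I_N) : \sum_(j < n) d j * a j l = - G`_l.
  have /rowP/(_ l) := xy; rewrite !mxE => /eqP; rewrite addr_eq0 => /eqP h.
  transitivity (\sum_j x 0 j * M1 j l).
    by apply: eq_bigr => j _; rewrite [M1 _ _]mxE /d row_extE.
  rewrite h; congr (- _); rewrite /G mulr_sumr coef_sum; apply: eq_bigr => i _.
  by rewrite /u row_extE [M2 _ _]mxE -scalerAr coefZ.
exists d, u; split; last first.
  split; first exact: expands_sum.
  move=> z; rewrite (horner_coef_wide z sG) -sumrN; apply: eq_bigr => l _.
  by rewrite coefG mulNr.
apply: contrapT => d0.
have dz j : (j < n)%N -> d j = 0.
  by move=> jn; apply/eqP; apply: contraT => dj; case: d0; exists j.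
have G0 : G = 0.
  apply/polyP => l; rewrite coef0; have [lN|Nl] := ltnP l N; last first.
    by rewrite nth_default// (leq_trans sG).
  have := coefG (Ordinal lN); rewrite big1 => [/eqP|j _]; last by rewrite dz// mul0r.
  by rewrite eq_sym oppr_eq0 => /eqP.
have w0 : w != 0 by rewrite -size_poly_eq0 sw.
have x0 : x = 0 by apply/rowP => j; rewrite -row_extE [RHS]mxE; exact: dz.
have y0 : y != 0.
  apply: contraNneq v0 => y0; rewrite -[v]hsubmxK -/x -/y x0 y0.
  by rewrite row_mx0.
have [i yi] : exists i, y 0 i != 0 by apply/rV0Pn.
have : \sum_(i < k) u i *: b i != 0 by apply: bf; exists i; rewrite // /u row_extE.
by move: G0 => /eqP; rewrite mulf_eq0 (negbTE w0)/= => ->.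
Qed.

Lemma eigenvalue_le b1 b2 S1 S2 A M eps : symbol_data b1 b2 S1 S2 A M eps ->
  exists (C : R) (m : nat), 1 <= C /\ forall lam n, (m.+1 < n)%N ->
    positive_eigenvalues (signed_symbol b1 b2 S1 S2) lam -> lam n * ((n.*2 - m.+2)`!%:R) <= C ^+ n.
Proof.
move=> H; have H' := symbol_data_swap H.
pose eta := eps * expR (- A ^+ 2).
have eta0 : 0 < eta by rewrite mulr_gt0 ?expR_gt0// (sd_eps H).
have M0 := bound_ge0 H.
(* The roles of the sets are exchanged. Passing from [f] to [p] and back costs a factor 2 each time:
   M mass(S1, f) is at most 2 M mass(S1, p), hence (eta / 2) mass(S2, p), hence eta mass(S2, f), up
   to terms in [r]; that last mass is cancelled by the negative part of q(f). *)
have [w [m [w0 sw wP]]] := absorb H' (2 * M) (divr_gt0 eta0 (ltr0n _ 2)).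
have [B B1 BP] := fock_tail (sd_A H).
have B0 : 0 < B by exact: lt_le_trans B1.
pose disc_area := plane_int (fun p => disc_weight A (tc p)).
have disc_area0 : 0 <= disc_area by apply: plane_int_ge0 => p; exact: disc_weight_ge0.
pose K := (2 * M + eta) * disc_area.
have K0 : 0 <= K.
  by apply: mulr_ge0 => //; apply: addr_ge0; [exact: mulr_ge0|exact: ltW].
exists ((1 + K) * B ^+ 2), m; split.
  by rewrite -[1]mulr1 ler_pM ?mulr1 ?exprn_ege1// lerDl.
move=> lam n mn HE.
have C0 : 0 <= (1 + K) * B ^+ 2 by rewrite mulr_ge0 ?addr_ge0// sqr_ge0.
(* Here N = 2n - m - 2 and n + k = N + 1: exactly one unknown more than coefficients. The hypothesis
   on [n] keeps the truncated subtractions exact. *)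
pose k := (n - m.+1)%N; pose N := (k.*2 + m)%N.
have NE : (n.*2 - m.+2)%N = N by rewrite /N /k; move: mn; clear; lia.
have Nnk : (N < n + k)%N by rewrite /N /k; move: mn; clear; lia.
have N2n : (N.+1 <= 2 * n)%N by rewrite /N /k; move: mn; clear; lia.
rewrite NE.
have [lam_ge0 lam_mono _] := HE.
have n0 : (0 < n)%N by exact: leq_ltn_trans mn.
have := lam_ge0 n n0; rewrite le_eqVlt => /predU1P[<-|lamn]; first by rewrite mul0r exprn_ge0.
have [e [eE _ eU]] := eigen_family HE.
have lamj j : (j < n)%N -> 0 < lam j.+1 by move=> jn; exact: lt_le_trans lamn (lam_mono _ _ _ jn).
have fe j : (j < n)%N -> fock (e j.+1) by move=> /lamj lj; have [] := eE j.+1 isT lj.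
have ea j : exists a, (j < n)%N -> expands (e j.+1) a.
  by have [/fe/fockP[_ [a ?]]|_] := ltnP j n; [exists a|exists (fun=> 0)].
have [a {}ea] := choice ea.
have [b [sb bf bm]] := mass_family_nat k H'.
have [d [y [[j jn dj] [fa fp]]]] := matching_combination sw sb (erefl N) Nnk bf ea.
pose f : CF := fun z => \sum_(j < n) d j * e j.+1 z.
pose p : {poly R[i]} := w * \sum_(i < k) y i *: b i.
have ff : fock f by apply: (@fock_sum R (fun j z => d j * e j.+1 z)) => i /fe; exact: fockZ.
have lf := fock_L2 ff; have lp := L2_horner p.
have mV := symbol_mfun H; have VB := symbol_bound H; have A0 := sd_A H; have Vs := symbol_support H.
have f0 : 0 < fock_norm2 f.
  rewrite lt_def fock_norm2_ge0 andbT; apply/eqP => /(fock_norm2_eq0 ff) f0.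
  have := eigen_span_free mV VB A0 Vs lamn lam_mono eE eU (d := d) (fun z => congr1 (fun h => h z) f0) jn.
  by move/eqP; rewrite (negbTE dj).
have q1 : lam n * fock_norm2 f <= complex.Re (symbol_dot (signed_symbol b1 b2 S1 S2) f f).
  by apply: (eigen_span_lower mV VB A0 Vs lamn lam_mono eE (d := d)).
have q2 := symbol_quad_le H lf.
(* The Taylor polynomial of [f] below [N] is -p, so [r] is the tail controlled by [fock_tail]. *)
pose r : CF := fun z => f z + p.[z].
have lr : L2 r by exact: L2D.
pose D := fock_norm2 f * (B ^+ N.+1 / N`!%:R).
have D0 : 0 <= D by rewrite mulr_ge0 ?(ltW f0)// divr_ge0// exprn_ge0// ltW.
have rD z : nc z <= A -> nc (r z) ^+ 2 <= D.
  by move=> zA; have := BP f _ fa lf N z zA; rewrite fp opprK.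
have r1 := mass_sup (sd_m1 H) (sd_S1 H) lr D0 rD.
have r2 := mass_sup (sd_m2 H) (sd_S2 H) lr D0 rD.
have lpN : L2 (fun z => (-1) * p.[z]) by exact: L2Z.
have lfN : L2 (fun z => (-1) * f z) by exact: L2Z.
have massN S g : mass S (fun z => (-1) * g z) = mass S g.
  by congr plane_int; apply/funext => x; rewrite mulN1r normcN.
have s1 : mass S1 f <= 2 * mass S1 (horner p) + 2 * mass S1 r.
  have := mass_add (sd_m1 H) (sd_S1 H) lpN lr; rewrite massN.
  by apply: le_trans; rewrite le_eqVlt; apply/orP; left; apply/eqP; congr (mass S1 _); apply/funext => z; rewrite /r; ring.
have s2 : mass S2 (horner p) <= 2 * mass S2 f + 2 * mass S2 r.
  have := mass_add (sd_m2 H) (sd_S2 H) lfN lr; rewrite massN.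
  by apply: le_trans; rewrite le_eqVlt; apply/orP; left; apply/eqP; congr (mass S2 _); apply/funext => z; rewrite /r; ring.
have s3 := wP _ (bm y).
have M1 := ler_wpM2l M0 s1; have E2 := ler_wpM2l (ltW eta0) s2.
have qK : lam n * fock_norm2 f <= K * D.
  have h1 := ler_wpM2l M0 r1; have h2 := ler_wpM2l (ltW eta0) r2.
  rewrite -/p -/disc_area in s3 h1 h2 *; rewrite -/eta in q2.
  have -> : K * D = 2 * (M * (D * disc_area)) + eta * (D * disc_area) by rewrite /K; ring.
  move: q1 q2 s3 M1 E2 h1 h2; clear; lra.
have lamD : lam n <= K * (B ^+ N.+1 / N`!%:R).
  by rewrite -(ler_pM2r f0) (le_trans qK)// /D le_eqVlt; apply/orP; left; apply/eqP; ring.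
have NF : 0 < N`!%:R :> R by rewrite ltr0n fact_gt0.
apply: (@le_trans _ _ (K * B ^+ N.+1)).
  by rewrite -ler_pdivlMr// -mulrA.
rewrite exprMn ler_pM ?exprn_ge0 ?(ltW B0)//.
  apply: (@le_trans _ _ (1 + K)); first by rewrite lerDr.
  have k1 : 1 <= 1 + K by rewrite lerDl.
  by case: (n) n0 => // n' _; rewrite exprS ler_peMr ?exprn_ege1// (le_trans _ k1).
by rewrite -exprM ler_weXn2l.
Qed.

End EigenvalueUpperBound.

(** * Asymptotics *)

Section Asymptotics.
Context {R : realType}.

Lemma ln_fact_le (n : nat) : (0 < n)%N -> ln (n`!%:R : R) <= n%:R * ln n%:R.
Proof.
move=> n0; rewrite mulr_natl -lnXn ?ltr0n// ler_ln ?posrE ?exprn_gt0 ?ltr0n ?fact_gt0//.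
by rewrite -natrX ler_nat fact_le_expn.
Qed.

Lemma ln_fact_ge (n : nat) : (0 < n)%N -> n%:R * ln n%:R - n%:R <= ln (n`!%:R : R).
Proof.
move=> n0; have f0 : 0 < n`!%:R :> R by rewrite ltr0n fact_gt0.
rewrite lerBlDr mulr_natl -lnXn ?ltr0n// -[X in _ <= _ + X]expRK -lnM ?posrE ?expR_gt0//.
by rewrite ler_ln ?posrE ?exprn_gt0 ?ltr0n ?mulr_gt0 ?expR_gt0// pow_le_expR.
Qed.

Lemma ln_nat_le (n : nat) : (0 < n)%N -> 0 <= ln (n%:R : R) <= n%:R.
Proof.
move=> n0; rewrite ln_ge0 ?ler1n//=.
by apply/ltW/ln_sublinear; rewrite ltr0n.
Qed.

Variables (lam : nat -> R) (C C' : R) (m m' : nat).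
Hypotheses (C1 : 1 <= C) (C'1 : 1 <= C')
  (lamC : forall n, (0 < n)%N -> 1 <= lam n * (C ^+ n * (n.*2 + m)`!%:R))
  (lamC' : forall n, (m'.+1 < n)%N -> lam n * ((n.*2 - m'.+2)`!%:R) <= C' ^+ n).

Let lam_gt0 n : (0 < n)%N -> 0 < lam n.
Proof.
move=> n0; have F0 : 0 < C ^+ n * (n.*2 + m)`!%:R.
  by rewrite mulr_gt0 ?ltr0n ?fact_gt0// exprn_gt0// (lt_le_trans _ C1).
by rewrite -(pmulr_lgt0 _ F0) (lt_le_trans _ (lamC n0)).
Qed.

(** Both factorials are (2n + O(1))!, with logarithm 2 n log n + O(n). The bounded shift contributes
    a multiple of log n <= n. The range of [n] ensures 2n + m <= 3n and 2n - m' - 2 >= n. *)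
Lemma ln_eigenvalue_bound : exists2 K, 0 < K & forall n, (m + m' + 2 < n)%N ->
  `|ln (lam n) + 2 * n%:R * ln n%:R| <= K * n%:R.
Proof.
have lC : 0 <= ln C by exact: ln_ge0.
have lC' : 0 <= ln C' by exact: ln_ge0.
have l3 : 0 <= ln (3 : R) by rewrite ln_ge0// ler1n.
exists (ln C + m%:R + 3 * ln 3 + (ln C' + m'.+2%:R + 2)) => [|n nm].
  by rewrite ltr_wpDl// ?addr_ge0 ?mulr_ge0// ltr_wpDl// addr_ge0.
have C0 : 0 < C by exact: lt_le_trans C1.
have C'0 : 0 < C' by exact: lt_le_trans C'1.
have n0 : (0 < n)%N by move: nm; clear; lia.
have nR : 0 < n%:R :> R by rewrite ltr0n.
have ln0 := lam_gt0 n0.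
have /andP[lnn0 lnn] := ln_nat_le n0.
rewrite ler_norml; apply/andP; split.
  have F0 : 0 < (n.*2 + m)`!%:R :> R by rewrite ltr0n fact_gt0.
  have : 0 <= ln (lam n) + (n%:R * ln C + ln (n.*2 + m)`!%:R).
    rewrite mulr_natl -lnXn// -lnM ?posrE ?exprn_gt0// -lnM ?posrE ?mulr_gt0 ?exprn_gt0//.
    by apply: ln_ge0; exact: lamC.
  have k0 : (0 < n.*2 + m)%N by move: n0; clear; lia.
  have h1 := ln_fact_le k0.
  have h2 : ln (n.*2 + m)%:R <= ln n%:R + ln (3 : R).
    rewrite -lnM ?posrE// ler_ln ?posrE ?mulr_gt0 ?ltr0n// -natrM ler_nat.
    by move: nm; clear; lia.
  have h3 : (n.*2 + m)%:R * ln (n.*2 + m)%:R <= (n.*2 + m)%:R * (ln n%:R + ln (3 : R)) by rewrite ler_wpM2l.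
  have h4 : (n.*2 + m)%:R * (ln n%:R + ln (3 : R)) <= 2 * n%:R * ln n%:R + m%:R * n%:R + 3 * ln 3 * n%:R.
    have -> : (n.*2 + m)%:R = 2 * n%:R + m%:R :> R by rewrite natrD -muln2 natrM mulrC.
    have a1 : m%:R * ln n%:R <= m%:R * n%:R :> R by rewrite ler_wpM2l.
    have a2 : m%:R * ln (3 : R) <= n%:R * ln 3.
      by rewrite ler_wpM2r// ler_nat; move: nm; clear; lia.
    by move: a1 a2; lra.
  have b1 : 0 <= (ln C' + m'.+2%:R + 2) * n%:R by rewrite mulr_ge0 ?addr_ge0// ltW.
  move: h1 h3 h4 b1; lra.
pose k := (n.*2 - m'.+2)%N.
have kn : (n <= k)%N by rewrite /k; move: nm; clear; lia.
have kE : k%:R = 2 * n%:R - m'.+2%:R :> R.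
  by rewrite /k natrB; [rewrite -muln2 natrM mulrC|move: nm; clear; lia].
have k0 : (0 < k)%N by exact: leq_trans kn.
have F0 : 0 < k`!%:R :> R by rewrite ltr0n fact_gt0.
have : ln (lam n) + ln k`!%:R <= n%:R * ln C'.
  rewrite mulr_natl -lnXn// -lnM ?posrE// ler_ln ?posrE ?mulr_gt0 ?exprn_gt0//.
  by apply: lamC'; move: nm; clear; lia.
have h1 := ln_fact_ge k0.
have h2 : k%:R * ln n%:R <= k%:R * ln k%:R :> R.
  by rewrite ler_wpM2l// ler_ln ?posrE ?ltr0n// ler_nat.
have h3 : m'.+2%:R * ln n%:R <= m'.+2%:R * n%:R :> R by rewrite ler_wpM2l.
have h4 : k%:R <= 2 * n%:R :> R by rewrite kE gerBl.
have b1 : 0 <= (ln C + m%:R + 3 * ln 3) * n%:R.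
  by rewrite mulr_ge0 ?(ltW nR)// addr_ge0 ?mulr_ge0// addr_ge0.
have h5 : k%:R * ln n%:R = 2 * n%:R * ln n%:R - m'.+2%:R * ln n%:R :> R by rewrite kE mulrBl.
move: h1 h2 h3 h4 h5 b1; lra.
Qed.

Lemma sharp_of_bounds : sharp_asymptotics lam.
Proof.
have [K K0 HK] := ln_eigenvalue_bound; split.
  by exists 1%N => // n /= n0; exact: lam_gt0.
apply/eqaddOP; near=> k; near=> n.
rewrite /= opprK (le_trans (HK n _))//; first by near: n; exists (m + m' + 2).+1.
rewrite [`|n%:R|]ger0_norm//.
by apply: ler_wpM2r.
Unshelve. all: by end_near.
Qed.

(** The exact remainder r(n) = log lam_n + 2 n log n serves on both sides, where the inequalities
    become equalities. It is O(n), hence o(n log n) since log n tends to infinity. *)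
Lemma nlogn_of_bounds : nlogn_bounds lam 2^-1 2^-1.
Proof.
have [K K0 HK] := ln_eigenvalue_bound.
pose r n : R^o := ln (lam n) + 2 * n%:R * ln n%:R.
have ro : r =o_\oo (fun n => n%:R * ln n%:R : R^o).
  apply/eqoP => e e0; near=> n.
  have n0 : (0 < n)%N by near: n; exists 1%N.
  have nR : 0 < n%:R :> R by rewrite ltr0n.
  apply: (@le_trans _ _ (K * n%:R)).
    by apply: HK; near: n; exists (m + m' + 2).+1.
  have /andP[l0 _] := ln_nat_le n0.
  rewrite [X in _ <= _ * X]ger0_norm ?mulr_ge0// mulrCA mulrC ler_pM2l//.
  rewrite -ler_pdivrMl// mulrC -[leLHS]expRK ler_ln ?posrE ?expR_gt0//.
  by near: n; exact: nbhs_infty_ger.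
exists r, r; split => //; exists 1%N => // n /= n0.
suff -> : expR (- (n%:R * ln n%:R / 2^-1) + r n) = lam n by rewrite !lexx.
have -> : - (n%:R * ln n%:R / 2^-1) + r n = ln (lam n).
  by rewrite /r invrK; ring.
by rewrite lnK// posrE lam_gt0.
Unshelve. all: by end_near.
Qed.

End Asymptotics.

(** * Reduction of the hypotheses to Borel symbols *)

Section BorelData.
Context {R : realType}.
Local Notation nc := (@Normc.normc R).
Local Notation tc := (@to_complex R).
Local Notation mR := (measurableTypeR R).
Local Notation mu := (planar_lebesgue R).

Lemma symbol_data_asymptotics b1 b2 S1 S2 (A M eps : R) lam : symbol_data b1 b2 S1 S2 A M eps ->
  positive_eigenvalues (signed_symbol b1 b2 S1 S2) lam ->
  nlogn_bounds lam 2^-1 2^-1 /\ sharp_asymptotics lam.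
Proof.
move=> H HE; have [C [m [C1 h1]]] := eigenvalue_ge H; have [C' [m' [C'1 h2]]] := eigenvalue_le H.
have k1 n : (0 < n)%N -> 1 <= lam n * (C ^+ n * (n.*2 + m)`!%:R) by move=> n0; exact: h1.
have k2 n : (m'.+1 < n)%N -> lam n * ((n.*2 - m'.+2)`!%:R) <= C' ^+ n by move=> nm; exact: h2.
by split; [exact: nlogn_of_bounds C1 C'1 k1 k2|exact: sharp_of_bounds C1 C'1 k1 k2].
Qed.

Lemma compact_domain_disc (Om : set R[i]^o) : compact_domain Om ->
  exists a r, 0 < r /\ forall z, nc (z - a) <= r -> Om z.
Proof.
move=> [_ [D [oD _ [a Da] ->]]].
have /nbhs_normcP[e e0 He] : nbhs a D by move: oD; rewrite openE => /(_ _ Da).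
exists a, (e / 2); split; first exact: divr_gt0.
move=> z za; apply: subset_closure; apply: He; rewrite (le_lt_trans za)//.
by rewrite ltr_pdivrMr// mulr_natr mulr2n ltrDl.
Qed.

Lemma inf_image_le (v : R[i]^o -> R) M (S : set R[i]^o) z :
  (forall z, 0 <= v z <= M) -> S z -> inf (v @` S) <= v z.
Proof.
move=> vM Sz; apply: ge_inf; last by exists z.
by exists 0 => _ [y _ <-]; have /andP[] := vM y.
Qed.

(** [eps] is the smaller of the two infima and [A], [M] are sums of the individual bounds, so that
    single constants serve both sets. Separation is applied in both orders. *)
Lemma borel_symbol_data (Op Om : set R[i]^o) (vp vm : R[i]^o -> R) :
  compact_domain Op -> compact_domain Om ->
  closed_convex_hull Op `&` closed_convex_hull Om = set0 ->
  lebesgue_measurable_fun vp -> lebesgue_measurable_fun vm ->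
  (exists M, forall z, 0 <= vp z <= M) -> (exists M, forall z, 0 <= vm z <= M) ->
  0 < inf (vp @` Op) -> 0 < inf (vm @` Om) ->
  (exists (theta : R) (c : R[i]^o) (phi : R[i]^o -> R[i]^o),
    [/\ (forall z, phi z = expi theta * z + c) \/
        (forall z, phi z = expi theta * z^* + c),
        phi @` Op = Om & phi @` Om = Op]) ->
  exists bp bm A M eps, symbol_data bp bm Op Om A M eps /\
    {ae mu, forall p, signed_symbol vp vm Op Om (tc p) = signed_symbol bp bm Op Om (tc p)}.
Proof.
move=> Opd Omd disj mp mm [Mp vpM] [Mm vmM] ip im sym.
have dp := compact_domain_disc Opd; have dm := compact_domain_disc Omd.
have [cp _] := Opd; have [cm _] := Omd.
have clp : closed Op by apply: compact_closed => //; exact: norm_hausdorff.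
have clm : closed Om by apply: compact_closed => //; exact: norm_hausdorff.
have [Ap Ap0 HAp] := compact_normc cp; have [Am Am0 HAm] := compact_normc cm.
have Mp0 : 0 <= Mp by have /andP[] := vpM 0; exact: le_trans.
have Mm0 : 0 <= Mm by have /andP[] := vmM 0; exact: le_trans.
pose A := Ap + Am; pose M := Mp + Mm; pose eps := Num.min (inf (vp @` Op)) (inf (vm @` Om)).
have eps0 : 0 < eps by rewrite lt_min ip im.
have hp z : Op z -> nc z <= A by move=> /HAp h; rewrite (le_trans h)// lerDl.
have hm z : Om z -> nc z <= A by move=> /HAm h; rewrite (le_trans h)// lerDr.
have vpM' z : 0 <= vp z <= M by have /andP[-> h] := vpM z; rewrite (le_trans h)// lerDl.
have vmM' z : 0 <= vm z <= M by have /andP[-> h] := vmM z; rewrite (le_trans h)// lerDr.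
have lp z : Op z -> eps <= vp z.
  by move=> Oz; rewrite (le_trans _ (inf_image_le vpM Oz))// ge_min lexx.
have lm z : Om z -> eps <= vm z.
  by move=> Oz; rewrite (le_trans _ (inf_image_le vmM Oz))// ge_min lexx orbT.
have mOp := measurable_closed clp; have mOm := measurable_closed clm.
have [bp [mbp bpM bpl bpv]] := borel_version mOp mp vpM' (ltW eps0) lp.
have [bm [mbm bmM bml bmv]] := borel_version mOm mm vmM' (ltW eps0) lm.
have nep : Op !=set0.
  by have [a [r [r0 Hr]]] := dp; exists a; apply: Hr; rewrite subrr Normc.normc0 ltW.
have nem : Om !=set0.
  by have [a [r [r0 Hr]]] := dm; exists a; apply: Hr; rewrite subrr Normc.normc0 ltW.
have s1 : exists c k1 k2, [/\ 0 <= k1, k1 < k2, forall z, Op z -> k2 <= nc (z + c) ^+ 2 &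
    forall z, Om z -> nc (z + c) ^+ 2 <= k1].
  by apply: (@separating_linear _ _ _ A) => // z [/hp|/hm].
have s2 : exists c k1 k2, [/\ 0 <= k1, k1 < k2, forall z, Om z -> k2 <= nc (z + c) ^+ 2 &
    forall z, Op z -> nc (z + c) ^+ 2 <= k1].
  apply: (@separating_linear _ _ _ A) => //; first by rewrite setIC.
  by move=> z [/hm|/hp].
exists bp, bm, A, M, eps; split; first by split => //; exact: addr_ge0.
by apply: ae_mono (ae_and bpv bmv) => p [h1 h2]; rewrite /signed_symbol h1 h2.
Qed.

End BorelData.

Theorem theorem1p3 (R : realType)
  (Op Om : set R[i]^o) (vp vm : R[i]^o -> R) (lamp lamm : nat -> R)
  (Op_dom : compact_domain Op) (Op_lip : lipschitz_boundary Op)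
  (Om_dom : compact_domain Om) (Om_lip : lipschitz_boundary Om)
  (hull_disj : closed_convex_hull Op `&` closed_convex_hull Om = set0)
  (vp_meas : lebesgue_measurable_fun vp) (vm_meas : lebesgue_measurable_fun vm)
  (vp_bnd : exists M, forall z, 0 <= vp z <= M)
  (vm_bnd : exists M, forall z, 0 <= vm z <= M)
  (vp_inf : 0 < inf (vp @` Op)) (vm_inf : 0 < inf (vm @` Om))
  (symmetric : exists (theta : R) (c : R[i]^o) (phi : R[i]^o -> R[i]^o),
    [/\ (forall z, phi z = expi theta * z + c) \/
        (forall z, phi z = expi theta * z^* + c),
        phi @` Op = Om & phi @` Om = Op])
  (lamp_eig : positive_eigenvalues (signed_symbol vp vm Op Om) lamp)
  (lamm_eig :
     positive_eigenvalues (fun z => - signed_symbol vp vm Op Om z) lamm) :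
  (nlogn_bounds lamp 2^-1 2^-1 /\ nlogn_bounds lamm 2^-1 2^-1) /\
  (sharp_asymptotics lamp /\ sharp_asymptotics lamm).
Proof.
have [bp [bm [A [M [eps [H VE]]]]]] := borel_symbol_data Op_dom Om_dom hull_disj
  vp_meas vm_meas vp_bnd vm_bnd vp_inf vm_inf symmetric.
(* The exchanged data describe the opposite symbol, whose positive eigenvalues are [lamm]. *)
have H' := symbol_data_swap H.
have [h1 h2] := symbol_data_asymptotics H
  (positive_eigenvalues_ae (symbol_mfun H) (symbol_bound H) VE lamp_eig).
have VE' : {ae planar_lebesgue R, forall p,
    - signed_symbol vp vm Op Om (to_complex p) = signed_symbol bm bp Om Op (to_complex p)}.
  by apply: ae_mono VE => p h; rewrite (signed_symbolN bp bm) h.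
have [h3 h4] := symbol_data_asymptotics H'
  (positive_eigenvalues_ae (symbol_mfun H') (symbol_bound H') VE' lamm_eig).
by [].
Qed.
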